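(* Let $c\in\mathbb{R}$, $J_+=[c,\infty)$ and $J_-=(-\infty,c)$. For each choice of the sign $\pm$, the minimal relation $\mathrm{T}_{\min,\pm}$ is symmetric in $\mathcal{H}(J_\pm)$ with $$\mathrm{T}_{\min,\pm}^\ast=\mathrm{T}_{\max,\pm},\qquad \mathrm{T}_{\max,\pm}^\ast=\mathrm{T}_{\min,\pm}.$$ In particular, the linear relations $\mathrm{T}_{\min,\pm}$ and $\mathrm{T}_{\max,\pm}$ are closed.
   Context: Let $\omega$ be a real-valued Borel measure on $\mathbb{R}$ and $\upsilon$ a non-negative Borel measure on $\mathbb{R}$ (both locally finite; so $\omega$ is a signed measure assigning finite values to bounded Borel sets). The superscript $^\ast$ on numbers and functions denotes complex conjugation. For a Borel measure $\mu$, $\int_x^y f\,d\mu$ means $\int_{[x,y)}f\,d\mu$ if $y>x$, $0$ if $y=x$, and $-\int_{[y,x)}f\,d\mu$ if $y<x$. Let $\mathcal{H}_{\mathrm{loc}}(\mathbb{R})=H^1_{\mathrm{loc}}(\mathbb{R})\times L^2_{\mathrm{loc}}(\mathbb{R};\upsilon)$, where $H^1_{\mathrm{loc}}(\mathbb{R})$ consists of locally absolutely continuous functions with locally square integrable derivative; components of $f\in\mathcal{H}_{\mathrm{loc}}(\mathbb{R})$ are denoted $f_1,f_2$. The linear relation $\mathrm{T}_{\mathrm{loc}}$ consists of all pairs $(f,g)\in\mathcal{H}_{\mathrm{loc}}(\mathbb{R})\times\mathcal{H}_{\mathrm{loc}}(\mathbb{R})$ such that $-f_1''+\frac14 f_1=\omega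 g_1+\upsilon g_2$ in the sense of distributions and $f_2=g_1$ almost everywhere with respect to $\upsilon$. For such a pair, $f_1'$ always denotes the left-continuous representative satisfying $-f_1'(y)+f_1'(x)+\frac14\int_x^y f_1(s)\,ds=\int_x^y g_1\,d\omega+\int_x^y g_2\,d\upsilon$ for all $x,y\in\mathbb{R}$. An element of $\mathrm{T}_{\mathrm{loc}}$ is written $\mathbf{f}=(f,\tau f)$. $\mathcal{H}(J_\pm)=H^1(J_\pm)\times L^2(J_\pm;\upsilon)$ is the Hilbert space with scalar product $$\langle f,g\rangle=\frac14\int_{J_\pm} f_1g_1^\ast\,dx+\int_{J_\pm} f_1'(g_1')^\ast\,dx+\int_{J_\pm} f_2g_2^\ast\,d\upsilon .$$ The maximal relation is $\mathrm{T}_{\max,\pm}=\{\mathbf{f}\in\mathcal{H}(J_\pm)\times\mathcal{H}(J_\pm) : \mathbf{f}=\mathbf{g}|_{J_\pm}\text{ for some }\mathbf{g}\in\mathrm{T}_{\mathrm{loc}}\}$. For $\mathbf f\in\mathrm{T}_{\max,\pm}$ the quantities $f_1(x),f_1'(x),\tau f_1(x)$, for $x$ in the closure of $J_\pm$, are defined through any representative in $\mathrm{T}_{\mathrm{loc}}$ (they do not depend on the choice). The minimal relation is $$\mathrm{T}_{\min,\pm}=\{\mathbf{f}\in\mathrm{T}_{\max,\pm}:\tau f_1(c)=f_1'(c)=0\}.$$ The adjoint of a linear relation $\mathrm{S}$ in a Hilbert space is $\mathrm{S}^\ast=\{(u,v):\langle u,k\rangle=\langle v,h\rangle\text{ for all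 }(h,k)\in\mathrm{S}\}$; $\mathrm{S}$ is symmetric if $\mathrm{S}\subseteq\mathrm{S}^\ast$. *)

(* Defs.v *)
(* Written over MathComp-Analysis; [R[i]] is the field of complex numbers over
   [R : realType], from mathcomp-real-closed. *)
From HB Require Import structures.
From mathcomp Require Import all_boot all_order all_algebra.
From mathcomp Require Import complex.
From mathcomp Require Import all_classical all_reals all_analysis.

Set Implicit Arguments.
Unset Strict Implicit.
Unset Printing Implicit Defensive.

Import Order.TTheory GRing.Theory Num.Theory.
Import numFieldNormedType.Exports.

Local Open Scope classical_set_scope.
Local Open Scope ring_scope.
Local Open Scope complex_scope.

Local Notation Re := complex.Re.
Local Notation Im := complex.Im.

(** Locally finite measures *)

(* The values of [smeas] matter on bounded Borel sets only: since the positive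
   and the negative part may both be infinite, a locally finite signed measure
   need not extend to all Borel sets, so the library's charges do not apply. *)
Record lf_signed_measure (R : realType) := LFSignedMeasure {
  smeas :> set (measurableTypeR R) -> R ;
  smeas0 : smeas set0 = 0 ;
  smeas_sigma_additive : forall F : (set (measurableTypeR R))^nat,
    (forall n, measurable (F n)) -> trivIset setT F ->
    bounded_set (\bigcup_n F n) ->
    (fun n => \sum_(0 <= i < n) smeas (F i)) @ \oo --> smeas (\bigcup_n F n) }.

Definition locally_finite (R : realType) (mu : {measure set (measurableTypeR R) -> \bar R}) :=
  forall A : set (measurableTypeR R), measurable A -> bounded_set A -> (mu A < +oo)%E.

Section signed_restr.
Context (R : realType) (omega : lf_signed_measure R) (a b : R).

Definition signed_restr (B : set (measurableTypeR R)) : \bar R := (omega (B `&` `[a, b[))%:E.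

Let signed_restr0 : signed_restr set0 = 0%E.
Proof. by rewrite /signed_restr set0I smeas0. Qed.

Let signed_restr_fin B : measurable B -> signed_restr B \is a fin_num.
Proof. by []. Qed.

Let bounded_restr (B : set R) : bounded_set (B `&` `[a, b[).
Proof.
apply: (@sub_boundedr _ _ _ _ (globally `[a, b])); last first.
  exact/compact_bounded/segment_compact.
move=> P /= PP x [_]; rewrite /= in_itv/= => /andP[ax xb]; apply: PP.
by rewrite /= in_itv/= ax ltW.
Qed.

Let signed_restr_sigma_additive : semi_sigma_additive signed_restr.
Proof.
move=> F mF tF _; rewrite /signed_restr setI_bigcupl.
under eq_fun do rewrite sumEFin.
apply: cvg_EFin; first exact: nearW.
apply: smeas_sigma_additive => [n||].
- exact: measurableI.
- exact: trivIset_setIr.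
- by rewrite -setI_bigcupl; exact: bounded_restr.
Qed.

HB.instance Definition _ := isCharge.Build _ _ _ signed_restr
  signed_restr0 signed_restr_fin signed_restr_sigma_additive.

Let hahn := cid (Hahn_decomposition signed_restr).
Let hahnPN := svalP (cid (svalP hahn)).

(* The integral over [a, b) with respect to omega, by the Jordan decomposition
   of the finite charge B |-> omega (B n [a, b)); the Hahn sets are unique up to
   null sets, so the chosen ones are irrelevant. *)
Definition sint (f : R -> R) : R :=
  \int[jordan_pos hahnPN]_(x in `[a, b[) f x -
  \int[jordan_neg hahnPN]_(x in `[a, b[) f x.

End signed_restr.

Section definitions.
Context {R : realType}.
Implicit Types (mu upsilon : {measure set (measurableTypeR R) -> \bar R}).
Implicit Types (omega : lf_signed_measure R) (J D : set (measurableTypeR R)).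

Local Notation leb := (@lebesgue_measure R).

(** Complex-valued integrals and derivatives *)

Definition cint mu D (f : R -> R[i]) : R[i] :=
  (\int[mu]_(x in D) Re (f x)) +i* (\int[mu]_(x in D) Im (f x)).

Definition csint omega (a b : R) (f : R -> R[i]) : R[i] :=
  sint omega a b (fun x => Re (f x)) +i* sint omega a b (fun x => Im (f x)).

(* The oriented integrals from x to y, over [x, y) or [y, x); both branches
   vanish for x = y. *)
Definition oint mu (x y : R) (f : R -> R[i]) : R[i] :=
  if x <= y then cint mu `[x, y[ f else - cint mu `[y, x[ f.

Definition osint omega (x y : R) (f : R -> R[i]) : R[i] :=
  if x <= y then csint omega x y f else - csint omega y x f.

Definition is_cderive (f : R -> R[i]) (x : R) (z : R[i]) :=
  is_derive x 1 (fun y => Re (f y)) (Re z) /\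
  is_derive x 1 (fun y => Im (f y)) (Im z).

Definition cderive1 (f : R -> R[i]) (x : R) : R[i] :=
  derive1 (fun y => Re (f y)) x +i* derive1 (fun y => Im (f y)) x.

(** Function spaces. Elements of L^2 and of H(J) are represented by functions
    on R whose values outside J are irrelevant; two representatives are
    identified when they agree on J, almost everywhere with respect to the
    measure in question. All relations below are invariant under this. *)

Definition L2 mu D (f : R -> R[i]) :=
  [/\ measurable_fun D (fun x => Re (f x)),
      measurable_fun D (fun x => Im (f x)) &
      (\int[mu]_(x in D) (Re (f x) ^+ 2 + Im (f x) ^+ 2)%:E < +oo)%E].

Definition abs_continuous (a b : R) (f : R -> R) :=
  forall e : R, 0 < e -> exists2 d : R, 0 < d &
    forall (n : nat) (s t : nat -> R),
      (forall i, (i < n)%N -> [/\ a <= s i, s i <= t i & t i <= b]) ->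
      trivIset `I_n (fun i => `]s i, t i[%classic) ->
      \sum_(i < n) (t i - s i) < d ->
      \sum_(i < n) `|f (t i) - f (s i)| < e.

Definition loc_abs_continuous J (f : R -> R[i]) :=
  forall a b : R, `[a, b] `<=` J ->
    abs_continuous a b (fun x => Re (f x)) /\
    abs_continuous a b (fun x => Im (f x)).

Definition ae_derivative J (f h : R -> R[i]) :=
  {ae leb, forall x, J x -> is_cderive f x (h x)}.

Definition H1J J (f : R -> R[i]) :=
  [/\ loc_abs_continuous J f, L2 leb J f &
      exists2 h, ae_derivative J f h & L2 leb J h].

Definition H1loc (f : R -> R[i]) :=
  loc_abs_continuous setT f /\
  exists2 h, ae_derivative setT f h & forall a b, L2 leb `[a, b] h.

Definition L2loc mu (f : R -> R[i]) := forall a b, L2 mu `[a, b] f.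

Definition vec : Type := ((R -> R[i]) * (R -> R[i]))%type.

Definition vsub (f g : vec) : vec :=
  (fun x => f.1 x - g.1 x, fun x => f.2 x - g.2 x).

Definition Hloc upsilon (f : vec) := H1loc f.1 /\ L2loc upsilon f.2.

Definition HJ upsilon J (f : vec) := H1J J f.1 /\ L2 upsilon J f.2.

Definition dotH upsilon J (f g : vec) : R[i] :=
  4^-1 * cint leb J (fun x => f.1 x * (g.1 x)^*) +
  cint leb J (fun x => cderive1 f.1 x * (cderive1 g.1 x)^*) +
  cint upsilon J (fun x => f.2 x * (g.2 x)^*).

Definition eqH upsilon J (f g : vec) :=
  (forall x, J x -> f.1 x = g.1 x) /\
  {ae upsilon, forall x, J x -> f.2 x = g.2 x}.

(** Linear relations in H(J), as sets of pairs of representatives *)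

Definition adjoint upsilon J (S : set (vec * vec)) : set (vec * vec) :=
  [set F | [/\ HJ upsilon J F.1, HJ upsilon J F.2 &
    forall K, S K -> dotH upsilon J F.1 K.2 = dotH upsilon J F.2 K.1]].

Definition symmetric_rel upsilon J (S : set (vec * vec)) :=
  S `<=` adjoint upsilon J S.

Definition sqnormH upsilon J (f : vec) : R := Re (dotH upsilon J f f).

(* Closedness in H(J) x H(J): every point of the closure belongs to S. *)
Definition closed_rel upsilon J (S : set (vec * vec)) :=
  forall F, HJ upsilon J F.1 -> HJ upsilon J F.2 ->
    (forall e : R, 0 < e -> exists2 K, S K &
      sqnormH upsilon J (vsub F.1 K.1) + sqnormH upsilon J (vsub F.2 K.2) < e) ->
    S F.

(** The differential equation *)

Definition test_function (a b : R) (phi : R -> R) :=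
  (forall n x, derivable (derive1n n phi) x 1) /\
  (forall x, x \notin `[a, b] -> phi x = 0).

(* -f_1'' + f_1 / 4 = omega g_1 + upsilon g_2 as distributions. Real-valued test
   functions are enough by linearity; the integrals are taken over a bounded
   interval outside of which the test function vanishes. *)
Definition distr_eq omega upsilon (f g : vec) :=
  forall (a b : R) (phi : R -> R), test_function a b phi ->
    - cint leb `[a, b[ (fun x => f.1 x * (derive1n 2 phi x)%:C) +
      4^-1 * cint leb `[a, b[ (fun x => f.1 x * (phi x)%:C) =
    csint omega a b (fun x => g.1 x * (phi x)%:C) +
    cint upsilon `[a, b[ (fun x => g.2 x * (phi x)%:C).

(* A pair F = (f, tau f) consists of f = F.1 and tau f = F.2. *)
Definition Tloc omega upsilon : set (vec * vec) :=
  [set F | [/\ Hloc upsilon F.1, Hloc upsilon F.2,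
    distr_eq omega upsilon F.1 F.2 &
    {ae upsilon, forall x, F.1.2 x = F.2.1 x}]].

(* p is the distinguished representative of f_1'. Left-continuity follows from
   the integrated equation, as the integrals are over half-open intervals
   [x, y); together with the first clause it makes p unique. *)
Definition left_derivative omega upsilon (F : vec * vec) (p : R -> R[i]) :=
  {ae leb, forall x, p x = cderive1 F.1.1 x} /\
  forall x y : R,
    - p y + p x + 4^-1 * oint leb x y F.1.1 =
    osint omega x y F.2.1 + oint upsilon x y F.2.2.

Definition is_restriction upsilon J (F G : vec * vec) :=
  eqH upsilon J F.1 G.1 /\ eqH upsilon J F.2 G.2.

Definition Tmax omega upsilon J : set (vec * vec) :=
  [set F | [/\ HJ upsilon J F.1, HJ upsilon J F.2 &
    exists2 G, Tloc omega upsilon G & is_restriction upsilon J F G]].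

(* The values tau f_1(c) and f_1'(c) are read off a representative G in Tloc. *)
Definition Tmin omega upsilon J (c : R) : set (vec * vec) :=
  [set F | Tmax omega upsilon J F /\
    exists G p, [/\ Tloc omega upsilon G, is_restriction upsilon J F G,
      left_derivative omega upsilon G p, G.2.1 c = 0 & p c = 0]].

Definition half_line (plus : bool) (c : R) : set R :=
  if plus then `[c, +oo[%classic else `]-oo, c[%classic.

End definitions.

(* Main.v *)
Require Import Defs.
From mathcomp Require Import all_boot all_order all_algebra.
From mathcomp Require Import complex.
From mathcomp Require Import all_classical all_reals all_analysis.
From mathcomp Require Import measurable_realfun.
From mathcomp Require Import ring lra.

Set Implicit Arguments.
Unset Strict Implicit.
Unset Printing Implicit Defensive.

Import Order.TTheory GRing.Theory Num.Theory.
Import numFieldNormedType.Exports.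

Local Open Scope classical_set_scope.
Local Open Scope ring_scope.

(** The equation is read as a first-order system.  Fix a solution (f, g) with
    g = tau f and second component g2, and let p be the distinguished
    representative of f'.  Integrating by parts, the right-hand side
    omega g + upsilon g2 has an explicit primitive M of locally bounded
    variation, which involves only g, g' and the distribution function of omega,
    and the equation becomes p = p(c) + U/4 - M with U the primitive of f.  In
    the variables D = p + M +- f/2 this system decouples into the two scalar
    equations D' = +- (D - M)/2, which have explicit solutions.  Existence,
    uniqueness and the behaviour at infinity of solutions follow from that
    (mode_exists, mode_unique, modes_solution).  Since omega, upsilon and the constant 1/4 are real,
    real and imaginary parts of all objects may be treated separately.

    Symmetry is Green's identity (green).  For two elements of the maximal
    relation, the difference of the two scalar products is the integral of the
    differential of B = p_f * tau k - p_k * tau f, in which the integrals against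
    omega cancel.  As B is itself integrable on the half-line and has a limit at
    infinity, this limit is zero, and only the boundary value B(c) remains
    (boundary_value).  Hence each of the two relations lies in the adjoint of
    the other.

    For the inclusion of the adjoint of the minimal relation in the maximal one,
    let (u, v) be in the adjoint.  For every compactly supported h in the form
    domain with h(c) = 0 and every h2, the equation with right-hand side
    omega h + upsilon h2 has a solution K which is square integrable on the
    half-line and has vanishing derivative at c: the growing mode is switched off
    beyond the support of the data, the free constant of the decaying mode takes
    care of the condition at c (test_exists).  Testing with K, which is in the
    minimal relation, expresses the scalar product of u with (h, h2) by v alone
    (test_pairing).  The choice h = 0 gives u2 = v1 almost everywhere with
    respect to upsilon, and the choice h' = q - mean of q with
    q = u' - U/4 + M shows that q is constant, which is the equation for u
    (second_component, momentum_constant).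

    For the inclusion of the adjoint of the maximal relation in the minimal one,
    Green's identity is tested with elements of the maximal relation having
    prescribed boundary values at c (boundary_test, cutoff_exists).  Adjoints
    are closed by the Cauchy-Schwarz inequality, and both relations are
    adjoints. *)

(** * Oriented integrals and primitives *)

Section integration.
Context {R : realType}.
Implicit Types (mu : {measure set (measurableTypeR R) -> \bar R}) (f g h : R -> R) (a b c x y z : R).
Local Notation leb := (@lebesgue_measure R).

Definition rint mu x y f : R :=
  if x <= y then \int[mu]_(t in `[x, y[) f t else - \int[mu]_(t in `[y, x[) f t.

Definition locint mu f := forall a b, mu.-integrable `[a, b[ (EFin \o f).

(** The locally bounded Borel functions: they multiply the locally integrable
    functions of every locally finite measure into locally integrable ones. *)
Definition lbm f := measurable_fun [set: R] f /\
  forall a b, exists M, forall x, a <= x <= b -> `|f x| <= M.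

Lemma rint_le mu x y f : x <= y -> rint mu x y f = \int[mu]_(t in `[x, y[) f t.
Proof. by rewrite /rint => ->. Qed.

Lemma rintxx mu x f : rint mu x x f = 0.
Proof. by rewrite /rint lexx set_itvco0 Rintegral_set0. Qed.

Lemma rintC mu x y f : rint mu y x f = - rint mu x y f.
Proof.
have [->|xy] := eqVneq x y; first by rewrite rintxx oppr0.
by rewrite /rint; case: ltgtP xy => // _; rewrite opprK.
Qed.

Lemma Rintegral_cat mu a b c f : mu.-integrable `[a, c[ (EFin \o f) -> a <= b -> b <= c ->
  \int[mu]_(t in `[a, c[) f t = \int[mu]_(t in `[a, b[) f t + \int[mu]_(t in `[b, c[) f t.
Proof.
move=> fi ab bc.
have E : `[a, c[%classic = `[a, b[%classic `|` `[b, c[%classic.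
  by rewrite -itv_bndbnd_setU// bnd_simp.
rewrite E Rintegral_setU//; first by rewrite -E.
apply/disj_setPLR => x/=; rewrite !in_itv/= => /andP[_ xb] /andP[bx _].
by rewrite ltNge bx in xb.
Qed.

Lemma rint_cat mu f : locint mu f -> forall x y z, rint mu x y f + rint mu y z f = rint mu x z f.
Proof.
move=> fi.
have H a b c : a <= b -> b <= c -> rint mu a b f + rint mu b c f = rint mu a c f.
  move=> ab bc; have ac := le_trans ab bc; rewrite !rint_le//.
  by rewrite [RHS](@Rintegral_cat _ _ b).
move=> x y z; have C := @rintC mu; case: (leP x y) => xy; case: (leP y z) => yz; case: (leP x z) => xz.
- exact: H.
- by have := H _ _ _ xy yz; rewrite leNgt in xy; lra.
- have := H _ _ _ xz (ltW yz); rewrite (C z y); lra.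
- have := H _ _ _ (ltW xz) xy; rewrite (C z y) (C z x); lra.
- have := H _ _ _ (ltW xy) xz; rewrite (C y x); lra.
- have := H _ _ _ yz (ltW xz); rewrite (C y x) (C z x); lra.
- by have := H _ _ _ (ltW yz) (ltW xy); lra.
- have := H _ _ _ (ltW yz) (ltW xy); rewrite (C z y) (C y x) (C z x); lra.
Qed.

Lemma locintD mu f g : locint mu f -> locint mu g -> locint mu (fun x => f x + g x).
Proof. by move=> fi gi a b; exact: (integrableD _ (fi a b) (gi a b)). Qed.

Lemma locintN mu f : locint mu f -> locint mu (fun x => - f x).
Proof. by move=> fi a b; exact: (integrableN (fi a b)). Qed.

Lemma locintB mu f g : locint mu f -> locint mu g -> locint mu (fun x => f x - g x).
Proof. by move=> fi gi a b; exact: (integrableB _ (fi a b) (gi a b)). Qed.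

Lemma locintZ mu k f : locint mu f -> locint mu (fun x => k * f x).
Proof. by move=> fi a b; exact: (integrableZl _ _ (fi a b)). Qed.

Lemma rintD mu f g x y : locint mu f -> locint mu g ->
  rint mu x y (fun t => f t + g t) = rint mu x y f + rint mu x y g.
Proof. by move=> fi gi; rewrite /rint; case: ifP => _; rewrite RintegralD// opprD. Qed.

Lemma rintZ mu k f x y : locint mu f -> rint mu x y (fun t => k * f t) = k * rint mu x y f.
Proof. by move=> fi; rewrite /rint; case: ifP => _; rewrite RintegralZl// mulrN. Qed.

Lemma rintN mu f x y : locint mu f -> rint mu x y (fun t => - f t) = - rint mu x y f.
Proof.
move=> fi; rewrite -mulN1r -rintZ//; congr (rint _ _ _ _).
by apply/funext => t; rewrite mulN1r.
Qed.

Lemma rintB mu f g x y : locint mu f -> locint mu g ->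
  rint mu x y (fun t => f t - g t) = rint mu x y f - rint mu x y g.
Proof. by move=> fi gi; rewrite rintD ?rintN//; exact: locintN. Qed.

Lemma lbm_bounded f a b : lbm f -> [bounded f x | x in `[a, b[%classic].
Proof.
move=> [_ /(_ a b) [M Mf]]; exists M; split; first exact: num_real.
move=> N MN x /=; rewrite in_itv/= => /andP[ax xb].
by rewrite (le_trans (Mf x _)) ?ax ?(ltW xb) ?(ltW MN).
Qed.

Lemma locintMl mu f g : lbm f -> locint mu g -> locint mu (fun x => f x * g x).
Proof.
move=> lf gi a b.
apply: (@integrableMr _ _ _ mu `[a, b[ _ f (EFin \o g)) => //.
- exact: measurable_funTS (lf.1).
- exact: lbm_bounded.
Qed.

Lemma lbm_locint mu f : locally_finite mu -> lbm f -> locint mu f.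
Proof.
move=> lmu lf a b; apply: measurable_bounded_integrable => //.
- apply: lmu => //; apply: (@sub_boundedr _ _ _ _ (globally `[a, b])); last first.
    exact/compact_bounded/segment_compact.
  move=> P /= PP x; rewrite /= in_itv/= => /andP[ax xb]; apply: PP.
  by rewrite /= in_itv/= ax ltW.
- exact: measurable_funTS (lf.1).
- exact: lbm_bounded.
Qed.

Lemma lebesgue_locally_finite : locally_finite leb.
Proof.
move=> A mA [M [_ MA]].
have AB : A `<=` `[- (M + 1), M + 1]%classic.
  move=> x Ax; have MM : M < M + 1 by rewrite ltrDl.
  by have := MA _ MM x Ax; rewrite /= in_itv/= ler_norml.
apply: (@le_lt_trans _ _ (leb `[- (M + 1), M + 1]%classic)).
  by apply: le_measure => //; rewrite inE.
by rewrite lebesgue_measure_itv/=; case: ifP => _; rewrite ?ltry// -EFinD ltry.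
Qed.

Lemma lbm_cst k : lbm (fun=> k).
Proof. by split; [exact: measurable_cst|move=> a b; exists `|k|]. Qed.

Lemma lbmD f g : lbm f -> lbm g -> lbm (fun x => f x + g x).
Proof.
move=> [mf bf] [mg bg]; split; first exact: measurable_funD.
move=> a b; have [M Mf] := bf a b; have [N Ng] := bg a b; exists (M + N) => x xab.
by rewrite (le_trans (ler_normD _ _))// lerD ?Mf ?Ng.
Qed.

Lemma lbmM f g : lbm f -> lbm g -> lbm (fun x => f x * g x).
Proof.
move=> [mf bf] [mg bg]; split; first exact: measurable_funM.
move=> a b; have [M Mf] := bf a b; have [N Ng] := bg a b; exists (M * N) => x xab.
by rewrite normrM ler_pM ?Mf ?Ng.
Qed.

Lemma lbmZ k f : lbm f -> lbm (fun x => k * f x).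
Proof. by move=> lf; apply: lbmM => //; exact: lbm_cst. Qed.

Lemma lbmN f : lbm f -> lbm (fun x => - f x).
Proof.
move=> /(lbmZ (-1)); congr lbm; apply/funext => x; exact: mulN1r.
Qed.

Lemma lbmB f g : lbm f -> lbm g -> lbm (fun x => f x - g x).
Proof. by move=> lf lg; apply: lbmD => //; exact: lbmN. Qed.

Lemma homo_lbm f : {homo f : x y / x <= y} -> lbm f.
Proof.
move=> hf; split; first exact: measurable_realfun.nondecreasing_measurable.
move=> a b; exists (`|f a| + `|f b|) => x /andP[ax xb].
have := hf _ _ ax; have := hf _ _ xb.
have := ler_norm (f b); have := ler_norm (- f a); have := normr_ge0 (f b); have := normr_ge0 (f a).
rewrite normrN ler_norml; lra.
Qed.

(** Monotone functions are Borel and locally bounded. *)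
Lemma rint_ge0_lbm mu c f : locint mu f -> (forall x, 0 <= f x) -> lbm (fun x => rint mu c x f).
Proof.
move=> fi f0; apply: homo_lbm => x y xy.
rewrite -(rint_cat fi c x y) lerDl rint_le// Rintegral_ge0//.
Qed.

(** Split f into its positive and negative parts. *)
Lemma rint_lbm mu c f : locint mu f -> lbm (fun x => rint mu c x f).
Proof.
move=> fi.
have pi : locint mu f^\+.
  by move=> a b; apply: integrable_funrpos.
have ni : locint mu f^\-.
  by move=> a b; apply: integrable_funrneg.
rewrite (_ : (fun x => _) = (fun x => rint mu c x f^\+ - rint mu c x f^\-)); last first.
  apply/funext => x; rewrite -rintB//; congr (rint _ _ _ _).
  by rewrite -[in LHS](funrposBneg f).
by apply: lbmB; apply: rint_ge0_lbm => // x; rewrite ?funrpos_ge0 ?funrneg_ge0.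
Qed.

Lemma continuous_lbm f : continuous f -> lbm f.
Proof.
move=> cf; split; first exact: continuous_measurable_fun.
move=> a b; have [ab|ba] := leP a b; last by exists 0 => x; lra.
have /compact_bounded [M [_ MB]] : compact (f @` `[a, b]).
  by apply: continuous_compact; [exact: continuous_subspaceT|exact: segment_compact].
exists (M + 1) => x xab; apply: (MB (M + 1)); first by rewrite ltrDl.
by exists x => //=; rewrite in_itv.
Qed.
Lemma rint_cst (m : R) x y : rint leb x y (fun=> m) = m * (y - x).
Proof.
have H t z : t <= z -> rint leb t z (fun=> m) = m * (z - t).
  move=> tz; rewrite rint_le// Rintegral_cst//; congr (_ * _).
  transitivity (fine (leb `[t, z[%classic)) => //; rewrite lebesgue_measure_itv/= lte_fin.
  by case: ltP => // zt; apply/esym/eqP; rewrite subr_eq0 eq_le tz zt.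
case: (leP x y) => [/H//|/ltW/H E]; by rewrite rintC E; ring.
Qed.

(** Local absolute continuity, with a chosen representative f' of the derivative.
    The functions of the theory are determined on the half-line only, and working
    with primitives on the whole line avoids all domain conditions. *)
Definition Prim f f' := locint leb f' /\ forall x y, f y - f x = rint leb x y f'.

Lemma Prim_lbm f f' : Prim f f' -> lbm f.
Proof.
move=> [i E]; rewrite (_ : f = fun x => f 0 + rint leb 0 x f').
  by apply: lbmD; [exact: lbm_cst|exact: rint_lbm].
by apply/funext => x; rewrite -E addrC subrK.
Qed.

Lemma PrimD f f' g g' : Prim f f' -> Prim g g' -> Prim (fun x => f x + g x) (fun x => f' x + g' x).
Proof.
move=> [fi fE] [gi gE]; split; first exact: locintD.
by move=> x y; rewrite rintD// -fE -gE; ring.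
Qed.

Lemma PrimZ k f f' : Prim f f' -> Prim (fun x => k * f x) (fun x => k * f' x).
Proof.
move=> [fi fE]; split; first exact: locintZ.
by move=> x y; rewrite rintZ// -fE; ring.
Qed.

Lemma PrimN f f' : Prim f f' -> Prim (fun x => - f x) (fun x => - f' x).
Proof.
move=> [fi fE]; split; first exact: locintN.
by move=> x y; rewrite rintN// -fE; ring.
Qed.

Lemma PrimB f f' g g' : Prim f f' -> Prim g g' -> Prim (fun x => f x - g x) (fun x => f' x - g' x).
Proof. by move=> Pf Pg; apply: PrimD => //; exact: PrimN. Qed.

Lemma Prim_cst k : Prim (fun=> k) (fun=> 0).
Proof.
split; first exact: (lbm_locint lebesgue_locally_finite (lbm_cst _)).
move=> x y; rewrite subrr /rint; case: ifP => _; rewrite Rintegral_cst// mul0r ?oppr0//.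
Qed.

Lemma Prim_rint c f : locint leb f -> Prim (fun x => rint leb c x f) f.
Proof. by move=> fi; split=> // x y; rewrite -(rint_cat fi c x y) addrC addKr. Qed.

End integration.

(** * Fubini's theorem on a triangle and integration by parts *)

Section fubini.
Context {R : realType}.
Implicit Types (mu : {measure set (measurableTypeR R) -> \bar R}) (f g h : R -> R) (a b c x y z : R).
Local Notation leb := (@lebesgue_measure R).

Lemma locint_measurable mu f : locint mu f -> measurable_fun [set: R] f.
Proof.
move=> fi; rewrite -(bigcup_itvT true true).
apply/measurable_fun_bigcup => // n.
by apply/measurable_EFinP; exact: (measurable_int mu (fi (- n%:R) n%:R)).
Qed.

Lemma EFin_Rintegral mu (D : set R) f : measurable D -> mu.-integrable D (EFin \o f) ->
  (\int[mu]_(x in D) (f x)%:E)%E = (\int[mu]_(x in D) f x)%:E.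
Proof. by move=> mD fi; rewrite fineK//; exact: integrable_fin_num. Qed.

Lemma locally_finite_lty mu a b : locally_finite mu -> (mu `[a, b[%classic < +oo)%E.
Proof.
move=> lmu; apply: lmu => //; apply: (@sub_boundedr _ _ _ _ (globally `[a, b])); last first.
  exact/compact_bounded/segment_compact.
move=> P /= PP x; rewrite /= in_itv/= => /andP[ax xb]; apply: PP.
by rewrite /= in_itv/= ax ltW.
Qed.

Section core.
Variables (mu : {measure set (measurableTypeR R) -> \bar R}) (a b : R).
Hypothesis lmu : locally_finite mu.
Variables (f g : R -> R).
Hypotheses (fi : locint leb f) (gi : locint mu g).

Let mI : measurable (`[a, b[%classic : set (measurableTypeR R)).
Proof. exact: measurable_itv. Qed.

Let m1 : {finite_measure set (measurableTypeR R) -> \bar R} :=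
  mfrestr mI (locally_finite_lty a b lmu).

Let F (z : R * R) : R := if [&& a <= z.1, z.1 < z.2 & z.2 < b] then f z.2 * g z.1 else 0.

Let mF : measurable_fun setT F.
Proof.
have m1' : measurable_fun [set: R * R] (fst : R * R -> R) by exact: measurable_fst.
have m2' : measurable_fun [set: R * R] (snd : R * R -> R) by exact: measurable_snd.
apply: measurable_fun_ifT => //.
- apply: measurable_and; first exact: measurable_fun_ler.
  by apply: measurable_and; exact: measurable_fun_ltr.
- by apply: measurable_funM; apply: measurableT_comp => //;
    [exact: locint_measurable fi|exact: locint_measurable gi].
Qed.

Let m1E (h : R -> \bar R) : (\int[m1]_x (h \_ `[a, b[) x = \int[mu]_(x in `[a, b[) h x)%E.
Proof.
rewrite -integral_mkcond; apply: eq_measure_integral => A mA AD.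
by rewrite /m1/= /mfrestr /mrestr setIidl.
Qed.

Let Fx (s : R) : (fun x => (F (s, x))%:E) =
  (if a <= s then (fun x => (f x * g s)%:E) \_ `]s, b[ else cst 0%E).
Proof.
apply/funext => x; rewrite /F/=; case: (leP a s) => as_ //=.
by rewrite patchE mem_setE in_itv/=; case: ifP.
Qed.

Let sub_int s : a <= s -> leb.-integrable `]s, b[ (EFin \o f).
Proof.
move=> as_; apply: (integrableS _ _ _ (fi a b)) => //.
by move=> x/=; rewrite !in_itv/= => /andP[sx ->]; rewrite (le_trans as_) ?ltW.
Qed.

Let cbnd s : a <= s -> \int[leb]_(x in `]s, b[) f x = \int[leb]_(x in `[s, b[) f x.
Proof. by move=> as_; rewrite Rintegral_itv_obnd_cbnd//; exact: sub_int. Qed.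

Let intFx s : (\int[leb]_x (F (s, x))%:E =
  ((fun s => ((\int[leb]_(x in `[s, b[) f x) * g s)%:E) \_ `[a, b[) s)%E.
Proof.
rewrite Fx patchE mem_setE in_itv/=; case: (leP a s) => as_ /=; last by rewrite integral0.
rewrite -integral_mkcond EFin_Rintegral//.
  rewrite RintegralZr ?cbnd//; last exact: sub_int.
  case: ifPn => //; rewrite -leNgt => bs.
  by rewrite set_itv_ge ?Rintegral_set0 ?mul0r// bnd_simp -leNgt.
rewrite (_ : EFin \o _ = fun x => ((g s)%:E * (EFin \o f) x)%E).
  by apply: integrableZl => //; exact: sub_int.
by apply/funext => x/=; rewrite mulrC.
Qed.

Let intFs x : (\int[m1]_s (F (s, x))%:E =
  ((fun x => (f x * (\int[mu]_(s in `[a, x[) g s))%:E) \_ `[a, b[) x)%E.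
Proof.
have E : (\int[m1]_s (F (s, x))%:E =
    \int[mu]_(s in `[a, b[) (if (s < x < b)%R then (f x * g s)%:E else 0))%E.
  rewrite -m1E; apply: eq_integral => s _; rewrite patchE mem_setE in_itv/= /F/=.
  case: (leP a s) => as_ //=; case: ifP => /=; last by case: ifP.
  by move=> /andP[sx xb]; rewrite (lt_trans sx xb).
rewrite E patchE mem_setE in_itv/=; case: (ltP x b) => xb; rewrite ?andbF/=; last first.
  by under eq_integral do rewrite andbF; rewrite integral0.
rewrite andbT; case: (leP a x) => ax; last first.
  rewrite integral0_eq// => s /=; rewrite in_itv/= => /andP[as_ _].
  by rewrite ltNge (ltW (lt_le_trans ax as_)).
transitivity (\int[mu]_(s in `[a, x[) (f x * g s)%:E)%E.
  rewrite [LHS]integral_mkcond [RHS]integral_mkcond; apply: eq_integral => s _.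
  rewrite !patchE !mem_setE !in_itv/=; case: (leP a s) => as_ //=; rewrite andbT.
  by case: (ltP s x) => sx; [rewrite (lt_trans sx xb)|case: ifP].
rewrite EFin_Rintegral//; last exact: (integrableZl _ _ (gi a x)).
by rewrite RintegralZl.
Qed.

Let intabs : (\int[m1]_s \int[leb]_x `|(F (s, x))%:E| < +oo)%E.
Proof.
have le s : (\int[leb]_x `|(F (s, x))%:E| <= ((fun s => (`|g s| * \int[leb]_(x in `[a, b[) `|f x|)%:E) \_ `[a, b[) s)%E.
  rewrite (_ : (fun x => _) = (if (a <= s) && (s < b) then (fun x => (`|g s| * `|f x|)%:E) \_ `]s, b[ else cst 0%E)); last first.
    apply/funext => x; rewrite /F/=; case: (leP a s) => as_ /=; last by rewrite normr0.
    case: (ltP s b) => sb; last first.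
      case: ifPn; rewrite ?normr0// => /andP[sx xb].
      by move: (lt_trans sx xb); rewrite ltNge sb.
    by rewrite patchE mem_setE in_itv/=; case: ifP; rewrite ?normr0// normrM mulrC.
  rewrite patchE mem_setE in_itv/=; case: ifP => [/andP[as_ sb]|]; last by rewrite integral0.
  rewrite -integral_mkcond EFin_Rintegral//; last first.
    exact: (integrableZl _ `|g s| (integrable_norm (sub_int as_))).
  rewrite lee_fin RintegralZl//; last exact: (integrable_norm (sub_int as_)).
  rewrite ler_wpM2l//.
  have := @Rintegral_cat _ leb a s b (Num.norm \o f).
  rewrite /comp => ->//; last 2 first.
  - exact: (integrable_norm (fi a b)).
  - exact: ltW.
  rewrite Rintegral_itv_obnd_cbnd ?lerDr ?Rintegral_ge0//.
  exact: (integrable_norm (sub_int as_)).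
apply: (@le_lt_trans _ _ (\int[m1]_s ((fun s => (`|g s| * \int[leb]_(x in `[a, b[) `|f x|)%:E) \_ `[a, b[) s)%E).
  apply: ge0_le_integral => //.
  - by move=> s _; apply: integral_ge0.
  - apply: (@measurable_fun_fubini_tonelli_F _ _ _ _ _ leb (fun z : R * R => `|(F z)%:E|)%E) => //.
    by apply: measurableT_comp => //; exact/measurable_EFinP.
  - apply/(measurable_restrictT _ _).1 => //; apply/measurable_EFinP; apply: measurable_funM => //.
    by apply: measurableT_comp => //; apply: measurable_funTS; exact: locint_measurable gi.
rewrite m1E EFin_Rintegral ?ltry//.
rewrite (_ : EFin \o _ = fun x => ((\int[leb]_(x in `[a, b[) `|f x|)%:E * (EFin \o (Num.norm \o g)) x)%E).
  by apply: integrableZl => //; exact: (integrable_norm (gi a b)).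
by apply/funext => x/=; rewrite mulrC.
Qed.

(** Both sides integrate f(x) g(s) over the triangle a <= s < x < b. *)
Lemma fubini_triangle :
  \int[mu]_(s in `[a, b[) ((\int[leb]_(x in `[s, b[) f x) * g s) =
  \int[leb]_(x in `[a, b[) (f x * (\int[mu]_(s in `[a, x[) g s)).
Proof.
have mEF : measurable_fun setT (fun z : R * R => (F z)%:E) by exact/measurable_EFinP.
have iF : (m1 \x leb)%E.-integrable setT (fun z : R * R => (F z)%:E).
  by apply/integrable12ltyP => //; exact: intabs.
have := Fubini iF.
under eq_integral do rewrite intFx.
under [X in _ = X -> _]eq_integral do rewrite intFs.
rewrite m1E -integral_mkcond /Rintegral => -> //.
Qed.
End core.

(** Integration by parts against an arbitrary locally finite measure.  No jump
    terms appear: f is continuous, and the primitive of g is left-continuous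
    because integrals are taken over half-open intervals. *)
Lemma rint_ibp mu g f f' c : locally_finite mu -> locint mu g -> Prim f f' -> forall x y,
  rint mu x y (fun t => f t * g t) =
  f y * rint mu c y g - f x * rint mu c x g - rint leb x y (fun t => f' t * rint mu c t g).
Proof.
move=> lmu gi Pf; have [fi fE] := Pf.
have lV := rint_lbm c gi.
have core a b : a <= b -> rint mu a b (fun t => f t * g t) =
  f b * rint mu c b g - f a * rint mu c a g - rint leb a b (fun t => f' t * rint mu c t g).
  move=> ab.
  have := fubini_triangle a b lmu fi gi.
  have -> : \int[mu]_(s in `[a, b[) ((\int[leb]_(x in `[s, b[) f' x) * g s) =
      rint mu a b (fun s => f b * g s - f s * g s).
    rewrite rint_le//; apply: eq_Rintegral => s; rewrite inE/= in_itv/= => /andP[_ sb].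
    by rewrite -(rint_le _ _ (ltW sb)) -fE mulrBl.
  have -> : \int[leb]_(x in `[a, b[) (f' x * (\int[mu]_(s in `[a, x[) g s)) =
      rint leb a b (fun x => rint mu c x g * f' x - rint mu c a g * f' x).
    rewrite rint_le//; apply: eq_Rintegral => s; rewrite inE/= in_itv/= => /andP[as_ _].
    rewrite -(rint_le _ _ as_) -mulrBl mulrC; congr (_ * _).
    by rewrite -(rint_cat gi c a s) addrC addKr.
  have lf := Prim_lbm Pf.
  rewrite !rintB//; [|exact: locintMl|exact: locintZ|exact: locintZ|exact: locintMl].
  rewrite !rintZ// -fE.
  rewrite (_ : (fun t => rint mu c t g * f' t) = (fun t => f' t * rint mu c t g)); last first.
    by apply/funext => t; rewrite mulrC.
  have -> : rint mu a b g = rint mu c b g - rint mu c a g by rewrite -(rint_cat gi c a b) addrC addKr.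
  by move=> H; lra.
move=> x y; case: (leP x y) => [|/ltW] /core; first by [].
rewrite rintC (rintC _ x y) => H; lra.
Qed.

(** The product rule is the integration by parts for the Lebesgue measure. *)
Lemma PrimM f f' g g' : Prim f f' -> Prim g g' ->
  Prim (fun x => f x * g x) (fun x => f' x * g x + f x * g' x).
Proof.
move=> Pf Pg.
have lf := Prim_lbm Pf; have lg := Prim_lbm Pg.
have i1 : locint leb (fun x => f' x * g x).
  by under eq_fun do rewrite mulrC; apply: locintMl => //; case: Pf.
have i2 : locint leb (fun x => f x * g' x) by apply: locintMl => //; case: Pg.
split; first exact: locintD.
move=> x y; rewrite rintD// (rint_ibp x lebesgue_locally_finite Pg.1 Pf).
rewrite (_ : (fun t => f' t * rint leb x t g') = (fun t => f' t * g t - g x * f' t)); last first.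
  by apply/funext => t; rewrite -Pg.2; ring.
rewrite rintB//; last by apply: locintZ; case: Pf.
rewrite rintZ//; last by case: Pf.
rewrite -!Pf.2 -!Pg.2; ring.
Qed.
End fubini.

(** * Integration by parts for the signed measure *)

Section omega.
Context {R : realType} (omega : lf_signed_measure R).
Implicit Types (mu : {measure set (measurableTypeR R) -> \bar R}) (f g h : R -> R) (a b c x y z : R).
Local Notation leb := (@lebesgue_measure R).

Lemma smeas_cat a b c : a <= b -> b <= c -> omega `[a, c[%classic = omega `[a, b[%classic + omega `[b, c[%classic.
Proof.
move=> ab bc.
have H (A : set (measurableTypeR R)) : A `<=` `[a, c[ -> signed_restr omega a c A = (omega A)%:E.
  by move=> Ac; rewrite /signed_restr setIidl.
have E : (signed_restr omega a c `[a, c[%classic =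
    signed_restr omega a c `[a, b[%classic + signed_restr omega a c `[b, c[%classic)%E.
  rewrite (@itv_bndbnd_setU _ _ _ (BLeft b)) ?bnd_simp//.
  apply: chargeU; [exact: measurable_itv|exact: measurable_itv|].
  by apply/seteqP; split=> // x [] /=; rewrite !in_itv/= => /andP[_ xb] /andP[bx _]; rewrite ltNge bx in xb.
apply/EFin_inj; rewrite EFinD -!H//.
- by move=> x/=; rewrite !in_itv/= => /andP[bx ->]; rewrite (le_trans ab).
- by move=> x/=; rewrite !in_itv/= => /andP[-> /lt_le_trans]; exact.
Qed.

(** The distribution function of omega based at x. *)
Definition odist x y : R := if x <= y then omega `[x, y[%classic else - omega `[y, x[%classic.

Lemma odist_le x y : x <= y -> odist x y = omega `[x, y[%classic.
Proof. by rewrite /odist => ->. Qed.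

Lemma odistxx x : odist x x = 0.
Proof. by rewrite /odist lexx set_itvco0 smeas0. Qed.

Lemma odistC x y : odist y x = - odist x y.
Proof.
have [->|xy] := eqVneq x y; first by rewrite odistxx oppr0.
by rewrite /odist; case: ltgtP xy => // _; rewrite opprK.
Qed.

Lemma odist_cat x y z : odist x y + odist y z = odist x z.
Proof.
have H a b c : a <= b -> b <= c -> odist a b + odist b c = odist a c.
  move=> ab bc; have ac := le_trans ab bc; rewrite !odist_le//.
  by rewrite [RHS](@smeas_cat _ b).
have C := @odistC; case: (leP x y) => xy; case: (leP y z) => yz; case: (leP x z) => xz.
- exact: H.
- by have := H _ _ _ xy yz; rewrite leNgt in xy; lra.
- have := H _ _ _ xz (ltW yz); rewrite (C z y); lra.
- have := H _ _ _ (ltW xz) xy; rewrite (C z y) (C z x); lra.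
- have := H _ _ _ (ltW xy) xz; rewrite (C y x); lra.
- have := H _ _ _ yz (ltW xz); rewrite (C y x) (C z x); lra.
- by have := H _ _ _ (ltW yz) (ltW xy); lra.
- have := H _ _ _ (ltW yz) (ltW xy); rewrite (C z y) (C y x) (C z x); lra.
Qed.

Lemma finite_locally_finite (m : {finite_measure set (measurableTypeR R) -> \bar R}) : locally_finite m.
Proof. by move=> A mA _; rewrite -ge0_fin_numE ?fin_num_measure. Qed.

(** On a bounded interval the integral against omega is a difference of integrals
    against finite measures, so that the results for measures apply. *)
Lemma sint_jordan a b : exists m n : {measure set (measurableTypeR R) -> \bar R},
  [/\ locally_finite m, locally_finite n,
   (forall x, a <= x <= b -> odist a x = rint m a x (fun=> 1) - rint n a x (fun=> 1)) &
   (forall f, sint omega a b f = \int[m]_(x in `[a, b[) f x - \int[n]_(x in `[a, b[) f x)].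
Proof.
pose h := svalP (cid (svalP (cid (Hahn_decomposition (signed_restr omega a b))))).
exists (jordan_pos h), (jordan_neg h); split => //.
- exact: finite_locally_finite.
- exact: finite_locally_finite.
move=> x /andP[ax xb]; rewrite odist_le// !rint_le// !Rintegral_cst// !mul1r.
have E : (signed_restr omega a b `[a, x[ = jordan_pos h `[a, x[ - jordan_neg h `[a, x[)%E.
  by rewrite (jordan_decomp h (measurable_itv _)) /cadd/= cscaleN1.
apply/EFin_inj; rewrite EFinB !fineK ?fin_num_measure// -E /signed_restr setIidl//.
by move=> y/=; rewrite !in_itv/= => /andP[-> /lt_le_trans]; exact.
Qed.

(** Being locally bounded and Borel is a local property. *)
Lemma lbm_patch f : (forall n : nat, exists2 g, lbm g & forall x, - n%:R <= x < n%:R -> f x = g x) -> lbm f.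
Proof.
move=> H; split.
  rewrite -(bigcup_itvT true true); apply/measurable_fun_bigcup => // n.
  have [g [mg _] fg] := H n.
  apply: (eq_measurable_fun g); last exact: measurable_funTS.
  by move=> x; rewrite inE/= in_itv/= => /fg ->.
move=> a b; pose n := (Num.trunc (`|a| + `|b|)).+1.
have nab : `|a| + `|b| < n%:R by rewrite /n truncnS_gt.
have [g [_ bg] fg] := H n; have [M Mg] := bg a b; exists M => x xab.
rewrite fg ?Mg//; have := ler_norm (- a); have := ler_norm b.
have := normr_ge0 a; have := normr_ge0 b; rewrite normrN; lra.
Qed.

Lemma odist_lbm c : lbm (odist c).
Proof.
apply: lbm_patch => k.
have [m [n [lm ln H _]]] := sint_jordan (- k%:R) k%:R.
exists (fun x => odist c (- k%:R) + (rint m (- k%:R) x (fun=> 1) - rint n (- k%:R) x (fun=> 1))).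
  apply: lbmD; first exact: lbm_cst.
  by apply: lbmB; apply: rint_lbm; apply: lbm_locint => //; exact: lbm_cst.
move=> x /andP[x1 x2]; rewrite -H ?x1 ?(ltW x2)//.
by rewrite odist_cat.
Qed.

(** The integral of an absolutely continuous function against omega depends on
    omega only through its distribution function.  This turns all integrals
    against omega into Lebesgue integrals. *)
Lemma sint_ibp c g g' : Prim g g' -> forall a b, a <= b ->
  sint omega a b g = g b * odist c b - g a * odist c a - rint leb a b (fun t => g' t * odist c t).
Proof.
move=> Pg a b ab; have gi := Pg.1.
have [m [n [lm ln H ->]]] := sint_jordan a b.
have i1 mu : locally_finite mu -> locint mu (fun=> 1) by move=> l; apply: lbm_locint => //; exact: lbm_cst.
have E mu : locally_finite mu -> \int[mu]_(x in `[a, b[) g x =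
    g b * rint mu a b (fun=> 1) - rint leb a b (fun t => rint mu a t (fun=> 1) * g' t).
  move=> l; have := rint_ibp a l (i1 _ l) Pg a b; rewrite [rint mu a a _]rintxx mulr0 subr0.
  under [X in rint leb a b X]eq_fun do rewrite mulrC.
  by move=> <-; rewrite rint_le//; apply: eq_Rintegral => x _; rewrite mulr1.
rewrite !E//.
have -> : rint leb a b (fun t => g' t * odist c t) =
    rint leb a b (fun t => odist c a * g' t + (rint m a t (fun=> 1) * g' t - rint n a t (fun=> 1) * g' t)).
  rewrite !rint_le//; apply: eq_Rintegral => x; rewrite inE/= in_itv/= => /andP[ax xb].
  by rewrite -mulrBl -H ?ax ?ltW// -mulrDl odist_cat mulrC.
have im : locint leb (fun t => rint m a t (fun=> 1) * g' t) by apply: locintMl => //; apply: rint_lbm; exact: i1.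
have in' : locint leb (fun t => rint n a t (fun=> 1) * g' t) by apply: locintMl => //; apply: rint_lbm; exact: i1.
rewrite rintD//; [|exact: locintZ|exact: locintB].
rewrite rintB// rintZ// -Pg.2 -(odist_cat c a b) H ?lexx ?ab//; ring.
Qed.
End omega.

(** * The fundamental theorem of calculus for absolutely continuous functions *)

Section abscont.
Context {R : realType}.
Implicit Types (f g h : R -> R) (a b c x y z : R).
Local Notation leb := (@lebesgue_measure R).

Lemma aeS (mu : {measure set (measurableTypeR R) -> \bar R}) (P Q : R -> Prop) : (forall x, P x -> Q x) ->
  {ae mu, forall x, P x} -> {ae mu, forall x, Q x}.
Proof. by move=> PQ; apply: filterS => //; exact: (ae_filter_ringOfSetsType mu). Qed.

Lemma aeS2 (mu : {measure set (measurableTypeR R) -> \bar R}) (P Q S : R -> Prop) : (forall x, P x -> Q x -> S x) ->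
  {ae mu, forall x, P x} -> {ae mu, forall x, Q x} -> {ae mu, forall x, S x}.
Proof. by move=> PQ; apply: filterS2 => //; exact: (ae_filter_ringOfSetsType mu). Qed.

Lemma integrable_patch (mu : {measure set (measurableTypeR R) -> \bar R}) (D : set (measurableTypeR R)) h :
  measurable D -> mu.-integrable D (EFin \o h) -> mu.-integrable setT (EFin \o (h \_ D)).
Proof. by move=> mD hi; have := (@integrable_mkcond _ _ _ mu D (EFin \o h) mD).1 hi; rewrite restrict_EFin. Qed.

Lemma leb_itvoo s t : s <= t -> leb `]s, t[%classic = (t - s)%:E.
Proof.
move=> st; have := @lebesgue_measure_itv R `]s, t[; rewrite /= lte_fin => ->.
by move: st; rewrite le_eqVlt => /orP[/eqP ->|->]; rewrite ?ltxx ?subrr.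
Qed.

Lemma is_derive_dist f x d : is_derive x 1 f d -> forall e, 0 < e -> exists2 r, 0 < r &
  forall y, `|y - x| < r -> `|f y - f x - d * (y - x)| <= e * `|y - x|.
Proof.
move=> [df1 df2] e e0.
have : h^-1 *: ((f \o shift x) (h *: 1) - f x) @[h --> 0^'] --> d.
  by rewrite -df2; exact: df1.
move=> /cvgrPdist_le/(_ e e0)/nbhs_ballP[r/= r0 H]; exists r => // y yx.
have [->|yx0] := eqVneq y x; first by rewrite !subrr mulr0 subr0 normr0 mulr0.
have h0 : y - x != 0 by rewrite subr_eq0.
have := H (y - x); rewrite /ball/= sub0r normrN => /(_ yx h0).
rewrite -[(y - x)^-1 *: _]/((y - x)^-1 * _) -[(y - x) *: 1]/((y - x) * 1) mulr1 subrK.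
have hp : 0 < `|y - x| by rewrite normr_gt0.
rewrite -(ler_pM2r hp) -normrM.
rewrite (_ : (d - _) * _ = - (f y - f x - d * (y - x))) ?normrN//.
by field.
Qed.

Lemma sum_itv_measure (n : nat) (s t : nat -> R) (U : set R) :
  (forall i, (i < n)%N -> s i <= t i) ->
  trivIset `I_n (fun i => `]s i, t i[%classic) -> measurable U ->
  (forall i, (i < n)%N -> `]s i, t i[%classic `<=` U) ->
  ((\sum_(i < n) (t i - s i))%:E <= leb U)%E.
Proof.
move=> st tI mU sU.
have mB : measurable (\big[setU/set0]_(k < n) `]s k, t k[%classic) by exact: bigsetU_measurable.
have E := @measure_semi_additive_ord_I _ _ _ leb (fun i => `]s i, t i[%classic) n
   (fun _ _ => measurable_itv _) tI mB.
rewrite (_ : (\sum_(i < n) (t i - s i))%:E = leb (\big[setU/set0]_(k < n) `]s k, t k[%classic)).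
  apply: le_measure; rewrite ?inE//.
  rewrite -(bigcup_mkord _ (fun i => `]s i, t i[%classic)) => x [i/= ni]; exact: sU.
rewrite E -sumEFin; apply: eq_bigr => i _.
by apply/esym/leb_itvoo; exact: st.
Qed.

(** A continuous induction along [a, b].  At points where the derivative vanishes
    the increment of f over a short interval is at most e times its length; the
    exceptional points are covered by an open set U of small measure, and
    absolute continuity bounds the total increment over intervals inside U. *)
Lemma zero_derivative_const f a b : a <= b -> abs_continuous a b f ->
  {ae leb, forall x, a < x < b -> is_derive x 1 f 0} -> f a = f b.
Proof.
move=> ab acf [N0 [mN0 N00 HN0]].
pose N : set R := N0 `|` [set a] `|` [set b].
have mN1 : measurable (N0 `|` [set a] : set (measurableTypeR R)) by exact: measurableU.
have mN : measurable N by exact: measurableU.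
have N00' : leb N = 0%E.
  apply: null_set_setU => //; last exact: lebesgue_measure_set1.
  by apply: null_set_setU => //; exact: lebesgue_measure_set1.
have HN x : a <= x <= b -> ~ N x -> is_derive x 1 f 0.
  move=> /andP[ax xb] Nx; apply: contrapT => Dx; apply: Nx.
  have [->|xa] := eqVneq x a; first by left; right.
  have [->|xnb] := eqVneq x b; first by right.
  left; left; apply: HN0 => /=; apply/not_implyP; split => //.
  by rewrite !lt_neqAle [a == x]eq_sym xa xnb ax xb.
suff H e : 0 < e -> `|f b - f a| <= e * (b - a + 1).
  apply/eqP; rewrite eq_sym -subr_eq0 -normr_eq0; apply/eqP/le_anti; rewrite normr_ge0 andbT.
  apply/ler_addgt0Pr => e e0; rewrite add0r.
  have d0 : 0 < b - a + 1 by lra.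
  by have := H (e / (b - a + 1)) (divr_gt0 e0 d0); rewrite divfK// gt_eqF.
move=> e0.
have [d d0 Hd] := acf e e0.
have [U [oU NU Ud]] : exists U : set R, [/\ open U, N `<=` U & (leb U < d%:E)%E].
  have Noo : (leb N < +oo)%E by rewrite N00'.
  have [U [oU NU Ud]] := lebesgue_regularity_outer mN Noo d0.
  exists U; split => //; apply: le_lt_trans Ud.
  have mU : measurable U by exact: open_measurable.
  have mUN : measurable (U `\` N) by exact: measurableD.
  rewrite -{1}(setDUK NU) (le_trans (measureU2 _ _ _))//= ?N00' ?add0e//.
(* S is the set of the points reached by a chain of short intervals, where the
   intervals s_i, t_i inside U are recorded. *)
pose S : set R := [set x | a <= x <= b /\ exists n (s t : nat -> R),
  [/\ forall i, (i < n)%N -> [/\ a <= s i, s i <= t i & t i <= x],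
      trivIset `I_n (fun i => `]s i, t i[%classic),
      (forall i, (i < n)%N -> `]s i, t i[%classic `<=` U) &
      `|f x - f a| <= e * (x - a) + \sum_(i < n) `|f (t i) - f (s i)|]].
have Sa : S a.
  split; first by rewrite lexx.
  exists 0%N, (fun=> 0), (fun=> 0); split=> //.
  by rewrite big_ord0 !subrr normr0 mulr0 addr0.
have ubS : ubound S b by move=> x [/andP[]].
have hS : has_sup S by split; [exists a|exists b].
pose z := sup S.
have az : a <= z by apply: ub_le_sup => //; exists b.
have zb : z <= b by apply: ge_sup => //; exists a.
have step r : 0 < r ->
   (forall x y, z - r < x -> x <= z -> z <= y -> y < z + r -> a <= x -> y <= b ->
     `|f y - f x| <= e * (y - x) \/ `]x, y[%classic `<=` U) ->
   z = b /\ S b.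
  move=> r0 Hr.
  have [x Sx zx] := sup_adherent r0 hS.
  have xz : x <= z by apply: ub_le_sup => //; exists b.
  pose y := Num.min b (z + r / 2).
  have zy : z <= y by rewrite le_min zb lerDl divr_ge0// ltW.
  have yb : y <= b by rewrite ge_min lexx.
  have yz : y < z + r by rewrite gt_min ltrD2l ltr_pdivrMr// mulr2n mulrDr mulr1 ltrDl r0 orbT.
  have [/andP[ax xb] [n [s [t [H1 H2 H3 H4]]]]] := Sx.
  have xy := le_trans xz zy.
  have Sy : S y.
    split; first by rewrite (le_trans ax)// (le_trans xb).
    have [fxy|xyU] := Hr x y zx xz zy yz ax yb.
      exists n, s, t; split=> //.
        by move=> i /H1[? ? tx]; split => //; rewrite (le_trans tx).
      rewrite (_ : f y - f a = (f y - f x) + (f x - f a)); last by ring.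
      rewrite (le_trans (ler_normD _ _))//; lra.
    exists n.+1, (fun i => if (i < n)%N then s i else x), (fun i => if (i < n)%N then t i else y); split.
    - move=> i _; case: ifP => // /H1[? ? tx]; split => //; exact: le_trans xy.
    - apply/trivIsetP => i j /= ni nj ij.
      have K k u : (k < n)%N -> `]s k, t k[%classic `&` `]x, u[%classic = set0.
        move=> /H1[_ _ tx]; apply/seteqP; split=> // w [/=]; rewrite !in_itv/=.
        by move=> /andP[_ wt] /andP[xw _]; have := lt_trans (lt_le_trans wt tx) xw; rewrite ltxx.
      case: ifPn => i'; case: ifPn => j'.
      + by move/trivIsetP: H2; apply.
      + exact: K.
      + by rewrite setIC; exact: K.
      + have Ek (k : nat) : (k < n.+1)%N -> ~~ (k < n)%N -> k = n.
          by rewrite ltnS -leqNgt => k1 k2; apply/anti_leq; rewrite k1 k2.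
        by move: ij; rewrite (Ek _ ni i') (Ek _ nj j') eqxx.
    - by move=> i _; case: ifPn => // /H3.
    - rewrite big_ord_recr/= ltnn.
      under eq_bigr do rewrite ltn_ord.
      rewrite (_ : f y - f a = (f x - f a) + (f y - f x)); last by ring.
      rewrite (le_trans (ler_normD _ _))// addrA lerD2r (le_trans H4)// lerD2r ler_wpM2l ?(ltW e0)//.
      by rewrite lerD2r.
  have yz' : y <= z by apply: ub_le_sup => //; exists b.
  have zE : z = b.
    move: yz'; rewrite /y ge_min => /orP[bz|]; first by apply/le_anti; rewrite zb.
    by rewrite gerDl; have : 0 < r / 2 by [rewrite divr_gt0]; rewrite ltNge => /negPf ->.
  by split => //; rewrite (_ : b = y)//; apply/le_anti; rewrite yb andbT -{1}zE.
have [zE Sb] : z = b /\ S b.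
  have [Nz|Nz] := pselect (N z).
    have [r/= r0 rU] : exists2 r, 0 < r & ball z r `<=` U.
      have : nbhs z U by apply: open_nbhs_nbhs; split => //; exact: NU.
      by move=> /nbhs_ballP[r r0 rU]; exists r.
    apply: (step r r0) => x y zx xz zy yz _ _; right => w /=; rewrite in_itv/= => /andP[xw wy].
    apply: rU; rewrite /ball/= ltr_norml; lra.
  have [|r r0 Hr] := @is_derive_dist f z 0 _ e e0; first by apply: HN; rewrite ?az.
  apply: (step r r0) => x y zx xz zy yz _ _; left.
  rewrite (_ : f y - f x = (f y - f z) - (f x - f z)); last by ring.
  rewrite (le_trans (ler_normB _ _))//.
  have := Hr y; have := Hr x; rewrite !mul0r !subr0 => hx hy.
  have {}hx := hx (_ : `|x - z| < r); have {}hy := hy (_ : `|y - z| < r).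
  rewrite ler0_norm in hx; last lra.
  rewrite ger0_norm in hy; last lra.
  have := hx (_ : - (x - z) < r); have := hy (_ : (y - z) < r).
  move=> /(_ ltac:(lra)) + /(_ ltac:(lra)); nra.
have [_ [n [s [t [H1 H2 H3 H4]]]]] := Sb.
apply: (le_trans H4); rewrite [leRHS]mulrDr lerD2l mulr1.
apply/ltW/Hd => //.
rewrite -lte_fin; apply: le_lt_trans Ud.
apply: sum_itv_measure => //; last exact: open_measurable.
by move=> i /H1[].
Qed.

Lemma itv_Rintegral_norm h c x y : locint leb h -> x <= y ->
  `|rint leb c y h - rint leb c x h| <= \int[leb]_(t in `]x, y[) `|h t|.
Proof.
move=> hi xy.
have -> : rint leb c y h - rint leb c x h = rint leb x y h.
  by rewrite -(rint_cat hi c x y) addrC addKr.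
rewrite rint_le// (le_trans (le_normr_Rintegral _ (hi x y)))//.
rewrite Rintegral_itv_obnd_cbnd//.
apply: (integrableS _ _ _ (integrable_norm (hi x y))) => //.
by move=> w/=; rewrite !in_itv/= => /andP[/ltW -> ->].
Qed.

(** This is the absolute continuity of the integral with respect to the measure
    of the domain of integration. *)
Lemma rint_abs_continuous h c a b : locint leb h -> abs_continuous a b (fun x => rint leb c x h).
Proof.
move=> hi e e0.
pose k := h \_ `[a, b[.
have ki : leb.-integrable setT (EFin \o k).
  by apply: integrable_patch => //; exact: hi.
have [d [d0 Hd]] := integral_normr_continuous ki e0.
exists d => // n s t st tI std.
have mB : measurable (\big[setU/set0]_(i < n) `]s i, t i[%classic) by exact: bigsetU_measurable.
apply: le_lt_trans (Hd _ mB _); last first.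
  rewrite (@measure_semi_additive_ord_I _ _ _ leb (fun i => `]s i, t i[%classic))//.
  rewrite -lte_fin in std; apply: le_lt_trans std; rewrite -sumEFin; apply: lee_sum => i _.
  by have [_ sti _] := st i (ltn_ord i); rewrite -(leb_itvoo sti).
rewrite /Rintegral -(big_mkord xpredT (fun i => `]s i, t i[%classic)) ge0_integral_bigsetU//; last 3 first.
- exact: iota_uniq.
- by apply: sub_trivIset tI => i/=; rewrite mem_index_iota.
- apply: measurableT_comp => //; apply: measurable_funTS; apply: measurableT_comp => //.
  by apply/measurable_EFinP; exact: (measurable_int _ ki).
rewrite big_mkord (eq_bigr (fun i : 'I_n => (\int[leb]_(x in `]s i, t i[) `|k x|)%:E)); last first.
  move=> i _; rewrite -EFin_Rintegral//.
  by apply: (integrableS _ _ _ (integrable_norm ki)).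
rewrite sumEFin/=; apply: ler_sum => i _.
have [asi sti tib] := st i (ltn_ord i).
rewrite (le_trans (itv_Rintegral_norm _ hi sti))//.
rewrite le_eqVlt; apply/orP; left; apply/eqP; apply: eq_Rintegral => x; rewrite inE/= in_itv/= => /andP[sx xt].
by rewrite /k patchE mem_setE in_itv/= (le_trans asi (ltW sx)) (lt_le_trans xt).
Qed.

Lemma Prim_abs_continuous f f' a b : Prim f f' -> abs_continuous a b f.
Proof.
move=> [fi fE] e e0; have [d d0 H] := rint_abs_continuous 0 a b fi e0.
exists d => // n s t st tI std; apply: le_lt_trans (H n s t st tI std).
apply: ler_sum => i _; rewrite fE -(rint_cat fi 0 (s i)).
by rewrite addrAC subrr add0r.
Qed.

(** The Lebesgue differentiation theorem, applied to f' cut off to [-n, n). *)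
Lemma Prim_ae_derive f f' : Prim f f' -> {ae leb, forall x, is_derive x 1 f (f' x)}.
Proof.
move=> [fi fE].
have H n : {ae leb, forall x, - n%:R < x < n%:R -> is_derive x 1 f (f' x)}.
  pose k := f' \_ `[- n%:R, n%:R[.
  have ki : leb.-integrable setT (EFin \o k).
    exact: integrable_patch (fi (- n%:R) n%:R).
  have lk : locally_integrable setT k by apply: integrable_locally => //; exact: fi.
  have ky y : leb.-integrable `]-oo, y] (EFin \o k) by apply: (integrableS _ _ _ ki).
  have := FTC1Ny ky lk.
  apply: aeS => x [dF1 dF2] /andP[nx xn].
  have kx : k x = f' x by rewrite /k patchE mem_setE in_itv/= (ltW nx) xn.
  rewrite -kx -dF2.
  have : is_derive x 1 (fun y => f (- n%:R) + \int[leb]_(t in `]-oo, y]) k t)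
     (derive1 (fun y => \int[leb]_(t in `]-oo, y]) k t) x).
    rewrite -[X in is_derive _ _ _ X]add0r derive1E; apply: is_deriveD.
    exact: DeriveDef.
  apply: near_eq_is_derive.
  have : \forall y \near x, y \in `]- n%:R, n%:R[.
    by apply: near_in_itvoo; rewrite in_itv/= nx.
  apply: filterS => y; rewrite in_itv/= => /andP[ny yn].
  apply: (@addIr _ (- f (- n%:R))); rewrite addrC addKr fE rint_le ?(ltW ny)//.
  rewrite [RHS]Rintegral_mkcond [LHS]Rintegral_mkcond.
  transitivity (\int[leb]_x ((f' \_ `[- n%:R, y]) x)).
    apply: eq_Rintegral => w _; rewrite /k !patchE !mem_setE !in_itv/=.
    case: (leP w y) => wy; rewrite ?andbF// andbT (le_lt_trans wy)// andbT; by case: ifP.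
  rewrite -!Rintegral_mkcond -Rintegral_itv_bndo_bndc//; exact: fi.
have := ae_foralln H; apply: aeS => x Hx.
apply: (Hx (Num.trunc `|x|).+1).
by rewrite -ltr_norml truncnS_gt.
Qed.

(** The difference of f and the primitive of h is absolutely continuous with
    derivative zero almost everywhere, hence constant. *)
Lemma FTC2_abs_continuous f h a b : a <= b -> abs_continuous a b f ->
  leb.-integrable `[a, b[ (EFin \o h) ->
  {ae leb, forall x, a < x < b -> is_derive x 1 f (h x)} ->
  f b - f a = \int[leb]_(x in `[a, b[) h x.
Proof.
move=> ab acf hi df.
pose k := h \_ `[a, b[.
have ki : leb.-integrable setT (EFin \o k).
  exact: integrable_patch.
have kl : locint leb k by move=> u v; apply: integrableS ki.
have Pk := Prim_rint a kl.
pose g x := f x - rint leb a x k.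
have : g a = g b.
  apply: zero_derivative_const => //.
    move=> e e0.
    have e20 : 0 < e / 2 by rewrite divr_gt0.
    have [d1 d10 H1] := acf _ e20; have [d2 d20 H2] := rint_abs_continuous a a b kl e20.
    exists (Num.min d1 d2); first by rewrite lt_min d10.
    move=> n s t st tI; rewrite lt_min => /andP[sd1 sd2].
    have := ltrD (H1 n s t st tI sd1) (H2 n s t st tI sd2).
    rewrite -splitr -big_split/=; apply: le_lt_trans; apply: ler_sum => i _.
    rewrite (_ : g (t i) - g (s i) = (f (t i) - f (s i)) - (rint leb a (t i) k - rint leb a (s i) k)); last by rewrite /g; ring.
    exact: ler_normB.
  have := Prim_ae_derive Pk; move: df; apply: aeS2 => x dfx dkx axb.
  have hk : h x = k x by rewrite /k patchE mem_setE in_itv/=; move: axb => /andP[/ltW -> ->].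
  have : is_derive x 1 (f \- (fun y => rint leb a y k)) (h x - k x).
    by apply: is_deriveB; exact: dfx.
  by rewrite hk subrr.
rewrite /g rintxx subr0 => ->; rewrite opprB addrC subrK rint_le//.
by apply: eq_Rintegral => x xab; rewrite /k patchE xab.
Qed.

End abscont.

(** * Smooth bumps and the du Bois-Reymond lemma *)

Section smooth.
Context {R : realType}.
Implicit Types (f g h : R -> R) (a b c x y z t : R).

(** Being n times differentiable, in a form suited to induction on n: sums and
    products are handled without formulas for higher derivatives. *)
Fixpoint Cn (n : nat) f : Prop :=
  if n is m.+1 then exists2 f', (forall x, is_derive x 1 f (f' x)) & Cn m f' else True.

Lemma CnS n f : Cn n.+1 f -> Cn n f.
Proof. by elim: n f => // n IH f [f' df /IH Cf']; exists f'. Qed.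

Lemma Cn_cst n k : Cn n (fun=> k).
Proof.
elim: n k => // n IH k; exists (fun=> 0); last exact: IH.
by move=> x; exact: is_derive_cst.
Qed.

Lemma CnD n f g : Cn n f -> Cn n g -> Cn n (fun x => f x + g x).
Proof.
elim: n f g => // n IH f g [f' df Cf'] [g' dg Cg'].
by exists (fun x => f' x + g' x); [move=> x; exact: is_deriveD|exact: IH].
Qed.

Lemma CnM n f g : Cn n f -> Cn n g -> Cn n (fun x => f x * g x).
Proof.
elim: n f g => // n IH f g Cf Cg.
have C0f := CnS Cf; have C0g := CnS Cg; move: Cf Cg => [f' df Cf'] [g' dg Cg'].
exists (fun x => f x * g' x + g x * f' x); last by apply: CnD; exact: IH.
by move=> x; exact: is_deriveM.
Qed.

Lemma CnZ n k f : Cn n f -> Cn n (fun x => k * f x).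
Proof. by apply: CnM; exact: Cn_cst. Qed.

Lemma Cn_affine n f k l : Cn n f -> Cn n (fun x => f (k * x + l)).
Proof.
elim: n f => // n IH f [f' df Cf'].
exists (fun x => f' (k * x + l) * k); last by apply: CnM; [exact: IH|exact: Cn_cst].
move=> x; apply: (@is_derive1_comp _ f (fun x => k * x + l)).
have : is_derive x 1 ((fun x => k * x) \+ cst l) (k *: 1 + 0).
  by apply: is_deriveD; apply: (@is_deriveZ _ _ _ id k).
by rewrite addr0 -[k *: 1]/(k * 1) mulr1.
Qed.

Lemma Cn_smooth f : (forall n, Cn n f) -> forall n x, derivable (derive1n n f) x 1.
Proof.
move=> Cf n; suff H m : Cn (m + n) f -> Cn m (derive1n n f).
  by have [f' df _] := H 1%N (Cf _); move=> x; case: (df x).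
elim: n m {Cf} => [|n IH] m; first by rewrite addn0.
rewrite addnS -addSn => /IH [f' df]; rewrite derive1nS.
congr (Cn m _); apply/funext => x; rewrite derive1E; by case: (df x).
Qed.

Lemma pow_expRN_le k (u : R) : 0 < u -> u ^+ k * expR (- u) <= k`!%:R.
Proof.
move=> u0; rewrite expRN ler_pdivrMr ?expR_gt0//.
case: k => [|k]; first by rewrite expr0 fact0 mul1r ltW// pexpR_gt1.
have := expR_ge1Dxn k (ltW u0).
have f0 : 0 < (k.+1)`!%:R :> R by rewrite ltr0n fact_gt0.
rewrite -ler_pdivrMl// mulrC; lra.
Qed.

(** The functions t^-k exp(-1/t), continued by zero, span a space that is stable
    under differentiation, so all of them are smooth. *)
Definition flat k t : R := if 0 < t then t^-1 ^+ k * expR (- t^-1) else 0.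

(** The bound gives differentiability at the origin, with derivative zero. *)
Lemma flat_le k t : `|flat k t| <= (k.+2)`!%:R * t ^+ 2.
Proof.
rewrite /flat; case: ifPn => t0; last by rewrite normr0 mulr_ge0// sqr_ge0.
have u0 : 0 < t^-1 by rewrite invr_gt0.
rewrite ger0_norm ?mulr_ge0 ?exprn_ge0 ?expR_ge0 ?(ltW u0)//.
have := pow_expRN_le k.+2 u0.
rewrite -(ler_pM2r (exprn_gt0 2 t0)); apply: le_trans.
rewrite le_eqVlt; apply/orP; left; apply/eqP.
by rewrite !exprS; field; rewrite gt_eqF.
Qed.

Lemma is_derive_flat k t : is_derive t 1 (flat k) (flat k.+2 t - k%:R * flat k.+1 t).
Proof.
case: (ltgtP t 0) => [t0|t0|->].
- have E j : flat j t = 0 by rewrite /flat ltNge (ltW t0).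
  rewrite !E mulr0 subr0.
  apply: (@near_eq_is_derive _ _ _ (fun=> (0 : R))).
  have := lt_nbhsl t0; apply: filterS => y y0.
  by rewrite /flat ltNge (ltW y0).
- have E j : flat j t = t^-1 ^+ j * expR (- t^-1) by rewrite /flat t0.
  rewrite !E.
  apply: (@near_eq_is_derive _ _ _ (fun t => t^-1 ^+ k * expR (- t^-1))).
    by have := lt_nbhsr t0; apply: filterS => y y0; rewrite /flat y0.
  have tn0 : t != 0 by rewrite gt_eqF.
  have dV : is_derive t 1 (fun t : R => t^-1) (- t ^- 2 *: 1) by exact: is_deriveV.
  have dX : is_derive t 1 (fun t : R => t^-1 ^+ k) (k%:R * t^-1 ^+ k.-1 *: (- t ^- 2 *: 1)).
    by have := is_deriveX k dV; rewrite exprfctE.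
  have dE : is_derive t 1 (fun t : R => expR (- t^-1)) (expR (- t^-1) * (- (- t ^- 2 *: 1))).
    exact: (@is_derive1_comp _ expR (fun t => - t^-1) _ _ _ (is_derive_expR _) (is_deriveN dV)).
  have := is_deriveM dX dE; congr is_derive.
  rewrite -![_ *: _]/(_ * _); case: k {dX} => [|k]; rewrite ?exprS ?expr0; field => //.
- have E j : flat j 0 = 0 by rewrite /flat ltxx.
  rewrite !E mulr0 subr0.
  have d0 : h^-1 *: (flat k (h *: 1 + 0) - flat k 0) @[h --> 0^'] --> (0 : R).
    apply/cvgrPdist_le => e e0.
    pose C : R := (k.+2)`!%:R.
    have C0 : 0 < C by rewrite ltr0n fact_gt0.
    near=> h; rewrite sub0r normrN addr0 -![_ *: _]/(_ * _) mulr1 E subr0.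
    have h0 : h != 0 by near: h; exact: nbhs_dnbhs_neq.
    have hp : 0 < `|h| by rewrite normr_gt0.
    have hC : `|h| <= e / C.
      near: h; apply: dnbhs0_le; exact: divr_gt0.
    rewrite normrM normfV ler_pdivrMl// (le_trans (flat_le _ _))// -/C.
    move: hC; rewrite ler_pdivlMr// => hC.
    rewrite -normr_id -(real_normK (num_real h)) normr_id; nra.
  split; first by apply/cvg_ex; exists 0.
  exact/cvg_lim.
Unshelve. all: by end_near.
Qed.

Lemma flat_Cn n k : Cn n (flat k).
Proof.
elim: n k => // n IH k; exists (fun t => flat k.+2 t - k%:R * flat k.+1 t).
  by move=> x; exact: is_derive_flat.
rewrite (_ : (fun t => _) = (fun t => flat k.+2 t + (- k%:R) * flat k.+1 t)).
  by apply: CnD; [exact: IH|apply: CnZ; exact: IH].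
by apply/funext => t; rewrite mulNr.
Qed.
(** Smooth functions with support [x, y] that increase to the indicator function
    of (x, y) as n grows. *)
Definition bump n x y t : R := flat 0 (n.+1%:R * t + - (n.+1%:R * x)) * flat 0 (- n.+1%:R * t + n.+1%:R * y).

Lemma bump_Cn m n x y : Cn m (bump n x y).
Proof. by apply: CnM; apply: Cn_affine; exact: flat_Cn. Qed.

Lemma flat01 t : 0 <= flat 0 t <= 1.
Proof.
rewrite /flat; case: ifP => t0; last by rewrite lexx ler01.
by rewrite expr0 mul1r expR_ge0/= expR_le1 oppr_le0 invr_ge0 ltW.
Qed.

Lemma bump01 n x y t : 0 <= bump n x y t <= 1.
Proof.
have /andP[a0 a1] := flat01 (n.+1%:R * t + - (n.+1%:R * x)).
have /andP[b0 b1] := flat01 (- n.+1%:R * t + n.+1%:R * y).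
by rewrite /bump mulr_ge0//= mulr_ile1.
Qed.

Lemma bump_out n x y t : t <= x \/ y <= t -> bump n x y t = 0.
Proof.
rewrite /bump /flat => -[tx|yt].
  rewrite ifF ?mul0r//; apply/negbTE; rewrite -leNgt -mulrBr.
  by rewrite mulr_ge0_le0// subr_le0.
rewrite [X in _ * X]ifF ?mulr0//; apply/negbTE; rewrite -leNgt mulNr addrC -mulrBr.
by rewrite mulr_ge0_le0// subr_le0.
Qed.

Lemma flat_cvg (s : R) : 0 < s -> flat 0 (n.+1%:R * s) @[n --> \oo] --> (1 : R).
Proof.
move=> s0.
rewrite (_ : (fun n => _) = (fun n => expR (- (n.+1%:R^-1 * s^-1)))); last first.
  by apply/funext => n; rewrite /flat mulr_gt0// expr0 mul1r invfM.
rewrite -[X in _ --> X]expR0; apply: continuous_cvg; first exact: continuous_expR.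
rewrite -[X in _ --> X]oppr0 -[X in - X](mul0r s^-1); apply: cvgN.
by apply: cvgM; [exact: cvg_harmonic|exact: cvg_cst].
Qed.

Lemma bump_cvg x y t : x < t < y -> bump n x y t @[n --> \oo] --> (1 : R).
Proof.
move=> /andP[xt ty]; rewrite -[1](mulr1 1) /bump; apply: cvgM.
  under eq_fun do rewrite -mulrBr.
  by apply: flat_cvg; rewrite subr_gt0.
under eq_fun do rewrite mulNr addrC -mulrBr.
by apply: flat_cvg; rewrite subr_gt0.
Qed.
End smooth.

Section dubois.
Context {R : realType}.
Implicit Types (mu : {measure set (measurableTypeR R) -> \bar R}) (f g h : R -> R) (a b c x y z : R).
Local Notation leb := (@lebesgue_measure R).

Lemma Rintegral_dominated mu (D : set (measurableTypeR R)) (f_ : nat -> R -> R) f g :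
  measurable D -> (forall n, measurable_fun D (f_ n)) -> measurable_fun D f ->
  (forall x, D x -> f_ n x @[n --> \oo] --> f x) ->
  mu.-integrable D (EFin \o g) ->
  (forall n x, D x -> `|f_ n x| <= g x) ->
  mu.-integrable D (EFin \o f) /\
  \int[mu]_(x in D) f_ n x @[n --> \oo] --> \int[mu]_(x in D) f x.
Proof.
move=> mD mf_ mf fc gi fg.
have fc' x : D x -> (EFin \o f_ n) x @[n --> \oo] --> (EFin \o f) x.
  by move=> Dx; apply: cvg_EFin; [exact: nearW|exact: fc].
have fc2 : {ae mu, forall x, D x -> (EFin \o f_ n) x @[n --> \oo] --> (EFin \o f) x} by exact: aeW.
have fg2 : {ae mu, forall x n, D x -> (`|(EFin \o f_ n) x| <= (EFin \o g) x)%E}.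
  by apply: aeW => x n Dx; rewrite /= lee_fin fg.
have [fi _ H] := @dominated_convergence _ _ _ mu D mD (fun n => EFin \o f_ n) (EFin \o f) (EFin \o g)
  (fun n => (measurable_EFinP _ _).2 (mf_ n)) ((measurable_EFinP _ _).2 mf)
  fc2 gi
  fg2.
by split => //; apply: fine_cvg; rewrite fineK ?integrable_fin_num.
Qed.

Lemma Prim_derive f f' x : Prim f f' -> {for x, continuous f'} -> is_derive x 1 f (f' x).
Proof.
move=> [fi fE] cf.
have d0 : h^-1 *: (f (h *: 1 + x) - f x) @[h --> 0^'] --> f' x.
  apply/cvgrPdist_le => e e0.
  have [r/= r0 Hr] : exists2 r, 0 < r & forall t, ball x r t -> `|f' x - f' t| <= e.
    by move/cvgrPdist_le : cf => /(_ e e0)/nbhs_ballP[r r0 Hr]; exists r.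
  near=> h; rewrite -![_ *: _]/(_ * _) mulr1.
  have h0 : h != 0 by near: h; exact: nbhs_dnbhs_neq.
  have hp : 0 < `|h| by rewrite normr_gt0.
  have hr : `|h| < r by near: h; exact: dnbhs0_lt.
  rewrite -(ler_pM2r hp) -normrM (_ : (f' x - _) * _ = - (f (h + x) - f x - f' x * h)); last by field.
  rewrite normrN fE.
  have K u v : u <= v -> (forall t, u <= t < v -> `|t - x| < r) ->
      `|rint leb u v f' - f' x * (v - u)| <= e * (v - u).
    move=> uv Ht.
    have ic k : locint leb (fun=> k) by apply: lbm_locint; [exact: lebesgue_locally_finite|exact: lbm_cst].
    rewrite -(rint_cst (f' x)) -(rint_cst e) -rintB// !rint_le//.
    have ii := locintB fi (ic (f' x)).
    rewrite (le_trans (le_normr_Rintegral _ (ii u v)))//.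
    apply: le_Rintegral => //; [exact: (integrable_norm (ii u v))|exact: ic|].
    move=> t /=; rewrite in_itv/= => /Ht tr.
    rewrite distrC; apply: (Hr t); by rewrite /ball/= distrC.
  case: (leP 0 h) => h1.
    rewrite (ger0_norm h1); have := K x (h + x); rewrite addrK; apply; first by rewrite lerDr.
    move=> t /andP[xt tx]; rewrite ger0_norm in hr => //; rewrite ger0_norm; lra.
  rewrite (ltr0_norm h1); have := K (h + x) x; rewrite rintC -normrN.
  rewrite (_ : x - (h + x) = - h); last by ring.
  rewrite mulrN.
  rewrite (_ : - (rint leb x (h + x) f' - f' x * h) = - rint leb x (h + x) f' - - (f' x * h)); last by ring.
  apply; first by rewrite gerDr ltW.
  move=> t /andP[xt tx]; rewrite ltr0_norm in hr => //; rewrite ler0_norm; lra.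
split; first by apply/cvg_ex; exists (f' x).
exact/cvg_lim.
Unshelve. all: by end_near.
Qed.

Lemma Cn_continuous f : (forall n, Cn n f) -> continuous f.
Proof.
move=> Cf x; have [f' df _] := Cf 1%N.
by apply/differentiable_continuous/derivable1_diffP; case: (df x).
Qed.

Lemma Cn_locint f mu : locally_finite mu -> (forall n, Cn n f) -> locint mu f.
Proof. by move=> lmu /Cn_continuous cf; apply: lbm_locint => //; exact: continuous_lbm. Qed.

Lemma rint_eq mu a b f g : (forall x, Num.min a b <= x < Num.max a b -> f x = g x) -> rint mu a b f = rint mu a b g.
Proof.
move=> fg; rewrite /rint; case: (leP a b) => ab; [|congr (- _)]; apply: eq_Rintegral => x;
  rewrite inE/= in_itv/= => xab; apply: fg; [rewrite min_l ?max_r|rewrite min_r ?max_l ?(ltW ab)]; by rewrite ?ab.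
Qed.

Lemma rint0 mu a b f : (forall x, Num.min a b <= x < Num.max a b -> f x = 0) -> rint mu a b f = 0.
Proof.
move=> f0; rewrite (@rint_eq mu a b f (fun=> 0)) //.
by rewrite /rint; case: ifP => _; rewrite /Rintegral integral0 ?oppr0.
Qed.

(** Integrals over intervals are limits of integrals against smooth functions. *)
Lemma bump_rint_cvg x y q : locint leb q -> x <= y ->
  rint leb x y (fun t => bump n x y t * q t) @[n --> \oo] --> rint leb x y q.
Proof.
move=> qi xy.
have mq := locint_measurable qi.
have mb n : measurable_fun setT (bump n x y) by apply: continuous_measurable_fun; apply: Cn_continuous => m; exact: bump_Cn.
have oc f : locint leb f -> rint leb x y f = \int[leb]_(t in `]x, y[) f t.
  move=> fi; rewrite rint_le// Rintegral_itv_obnd_cbnd//.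
  apply: (integrableS _ _ _ (fi x y)) => //.
  by move=> w/=; rewrite !in_itv/= => /andP[/ltW -> ->].
have bi n : locint leb (fun t => bump n x y t * q t).
  by apply: locintMl => //; apply: continuous_lbm; apply: Cn_continuous => m; exact: bump_Cn.
rewrite oc//; under eq_fun do rewrite oc//.
apply: (proj2 (Rintegral_dominated (g := fun t => `|q t|) _ _ _ _ _ _)) => //.
- by move=> n; apply: measurable_funTS; exact: (measurable_funM (mb n) mq).
- exact: measurable_funTS.
- move=> t /=; rewrite in_itv/= => xty; rewrite -[X in _ --> X]mul1r.
  by apply: cvgM; [exact: bump_cvg|exact: cvg_cst].
- apply: (integrableS _ _ _ (integrable_norm (qi x y))) => //.
  by move=> w/=; rewrite !in_itv/= => /andP[/ltW -> ->].
- move=> n t _; have /andP[b0 b1] := bump01 n x y t.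
  by rewrite normrM ger0_norm// ler_piMl.
Qed.

(** The function psi, a bump on (x, y) minus a multiple of the fixed bump rho on
    (0, 1), has integral zero and is therefore the derivative of a test function.
    Hence the integrals of q against the bumps on (x, y) are C times the integrals
    of the bumps; in the limit, q - C has integral zero over every interval. *)
Lemma du_bois_reymond q : locint leb q ->
  (forall a b phi, a <= b -> test_function a b phi -> rint leb a b (fun t => derive1 phi t * q t) = 0) ->
  exists C, {ae leb, forall x, q x = C}.
Proof.
move=> qi H.
have lbmb n x y : lbm (bump n x y) by apply: continuous_lbm; apply: Cn_continuous => m; exact: bump_Cn.
have ib n x y : locint leb (bump n x y) by apply: lbm_locint => //; exact: lebesgue_locally_finite.
have ic k : locint leb (fun=> k) by apply: lbm_locint; [exact: lebesgue_locally_finite|exact: lbm_cst].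
have r1 x y : rint leb x y (fun=> 1) = y - x by rewrite rint_cst mul1r.
have [N cN] : exists N, rint leb 0 1 (bump N 0 1) != 0.
  have := bump_rint_cvg (ic 1) (@ler01 R); rewrite r1 subr0.
  under eq_fun do under eq_fun do rewrite mulr1.
  move=> /cvgrPdist_lt/(_ 1 ltr01)[N _ /(_ N (leqnn N))] /= HN.
  by exists N; apply: contraTneq HN => ->; rewrite subr0 normr1 ltxx.
pose rho : R -> R := bump N 0 1.
pose c0 := rint leb 0 1 rho.
pose C := rint leb 0 1 (fun t => rho t * q t) / c0.
have key n x y : x <= y -> rint leb x y (fun t => bump n x y t * q t) = C * rint leb x y (bump n x y).
  move=> xy.
  pose m := rint leb x y (bump n x y).
  pose psi (t : R) : R := bump n x y t + - (m / c0) * rho t.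
  have Cpsi k : Cn k psi by apply: CnD; [exact: bump_Cn|apply: CnZ; exact: bump_Cn].
  have psi_i : locint leb psi by apply: Cn_locint => //; exact: lebesgue_locally_finite.
  pose a := Num.min 0 x; pose b := Num.max 1 y.
  have a0 : a <= 0 by rewrite ge_min lexx.
  have ax : a <= x by rewrite ge_min lexx orbT.
  have b1 : 1 <= b by rewrite le_max lexx.
  have yb : y <= b by rewrite le_max lexx orbT.
  have ab : a <= b by rewrite (le_trans a0)// (le_trans ler01).
  have psi0 t : t <= a \/ b <= t -> psi t = 0.
    move=> tab; rewrite /psi /rho !bump_out ?mulr0 ?addr0//; case: tab => tab;
      by [left; apply: le_trans tab _|right; apply: le_trans tab].
  have ext k u v f : a <= u -> u <= v -> v <= b -> locint leb f ->
      rint leb a b (fun t => bump k u v t * f t) = rint leb u v (fun t => bump k u v t * f t).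
    move=> au uv vb fi.
    have bi : locint leb (fun t => bump k u v t * f t) by exact: locintMl.
    rewrite -(rint_cat bi a u b) -(rint_cat bi u v b) (@rint0 leb a u) ?add0r; last first.
      move=> t; rewrite min_l// max_r// => /andP[_ tu]; rewrite bump_out ?mul0r//; by left; exact: ltW.
    rewrite (@rint0 leb v b) ?addr0// => t; rewrite min_l// max_r// => /andP[vt _].
    by rewrite bump_out ?mul0r//; right.
  pose phi (t : R) : R := rint leb a t psi.
  have dphi (t : R) : is_derive t 1 phi (psi t).
    by apply: Prim_derive; [exact: Prim_rint|exact: Cn_continuous].
  have phib : phi b = 0.
    rewrite /phi /psi rintD//; last by apply: locintZ; exact: ib.
    rewrite rintZ//; last exact: ib.
    have e1 := ext n x y (fun=> 1) ax xy yb (ic 1).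
    have e2 := ext N 0 1 (fun=> 1) a0 ler01 b1 (ic 1).
    have one k u v : (fun t => bump k u v t * 1) = bump k u v by apply/funext => t; rewrite mulr1.
    move: e1 e2; rewrite !one => ->.
    move=> E2; rewrite E2 -/m -/rho -/c0 mulNr divfK; first by rewrite subrr.
    exact: cN.
  have tphi : test_function a b phi.
    split.
      apply: Cn_smooth => -[//|k]; exists psi => //.
    move=> t; rewrite in_itv/= negb_and -!ltNge => /orP[ta|bt].
      apply: rint0 => s; rewrite min_r ?max_l ?(ltW ta)// => /andP[_ sa].
      by apply: psi0; left; exact: ltW.
    rewrite /phi -(rint_cat psi_i a b t) -/(phi b) phib add0r; apply: rint0 => s.
    rewrite min_l ?max_r ?(ltW bt)// => /andP[bs _]; by apply: psi0; right.
  have := H a b phi ab tphi.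
  have -> : (fun t => derive1 phi t * q t) = (fun t => bump n x y t * q t + - (m / c0) * (rho t * q t)).
    apply/funext => t; rewrite derive1E; have [_ ->] := dphi t.
    rewrite /psi; ring.
  rewrite rintD//; [|exact: locintMl|by apply: locintZ; apply: locintMl => //; exact: lbmb].
  rewrite rintZ//; last by apply: locintMl => //; exact: lbmb.
  rewrite (ext n x y q)// (ext N 0 1 q)//.
  rewrite /C -/m -/rho => /eqP; rewrite mulNr subr_eq0 => /eqP ->; field.
  exact: cN.
exists C.
have P0 : Prim (fun=> 0) (fun t => q t - C * 1).
  have qC : locint leb (fun t => q t - C * 1) by apply: locintB => //; exact: ic.
  suff P x y : x <= y -> rint leb x y (fun t => q t - C * 1) = 0.
    split => // x y; rewrite subrr; case: (leP x y) => [|/ltW] /P// E.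
    by rewrite rintC E oppr0.
  move=> xy; rewrite rintB//.
  apply/eqP; rewrite subr_eq0; apply/eqP.
  have c1 := bump_rint_cvg qi xy.
  have c2 := bump_rint_cvg (ic (C * 1)) xy.
  rewrite -(cvg_lim (@Rhausdorff R) c1) -(cvg_lim (@Rhausdorff R) c2).
  congr (lim (_ @ \oo)); apply/funext => n.
  rewrite key//; under [in RHS]eq_fun do rewrite mulr1 mulrC.
  by rewrite rintZ.
have := Prim_ae_derive P0; apply: aeS => x dx.
have : is_derive x 1 (cst 0 : R -> R) (q x - C * 1) by exact: dx.
have [_ d1] := @is_derive_cst R R R (0 : R) x 1.
by move=> [_]; rewrite d1 mulr1 => /eqP; rewrite eq_sym subr_eq0 => /eqP.
Qed.
End dubois.

(** * Square integrable functions and almost everywhere equality *)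

Section l2.
Import HBNNSimple.
Context {R : realType}.
Implicit Types (mu : {measure set (measurableTypeR R) -> \bar R}) (f g h : R -> R) (a b x y z : R) (D E : set (measurableTypeR R)).
Local Notation leb := (@lebesgue_measure R).

Definition L2on mu D f := measurable_fun D f /\ mu.-integrable D (EFin \o (fun x => f x ^+ 2)).

Lemma L2onM mu D f g : measurable D -> L2on mu D f -> L2on mu D g -> mu.-integrable D (EFin \o (fun x => f x * g x)).
Proof.
move=> mD [mf fi] [mg gi].
apply: (le_integrable mD _ _ (integrableD mD fi gi)).
  by apply/measurable_EFinP; exact: measurable_funM.
move=> x _ /=; rewrite lee_fin normrM [leRHS]ger0_norm ?addr_ge0 ?sqr_ge0//.
rewrite -(real_normK (num_real (f x))) -(real_normK (num_real (g x))).
have := sqr_ge0 (`|f x| - `|g x|); have := normr_ge0 (f x); have := normr_ge0 (g x).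
by move: `|f x| `|g x| => u v; nra.
Qed.

Lemma L2onZ mu D k f : measurable D -> L2on mu D f -> L2on mu D (fun x => k * f x).
Proof.
move=> mD [mf fi]; split; first by apply: measurable_funM => //; exact: measurable_cst.
have := integrableZl mD (k ^+ 2) fi; congr (integrable _ _ _).
by apply/funext => x /=; rewrite exprMn EFinM.
Qed.

Lemma L2onD mu D f g : measurable D -> L2on mu D f -> L2on mu D g -> L2on mu D (fun x => f x + g x).
Proof.
move=> mD Lf Lg; split; first by apply: measurable_funD; [exact: Lf.1|exact: Lg.1].
have := integrableD mD (integrableD mD Lf.2 Lg.2) (integrableZl mD 2 (L2onM mD Lf Lg)).
congr (integrable _ _ _).
by apply/funext => x /=; rewrite -!EFinM -!EFinD; congr EFin; ring.
Qed.

Lemma L2onB mu D f g : measurable D -> L2on mu D f -> L2on mu D g -> L2on mu D (fun x => f x - g x).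
Proof.
move=> mD Lf Lg; have := L2onD mD Lf (L2onZ (-1) mD Lg).
by congr L2on; apply/funext => x; rewrite mulN1r.
Qed.

Lemma L2on_sub mu D E f : measurable D -> measurable E -> E `<=` D -> L2on mu D f -> L2on mu E f.
Proof.
by move=> mD mE ED [mf fi]; split; [exact: measurable_funS mf|exact: (integrableS _ _ ED fi)].
Qed.

Lemma L2on_eq mu D f g : measurable D -> (forall x, D x -> f x = g x) -> L2on mu D f -> L2on mu D g.
Proof.
move=> mD fg [mf fi]; split.
  by apply: (eq_measurable_fun f) => // x; rewrite inE => /fg.
apply: (le_integrable mD _ _ fi) => [|x Dx /=]; last by rewrite fg.
apply/measurable_EFinP; apply: measurable_funX.
by apply: (eq_measurable_fun f) => // x; rewrite inE => /fg.
Qed.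

Lemma L2on_patch mu D E f : measurable D -> measurable E -> D `<=` E -> L2on mu D f -> L2on mu E (f \_ D).
Proof.
move=> mD mE DE [mf fi]; split.
  apply: measurable_funTS; exact/(measurable_restrictT _ _).1.
apply: (integrableS measurableT) => //.
have := integrable_patch mD fi; congr (integrable _ _ _).
by apply/funext => x /=; rewrite !patchE; case: ifP => // _; rewrite expr0n.
Qed.

Lemma L2on_lbm mu a b f : locally_finite mu -> lbm f -> L2on mu `[a, b[ f.
Proof.
move=> lmu lf; split; first exact: measurable_funTS lf.1.
exact: (lbm_locint lmu (lbmM lf lf) a b).
Qed.

Lemma L2on_locint mu f : locally_finite mu -> (forall a b, L2on mu `[a, b[ f) -> locint mu f.
Proof.
move=> lmu Lf a b.
have := L2onM (measurable_itv _) (Lf a b) (L2on_lbm a b lmu (lbm_cst 1)).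
by congr (integrable _ _ _); apply/funext => x /=; rewrite mulr1.
Qed.
Lemma L2on0 mu D : L2on mu D (fun=> 0).
Proof.
split; first exact: measurable_cst.
by rewrite (_ : _ \o _ = cst 0%E); [exact: integrable0|apply/funext => x /=; rewrite expr0n].
Qed.

(** The default value of a restricted real function is zero by conversion only;
    this form exposes it to ring tactics. *)
Lemma patch0 (D : set R) f x : (f \_ D) x = if x \in D then f x else 0.
Proof. by []. Qed.

Lemma Rintegral_mulr0 mu D f : \int[mu]_(x in D) (f x * 0) = 0.
Proof. by under eq_Rintegral do rewrite mulr0; rewrite /Rintegral integral0. Qed.

(** The integral of a nonnegative function is a supremum over the simple functions
    below it, so monotonicity holds for nonmeasurable integrands too. *)
Lemma ge0_le_integral_nm mu (f g : R -> \bar R) :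
  (forall x, 0 <= f x)%E -> (forall x, f x <= g x)%E -> (\int[mu]_x f x <= \int[mu]_x g x)%E.
Proof.
move=> f0 fg; have g0 x : (0 <= g x)%E by exact: le_trans (fg x).
rewrite !ge0_integralTE//; apply: ereal_sup_le => _ [h hf <-].
exists h => // x; exact: le_trans (hf x) (fg x).
Qed.

(** Cut off the simple functions below f outside the null set N. *)
Lemma ge0_integral_ae_le mu (f g : R -> \bar R) (N : set (measurableTypeR R)) :
  measurable N -> mu N = 0%E -> (forall x, 0 <= f x)%E -> (forall x, 0 <= g x)%E ->
  (forall x, ~ N x -> f x <= g x)%E -> (\int[mu]_x f x <= \int[mu]_x g x)%E.
Proof.
move=> mN N0 f0 g0 fg.
rewrite [leLHS]ge0_integralTE//; apply: ub_ereal_sup => _ [h hf <-].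
rewrite -integralT_nnsfun.
have mh : measurable_fun setT h by exact: measurable_funPT.
have -> : (\int[mu]_x (h x)%:E = \int[mu]_x (((EFin \o h) \_ (~` N)) x))%E.
  apply: ae_eq_integral => //.
  - exact/measurable_EFinP.
  - apply/(measurable_restrictT _ _).1; first exact: measurableC.
    by apply: measurable_funTS; exact/measurable_EFinP.
  - exists N; split => // x /= /not_implyP[_ H]; apply: contrapT => Nx; apply: H.
    by rewrite patchE mem_set.
apply: ge0_le_integral_nm => x; rewrite patchE; case: ifPn => //.
  by move=> _; rewrite lee_fin.
by rewrite inE => Nx; apply: (le_trans (hf x)); exact: fg.
Qed.

Lemma ge0_integral_ae_nm mu (f g : R -> \bar R) (N : set (measurableTypeR R)) :
  measurable N -> mu N = 0%E -> (forall x, 0 <= f x)%E -> (forall x, 0 <= g x)%E ->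
  (forall x, ~ N x -> f x = g x)%E -> (\int[mu]_x f x = \int[mu]_x g x)%E.
Proof.
move=> mN N0 f0 g0 fg; apply/le_anti/andP; split; apply: (ge0_integral_ae_le mN) => // x Nx;
  by rewrite fg.
Qed.

(** The derivative of a representative is equal almost everywhere to a measurable
    function; this replaces it under the integral without proving it measurable. *)
Lemma Rintegral_ae_nm mu D f g : {ae mu, forall x, D x -> f x = g x} ->
  \int[mu]_(x in D) f x = \int[mu]_(x in D) g x.
Proof.
move=> [N [mN N0 sN]]; congr fine.
have fg x : ~ N x -> D x -> f x = g x.
  by move=> Nx Dx; apply: contrapT => H; apply: Nx; apply: sN => /= H'; exact/H/H'.
rewrite integralE [RHS]integralE; congr (_ - _)%E; rewrite !(integral_mkcond D);
  apply: (ge0_integral_ae_nm mN) => // x; rewrite !patchE; case: ifPn => //; rewrite inE => Dx;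
  by move=> /fg/(_ Dx) E; rewrite !(funeposE, funenegE) E.
Qed.

Lemma rint_ae_nm mu a b f g : {ae mu, forall x, Num.min a b <= x < Num.max a b -> f x = g x} ->
  rint mu a b f = rint mu a b g.
Proof.
move=> fg; rewrite /rint; case: (leP a b) => ab; [|congr (- _)]; apply: Rintegral_ae_nm;
  move: fg; apply: aeS => x H; rewrite /= in_itv/= => xab; apply: H;
  by [rewrite min_l ?max_r|rewrite min_r ?max_l ?(ltW ab)].
Qed.
End l2.


(** * The differential equation in integrated form *)

Section equation.
Context {R : realType}.
Variables (omega : lf_signed_measure R) (upsilon : {measure set (measurableTypeR R) -> \bar R}).
Hypothesis upsilon_lf : locally_finite upsilon.
Variable c : R.
Implicit Types (mu : {measure set (measurableTypeR R) -> \bar R}) (f g h : R -> R) (a b x y z : R).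
Local Notation leb := (@lebesgue_measure R).

Lemma C1_Prim f f' : (forall x, is_derive x 1 f (f' x)) -> continuous f' -> Prim f f'.
Proof.
move=> df cf'.
have fi : locint leb f' by apply: lbm_locint; [exact: lebesgue_locally_finite|exact: continuous_lbm].
have PF := Prim_rint 0 fi.
split=> // x y.
have d0 (t : R) : is_derive t 1 (f - (fun x => rint leb 0 x f')) 0.
  by have := is_deriveB (df t) (Prim_derive PF (@cf' t)); rewrite subrr.
have := is_derive_0_is_cst y x d0; rewrite !fctE => E.
rewrite -(rint_cat fi x 0 y) rintC; lra.
Qed.

Lemma Prim_ae f p q : Prim f p -> locint leb q -> {ae leb, forall x, p x = q x} -> Prim f q.
Proof.
move=> [pi pE] qi pq; split=> // x y; rewrite pE; apply: rint_ae_nm.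
by move: pq; apply: aeS => t E _.
Qed.

Lemma Prim_expR k b : Prim (fun x => expR (k * (x - b))) (fun x => k * expR (k * (x - b))).
Proof.
have dk (x : R) : is_derive x 1 (fun x => k * (x - b)) k.
  have := is_deriveZ k (is_deriveB (is_derive_id x 1) (is_derive_cst b x 1)).
  by rewrite subr0 -[k *: 1]/(k * 1) mulr1.
have d (x : R) : is_derive x 1 (fun x => expR (k * (x - b))) (k * expR (k * (x - b))).
  by rewrite mulrC; exact: (@is_derive1_comp _ expR (fun x => k * (x - b)) _ _ _ (is_derive_expR _) (dk x)).
have cE : continuous (fun x => expR (k * (x - b))).
  by move=> x; apply/differentiable_continuous/derivable1_diffP; case: (d x).
by apply: C1_Prim => // x; apply: cvgM; [exact: cvg_cst|exact: cE].
Qed.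
Definition real_osint x y f : R := if x <= y then sint omega x y f else - sint omega y x f.

(** The primitive of omega g + upsilon g2 that vanishes at c, where the integral of g
    against omega has been integrated by parts (see rosint_source). *)
Definition source_primitive g g' g2 x : R :=
  g x * odist omega c x - rint leb c x (fun t => g' t * odist omega c t) + rint upsilon c x g2.

Lemma locint_W g' : locint leb g' -> locint leb (fun t => g' t * odist omega c t).
Proof.
move=> gi; under eq_fun do rewrite mulrC.
by apply: locintMl => //; exact: odist_lbm.
Qed.

Lemma source_lbm g g' g2 : Prim g g' -> locint upsilon g2 -> lbm (source_primitive g g' g2).
Proof.
move=> Pg g2i; apply: lbmD; last exact: rint_lbm.
apply: lbmB; first by apply: lbmM; [exact: Prim_lbm Pg|exact: odist_lbm].
by apply: rint_lbm; apply: locint_W; case: Pg.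
Qed.

Lemma source_c g g' g2 : source_primitive g g' g2 c = 0.
Proof. by rewrite /source_primitive !rintxx odistxx mulr0 subr0 addr0. Qed.

Lemma rosint_source g g' g2 : Prim g g' -> locint upsilon g2 -> forall x y,
  real_osint x y g + rint upsilon x y g2 = source_primitive g g' g2 y - source_primitive g g' g2 x.
Proof.
move=> Pg g2i x y.
have wi := locint_W Pg.1.
have H u v : u <= v -> real_osint u v g + rint upsilon u v g2 = source_primitive g g' g2 v - source_primitive g g' g2 u.
  move=> uv; rewrite /real_osint uv (sint_ibp _ c Pg)// /source_primitive.
  rewrite -(rint_cat wi c u v) -(rint_cat g2i c u v); ring.
case: (leP x y) => [|xy]; first exact: H.
have := H y x (ltW xy); rewrite /real_osint (ltW xy) leNgt xy/= rintC; lra.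
Qed.

(** Integration by parts for the measure omega g + upsilon g2 and its primitive. *)
Lemma source_pairing g g' g2 phi phi' a b : Prim g g' -> locint upsilon g2 -> Prim phi phi' -> a <= b ->
  sint omega a b (fun x => g x * phi x) + rint upsilon a b (fun x => phi x * g2 x) =
  phi b * source_primitive g g' g2 b - phi a * source_primitive g g' g2 a - rint leb a b (fun x => phi' x * source_primitive g g' g2 x).
Proof.
move=> Pg g2i Pp ab.
have wi := locint_W Pg.1.
have lg := Prim_lbm Pg; have lp := Prim_lbm Pp.
have lW := odist_lbm omega c.
have pi := Pp.1.
rewrite (sint_ibp _ c (PrimM Pg Pp))// (rint_ibp c upsilon_lf g2i Pp).
have Pwi := Prim_rint c wi.
have := rint_ibp c lebesgue_locally_finite wi Pp a b.
have i1 : locint leb (fun t => (g t * odist omega c t) * phi' t) by apply: locintMl => //; exact: lbmM.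
have i2 : locint leb (fun t => phi t * (g' t * odist omega c t)) by exact: locintMl.
have lI := Prim_lbm Pwi.
have i3 : locint leb (fun t => rint leb c t (fun s => g' s * odist omega c s) * phi' t) by exact: locintMl.
have i4 : locint leb (fun t => rint upsilon c t g2 * phi' t) by apply: locintMl => //; exact: rint_lbm.
rewrite (_ : (fun t => (g' t * phi t + g t * phi' t) * odist omega c t) =
   (fun t => phi t * (g' t * odist omega c t) + (g t * odist omega c t) * phi' t)); last first.
  by apply/funext => t; ring.
rewrite (rintD a b i2 i1).
rewrite (_ : (fun t => phi' t * rint leb c t (fun t => g' t * odist omega c t)) =
  (fun t => rint leb c t (fun s => g' s * odist omega c s) * phi' t)); last by apply/funext => t; ring.
rewrite (_ : (fun t => phi' t * rint upsilon c t g2) = (fun t => rint upsilon c t g2 * phi' t)); last first.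
  by apply/funext => t; ring.
rewrite (_ : (fun x => phi' x * source_primitive g g' g2 x) = (fun t => (g t * odist omega c t) * phi' t -
   rint leb c t (fun s => g' s * odist omega c s) * phi' t + rint upsilon c t g2 * phi' t)); last first.
  by apply/funext => t; rewrite /source_primitive; ring.
rewrite (rintD a b (locintB i1 i3) i4) (rintB a b i1 i3) /source_primitive; lra.
Qed.
Lemma cont_zero_edge h a : continuous h -> (forall x, x < a -> h x = 0) -> h a = 0.
Proof.
move=> ch h0; apply: contrapT => /eqP ha.
have ha0 : 0 < `|h a| by rewrite normr_gt0.
have /cvgrPdist_lt/(_ _ ha0)/nbhs_ballP[r/= r0 Hr] := ch a.
have ar : a - r / 2 < a by rewrite ltrBlDr ltrDl divr_gt0.
have := Hr (a - r / 2); rewrite /= (h0 _ ar) subr0 ltxx.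
suff : ball a r (a - r / 2) by move=> B /(_ B).
rewrite /ball/= opprD opprK addNKr ger0_norm ?divr_ge0 ?ltW//.
by rewrite ltr_pdivrMr// mulr2n mulrDr mulr1 ltrDl.
Qed.

Lemma cont_zero_edge_right h b : continuous h -> (forall x, b < x -> h x = 0) -> h b = 0.
Proof.
move=> ch h0; have := @cont_zero_edge (fun x => h (- x)) (- b); rewrite opprK; apply.
  by move=> x; apply: continuous_comp; [exact: opp_continuous|exact: ch].
by move=> x xb; apply: h0; rewrite ltrNr.
Qed.

(** A test function is only required to vanish outside of [a, b]; by continuity it and
    its derivative also vanish at the endpoints. *)
Lemma test_functionP a b phi : test_function a b phi -> a <= b ->
  [/\ Prim phi (derive1 phi), Prim (derive1 phi) (derive1n 2 phi),
      (forall x, x <= a \/ b <= x -> phi x = 0) &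
      (forall x, x <= a \/ b <= x -> derive1 phi x = 0)].
Proof.
move=> [dphi phi0] ab.
have c_n n : continuous (derive1n n phi).
  by move=> x; apply/differentiable_continuous/derivable1_diffP; exact: dphi.
have d_n n (x : R) : is_derive x 1 (derive1n n phi) (derive1n n.+1 phi x).
  by apply: DeriveDef; [exact: dphi|rewrite derive1nS derive1E].
have out x : x < a \/ b < x -> phi x = 0.
  move=> xab; apply: phi0; rewrite in_itv/= negb_and -!ltNge.
  by apply/orP.
have out' x : x < a \/ b < x -> derive1 phi x = 0.
  move=> xab; rewrite derive1E.
  have E : \near x, (cst 0 : R -> R) x = phi x.
    case: xab => [xa|bx].
      by have := lt_nbhsl xa; apply: filterS => y ya; rewrite out//; left.
    by have := lt_nbhsr bx; apply: filterS => y ya; rewrite out//; right.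
  by rewrite -(near_eq_derive (1 : R) E); case: (@is_derive_cst R R R (0 : R) x 1).
split.
- by apply: C1_Prim; [exact: (d_n 0%N)|exact: (c_n 1%N)].
- by apply: C1_Prim; [exact: (d_n 1%N)|exact: (c_n 2%N)].
- move=> x [|]; rewrite le_eqVlt => /orP[/eqP xa|xa]; try by apply: out; [left|right].
  + by rewrite xa; apply: cont_zero_edge; [exact: (c_n 0%N)|move=> y ya; apply: out; left].
  + by apply: out; left.
  + by rewrite -xa; apply: cont_zero_edge_right; [exact: (c_n 0%N)|move=> y ya; apply: out; right].
  + by apply: out; right.
- move=> x [|]; rewrite le_eqVlt => /orP[/eqP xa|xa].
  + by rewrite xa; apply: cont_zero_edge; [exact: (c_n 1%N)|move=> y ya; apply: out'; left].
  + by apply: out'; left.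
  + by rewrite -xa; apply: cont_zero_edge_right; [exact: (c_n 1%N)|move=> y ya; apply: out'; right].
  + by apply: out'; right.
Qed.

Definition distributional_eq f g g2 := forall a b phi, test_function a b phi ->
  - (\int[leb]_(x in `[a, b[) (f x * derive1n 2 phi x)) + 4^-1 * (\int[leb]_(x in `[a, b[) (f x * phi x)) =
  sint omega a b (fun x => g x * phi x) + (\int[upsilon]_(x in `[a, b[) (g2 x * phi x)).

Section distr.
Variables (f f' g g' g2 : R -> R).
Hypotheses (Pf : Prim f f') (Pg : Prim g g') (g2i : locint upsilon g2).
Let U x := rint leb c x f.
Let M := source_primitive g g' g2.

Let lf : lbm f. Proof. exact: Prim_lbm Pf. Qed.
Let fi : locint leb f. Proof. by apply: lbm_locint => //; exact: lebesgue_locally_finite. Qed.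
Let PU : Prim U f. Proof. exact: Prim_rint. Qed.
Let lU : lbm U. Proof. exact: Prim_lbm PU. Qed.
Let lM : lbm M. Proof. exact: source_lbm. Qed.

(** Integrating by parts once, the defect of the distributional equation becomes the
    integral of phi' against q = f' - U/4 + M. *)
Lemma distr_weak a b phi : test_function a b phi -> a <= b ->
  (- (\int[leb]_(x in `[a, b[) (f x * derive1n 2 phi x)) + 4^-1 * (\int[leb]_(x in `[a, b[) (f x * phi x))) -
  (sint omega a b (fun x => g x * phi x) + (\int[upsilon]_(x in `[a, b[) (g2 x * phi x))) =
  rint leb a b (fun x => derive1 phi x * (f' x - U x / 4 + M x)).
Proof.
move=> tphi ab; have [P1 P2 z1 z2] := test_functionP tphi ab.
have la : a <= a \/ b <= a by left. have lb : b <= a \/ b <= b by right.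
have l1 := Prim_lbm P1; have l2 := Prim_lbm P2.
rewrite -!(rint_le _ _ ab).
rewrite (_ : (fun x => g2 x * phi x) = (fun x => phi x * g2 x)); last by apply/funext => x; ring.
rewrite (source_pairing Pg g2i P1 ab) -/M !z1// !mul0r subrr sub0r.
have := rint_ibp c lebesgue_locally_finite fi P1 a b; rewrite -/U !z1// !mul0r subrr sub0r.
rewrite (_ : (fun x => phi x * f x) = (fun x => f x * phi x)); last by apply/funext => x; ring.
move=> ->.
have := (PrimM Pf P2).2 a b; rewrite !z2// !mulr0 subrr.
have i1 : locint leb (fun x => derive1 phi x * f' x) by apply: locintMl => //; case: Pf.
have i1' : locint leb (fun x => f' x * derive1 phi x) by under eq_fun do rewrite mulrC.
have i2 : locint leb (fun x => f x * derive1n 2 phi x) by apply: locintMl => //; case: P2.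
have i3 : locint leb (fun x => derive1 phi x * rint leb c x f).
  by apply: locintMl => //; apply: lbm_locint => //; exact: lebesgue_locally_finite.
have i4 : locint leb (fun x => derive1 phi x * M x).
  by apply: locintMl => //; apply: lbm_locint => //; exact: lebesgue_locally_finite.
rewrite (rintD a b i1' i2) => E.
rewrite (_ : (fun x => derive1 phi x * (f' x - U x / 4 + M x)) =
  (fun x => f' x * derive1 phi x + (- 4^-1 * (derive1 phi x * rint leb c x f) + derive1 phi x * M x))); last first.
  by apply/funext => x; rewrite /U; ring.
rewrite (rintD a b i1' (locintD (locintZ _ i3) i4)) (rintD a b (locintZ _ i3) i4) (rintZ _ a b i3).
have aux (A B C D : R) : 0 = A + B -> - B + 4^-1 * - C - - D = A + (- 4^-1 * C + D).
  by move=> /esym/eqP; rewrite addr_eq0 => /eqP ->; ring.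
exact: (aux _ _ _ _ E).
Qed.

(** The direct implication is the du Bois-Reymond lemma, applied to q. *)
Lemma distributional_eq_ae : distributional_eq f g g2 <-> exists C, {ae leb, forall x, f' x - U x / 4 + M x = C}.
Proof.
have qi : locint leb (fun x => f' x - U x / 4 + M x).
  have l2 := lebesgue_locally_finite.
  apply: locintD; last exact: lbm_locint.
  apply: locintB; first by case: Pf.
  by under eq_fun do rewrite mulrC; apply: locintZ; exact: lbm_locint.
split=> [H|[C HC] a b phi tphi].
  apply: du_bois_reymond => // a b phi ab tphi.
  by rewrite -(distr_weak tphi ab) (H _ _ _ tphi) subrr.
have [ab|ba] := leP a b; last first.
  by rewrite /sint !set_itv_ge ?Rintegral_set0 ?bnd_simp -?leNgt ?ltW//; ring.
apply/eqP; rewrite -subr_eq0 (distr_weak tphi ab).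
have [P1 P2 z1 z2] := test_functionP tphi ab.
rewrite (@rint_ae_nm _ _ _ _ _ (fun x => C * derive1 phi x)); last first.
  by move: HC; apply: aeS => x E _; rewrite E mulrC.
rewrite rintZ; last by case: P1.
by rewrite -P1.2 !z1 ?subrr ?mulr0//; [left|right].
Qed.

End distr.

(** p is the left-continuous representative of f'. *)
Definition integrated_eq f g g2 p := forall x y, - p y + p x + 4^-1 * rint leb x y f = real_osint x y g + rint upsilon x y g2.

Lemma integrated_eq_formula f g g' g2 p : Prim g g' -> locint upsilon g2 -> locint leb f -> integrated_eq f g g2 p ->
  forall x, p x = p c + rint leb c x f / 4 - source_primitive g g' g2 x.
Proof.
move=> Pg g2i fi H x; have := H c x; rewrite (rosint_source Pg g2i) source_c; lra.
Qed.

Lemma formula_integrated_eq f g g' g2 p k : Prim g g' -> locint upsilon g2 -> locint leb f ->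
  (forall x, p x = k + rint leb c x f / 4 - source_primitive g g' g2 x) -> integrated_eq f g g2 p.
Proof.
move=> Pg g2i fi H x y; rewrite (rosint_source Pg g2i) !H -(rint_cat fi c x y); lra.
Qed.

Lemma formula_momentum_lbm f g g' g2 p k : Prim g g' -> locint upsilon g2 -> locint leb f ->
  (forall x, p x = k + rint leb c x f / 4 - source_primitive g g' g2 x) -> lbm p.
Proof.
move=> Pg g2i fi H; rewrite (_ : p = fun x => k + rint leb c x f / 4 - source_primitive g g' g2 x); last exact/funext.
apply: lbmB; last exact: source_lbm.
apply: lbmD; first exact: lbm_cst.
by under eq_fun do rewrite mulrC; apply: lbmZ; exact: rint_lbm.
Qed.

Lemma Prim_locint f f' : Prim f f' -> locint leb f.
Proof. by move=> /Prim_lbm; apply: lbm_locint; exact: lebesgue_locally_finite. Qed.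

Lemma Prim_derive1 f f' : Prim f f' -> {ae leb, forall x, derive1 f x = f' x}.
Proof.
move=> /Prim_ae_derive; apply: aeS => x [_ d]; by rewrite derive1E.
Qed.

Lemma distributional_integrated f f' g g' g2 : Prim f f' -> Prim g g' -> locint upsilon g2 -> distributional_eq f g g2 ->
  exists2 p, Prim f p & integrated_eq f g g2 p.
Proof.
move=> Pf Pg g2i /(distributional_eq_ae Pf Pg g2i)[C HC].
have fi := Prim_locint Pf.
pose p x := C + rint leb c x f / 4 - source_primitive g g' g2 x.
exists p; last exact: (formula_integrated_eq (k := C) Pg).
apply: (Prim_ae Pf).
  apply: lbm_locint; first exact: lebesgue_locally_finite.
  exact: (@formula_momentum_lbm f g g' g2 p C).
by move: HC; apply: aeS => x E; rewrite /p -E; ring.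
Qed.

Lemma integrated_distributional f g g' g2 p : Prim f p -> Prim g g' -> locint upsilon g2 -> integrated_eq f g g2 p -> distributional_eq f g g2.
Proof.
move=> Pf Pg g2i H; apply/(distributional_eq_ae Pf Pg g2i); exists (p c).
have fi := Prim_locint Pf.
by apply: aeW => x; rewrite (integrated_eq_formula Pg g2i fi H x); ring.
Qed.

Lemma integrated_eq_Prim f f' g g' g2 p : Prim f f' -> Prim g g' -> locint upsilon g2 -> integrated_eq f g g2 p ->
  {ae leb, forall x, p x = derive1 f x} -> Prim f p.
Proof.
move=> Pf Pg g2i H pf; have fi := Prim_locint Pf.
apply: (Prim_ae Pf).
  apply: lbm_locint; first exact: lebesgue_locally_finite.
  exact: (formula_momentum_lbm Pg g2i fi (integrated_eq_formula Pg g2i fi H)).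
by have := Prim_derive1 Pf; move: pf; apply: aeS2 => x -> ->.
Qed.
(** Variation of constants. *)
Lemma mode_exists M k d : lbm M -> exists2 D, Prim D (fun x => k * (D x - M x)) & D c = d.
Proof.
move=> lM.
have Mi : locint leb M by apply: lbm_locint => //; exact: lebesgue_locally_finite.
have PE := Prim_expR k c; have PE' := Prim_expR (- k) c.
have lE := Prim_lbm PE; have lE' := Prim_lbm PE'.
have EMi : locint leb (fun x => expR (- k * (x - c)) * M x) by exact: locintMl.
pose I x := d - k * rint leb c x (fun x => expR (- k * (x - c)) * M x).
have PI : Prim I (fun x => 0 - k * (expR (- k * (x - c)) * M x)).
  by apply: PrimB; [exact: Prim_cst|apply: PrimZ; exact: Prim_rint].
exists (fun x => expR (k * (x - c)) * I x); last first.
  by rewrite subrr mulr0 expR0 mul1r /I rintxx mulr0 subr0.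
have := PrimM PE PI; congr Prim; apply/funext => x.
have e1 : expR (k * (x - c)) * expR (- k * (x - c)) = 1 by rewrite -expRD mulNr subrr expR0.
rewrite [X in _ + X](_ : _ = - k * (expR (k * (x - c)) * expR (- k * (x - c))) * M x); last by ring.
rewrite e1; ring.
Qed.

(** Where M equals a constant m, the function D - m satisfies the homogeneous
    equation and is an exponential. *)
Lemma mode_far M k D b m x : lbm M -> Prim D (fun x => k * (D x - M x)) ->
  (forall t, Num.min b x <= t < Num.max b x -> M t = m) ->
  D x - m = expR (k * (x - b)) * (D b - m).
Proof.
move=> lM PD Mm.
have PY := PrimM (Prim_expR (- k) b) (PrimB PD (Prim_cst m)).
have := PY.2 b x; rewrite rint0; last first.
  by move=> t /Mm ->; ring.
rewrite subrr mulr0 expR0 mul1r => /eqP; rewrite subr_eq0 => /eqP <-.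
by rewrite mulrA -expRD mulNr subrr expR0 mul1r.
Qed.

(** The inverse of the change of variables D1, D2 = p + M +- s f/2 that decouples
    the equation. *)
Lemma modes_solution s M D1 D2 : s ^+ 2 = 1 ->
  Prim D1 (fun x => s / 2 * (D1 x - M x)) -> Prim D2 (fun x => - s / 2 * (D2 x - M x)) ->
  let f x := s * (D1 x - D2 x) in let p x := (D1 x + D2 x) / 2 - M x in
  Prim f p /\ forall x, p x = (D1 c + D2 c) / 2 + rint leb c x f / 4 - M x.
Proof.
move=> s2 P1 P2 f p.
have Pf : Prim f p.
  have := PrimZ s (PrimB P1 P2); congr Prim; apply/funext => x.
  transitivity (s ^+ 2 * p x); last by rewrite s2 mul1r.
  by rewrite /p; field.
split=> // x.
have Pr := PrimZ 2^-1 (PrimD P1 P2).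
have := Pr.2 c x.
rewrite (_ : (fun x => _) = (fun x => 4^-1 * f x)); last by apply/funext => t; rewrite /f; field.
rewrite rintZ; last exact: Prim_locint Pf.
rewrite /p; lra.
Qed.

End equation.

(** * Half-lines *)

(** The direction in which the half-line extends.  With it, both half-lines are
    treated at once: s * (x - c) is the distance of x in the half-line from c. *)
Definition outward (R : realType) (plus : bool) : R := if plus then 1 else -1.

Section halfline.
Context {R : realType}.
Variables (c : R) (plus : bool).
Implicit Types (mu : {measure set (measurableTypeR R) -> \bar R}) (f g h k : R -> R) (a b x y z r : R).
Local Notation leb := (@lebesgue_measure R).
Local Notation J := (half_line plus c).
Local Notation s := (@outward R plus).

Lemma outward_sq : s ^+ 2 = 1.
Proof. by rewrite /outward; case: plus; rewrite ?sqrrN expr1n. Qed.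
(** The part of the half-line up to distance r from its endpoint.  Both half-lines
    are half-open on the same side, and so are these parts, as oriented integrals
    require; the left part hence contains its far endpoint. *)
Definition half_line_part r : set R := if plus then `[c, c + r[%classic else `[c - r, c[%classic.

Lemma JE x : J x <-> if plus then c <= x else x < c.
Proof. by rewrite /half_line; case: plus; rewrite /= in_itv/= ?andbT. Qed.

Lemma JpartE r x : half_line_part r x <-> if plus then c <= x < c + r else c - r <= x < c.
Proof. by rewrite /half_line_part; case: plus; rewrite /= in_itv/=. Qed.

Lemma mJ : measurable (J : set (measurableTypeR R)).
Proof. by rewrite /half_line; case: plus; exact: measurable_itv. Qed.

Lemma mJpart r : measurable (half_line_part r : set (measurableTypeR R)).
Proof. by rewrite /half_line_part; case: plus; exact: measurable_itv. Qed.

Lemma JpartS r : half_line_part r `<=` J.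
Proof. by move=> x /JpartE H; apply/JE; case: plus H => /andP[]. Qed.

Lemma Jpart_dist r x : J x -> s * (x - c) < r -> half_line_part r x.
Proof. by move/JE => H1 H2; apply/JpartE; move: H1 H2; rewrite /outward; case: plus => ? ?; lra. Qed.

Lemma J_between x t : J x -> Num.min c x <= t < Num.max c x -> J t.
Proof.
move/JE => H1 H2; apply/JE; move: H1 H2; case: plus => H1.
  by rewrite min_l// => /andP[].
by rewrite [X in t < X]max_l ?(ltW H1)// => /andP[].
Qed.

Lemma between_Jpart r t : 0 <= r -> Num.min c (c + s * r) <= t < Num.max c (c + s * r) <-> half_line_part r t.
Proof.
move=> r0; rewrite JpartE /outward; case: plus; rewrite ?mul1r ?mulN1r.
  by rewrite min_l ?max_r// lerDl.
by rewrite min_r ?max_l// gerBl.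
Qed.

Lemma rint_Jpart mu r k : 0 <= r -> \int[mu]_(x in half_line_part r) k x = s * rint mu c (c + s * r) k.
Proof.
move=> r0; rewrite /half_line_part /outward; case: plus; rewrite ?mul1r ?mulN1r.
  by rewrite rint_le// lerDl.
by rewrite rintC opprK rint_le// gerBl.
Qed.

Lemma L2on_half_line_part mu r f : locally_finite mu -> lbm f -> L2on mu (half_line_part r) f.
Proof. by move=> lmu lf; rewrite /half_line_part; case: plus; exact: L2on_lbm. Qed.

Lemma far_between N x t : s * (x - (c + s * N)) >= 0 ->
  Num.min (c + s * N) x <= t < Num.max (c + s * N) x -> s * (t - c) >= N.
Proof.
rewrite /outward; case: plus; rewrite ?mul1r ?mulN1r => H.
  have {}H : c + N <= x by lra.
  by rewrite min_l// => /andP[+ _]; lra.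
have {}H : x <= c - N by lra.
by rewrite max_l// => /andP[_ +]; lra.
Qed.

(** By dominated convergence. *)
Lemma rint_exhaust mu k (r : nat -> R) : (forall n, n%:R <= r n) -> mu.-integrable J (EFin \o k) ->
  s * rint mu c (c + s * r n) k @[n --> \oo] --> \int[mu]_(x in J) k x.
Proof.
move=> rn ki.
have r0 n : 0 <= r n by exact: le_trans (rn n).
rewrite (_ : (fun n => _) = (fun n => \int[mu]_(x in J) (k \_ (half_line_part (r n))) x)); last first.
  apply/funext => n; rewrite -rint_Jpart// -Rintegral_mkcondr.
  by congr (Rintegral _ _ _); rewrite setIidr//; exact: JpartS.
have mk : measurable_fun J k by apply/measurable_EFinP; exact: measurable_int ki.
apply: (proj2 (Rintegral_dominated (g := fun t => `|k t|) _ _ _ _ _ _)) => //.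
- exact: mJ.
- move=> n; apply/measurable_restrict => //; [exact: mJpart|exact: mJ|].
  by apply: measurable_funS mk; [exact: mJ|exact: subIsetl].
- move=> x Jx; apply: (cvg_near_cst); near=> n.
  rewrite patchE mem_set//; apply: Jpart_dist => //; apply: lt_le_trans (rn n).
  by near: n; exact: nbhs_infty_gtr.
- exact: (integrable_norm ki).
- by move=> n x _; rewrite patchE; case: ifP => //; rewrite normr0.
Unshelve. all: by end_near.
Qed.

(** By monotone convergence. *)
Lemma ge0_integrable_J mu k C : locally_finite mu -> lbm k -> (forall x, 0 <= k x) ->
  (forall n : nat, s * rint mu c (c + s * n%:R) k <= C) -> mu.-integrable J (EFin \o k).
Proof.
move=> lmu lk k0 H; apply/integrableP; split.
  by apply/measurable_EFinP; exact: measurable_funTS lk.1.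
have EJ : J = \bigcup_n half_line_part n%:R.
  apply/seteqP; split; last by move=> x [n _]; exact: JpartS.
  move=> x Jx; exists (Num.trunc (s * (x - c))).+1 => //; apply: Jpart_dist => //.
  exact: truncnS_gt.
rewrite EJ.
apply: (@le_lt_trans _ _ C%:E); last exact: ltry.
have ki := lbm_locint lmu lk.
have cv := @ge0_nondecreasing_set_cvg_integral _ (measurableTypeR R) R (fun n => half_line_part n%:R)
  (fun x => `|(k x)%:E|%E) mu.
have {}cv : (\int[mu]_(x in half_line_part n%:R) `|(k x)%:E|)%E @[n --> \oo] -->
   (\int[mu]_(x in \bigcup_n half_line_part n%:R) `|(k x)%:E|)%E.
  apply: cv => //.
  - move=> n m nm; apply/subsetPset => x /JpartE H1; apply/JpartE.
    have : n%:R <= m%:R :> R by rewrite ler_nat.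
    by move: H1; case: plus => /andP[? ?] ?; apply/andP; split; lra.
  - by move=> n; exact: mJpart.
  - by move=> n; do 2 apply: measurableT_comp => //; exact: measurable_funTS lk.1.
rewrite -(cvg_lim _ cv)//; apply: lime_le; first by apply/cvg_ex; eexists; exact: cv.
apply: nearW => n.
under eq_integral do rewrite gee0_abs ?lee_fin//.
rewrite EFin_Rintegral; [|exact: mJpart|].
  by rewrite lee_fin rint_Jpart//; exact: H.
by rewrite /half_line_part; case: plus; exact: ki.
Qed.
End halfline.

(** * Green's identity *)

Section integrable_real.
Context {R : realType} (mu : {measure set (measurableTypeR R) -> \bar R}) (D : set (measurableTypeR R)).
Hypothesis mD : measurable D.
Implicit Types f g : R -> R.

Lemma intD f g : mu.-integrable D (EFin \o f) -> mu.-integrable D (EFin \o g) ->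
  mu.-integrable D (EFin \o (fun x => f x + g x)).
Proof. exact: integrableD. Qed.

Lemma intB f g : mu.-integrable D (EFin \o f) -> mu.-integrable D (EFin \o g) ->
  mu.-integrable D (EFin \o (fun x => f x - g x)).
Proof. exact: integrableB. Qed.

Lemma intZ k f : mu.-integrable D (EFin \o f) -> mu.-integrable D (EFin \o (fun x => k * f x)).
Proof. exact: integrableZl. Qed.
End integrable_real.

Section green.
Context {R : realType}.
Variables (omega : lf_signed_measure R) (upsilon : {measure set (measurableTypeR R) -> \bar R}).
Hypothesis upsilon_lf : locally_finite upsilon.
Variables (c : R) (plus : bool).
Implicit Types (mu : {measure set (measurableTypeR R) -> \bar R}) (f g h k p q u v w : R -> R) (a b x y z r : R).
Local Notation leb := (@lebesgue_measure R).
Local Notation J := (half_line plus c).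
Local Notation s := (@outward R plus).
Local Notation source := (source_primitive omega upsilon c).
Local Notation integrated_eq := (integrated_eq omega upsilon).
Local Notation rosint := (real_osint omega).

Let ss : s * s = 1. Proof. by rewrite -expr2 outward_sq. Qed.

(** The right-hand side of the last hypothesis converges as x goes to infinity, hence so
    does B; being integrable on a set of infinite measure, B has limit zero. *)
Lemma boundary_value (B k1 k2 : R -> R) : leb.-integrable J (EFin \o k1) -> upsilon.-integrable J (EFin \o k2) ->
  leb.-integrable J (EFin \o B) ->
  (forall x, 0 <= s * (x - c) -> B x - B c = rint leb c x k1 + rint upsilon c x k2) ->
  - (s * B c) = \int[leb]_(x in J) k1 x + \int[upsilon]_(x in J) k2 x.
Proof.
move=> i1 i2 iB HB.
have [L LE] : exists L : R, L = s * B c + ((\int[leb]_(x in J) k1 x) + (\int[upsilon]_(x in J) k2 x)).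
  by eexists.
(* L is the limit of s * B at infinity. *)
suff L0 : L = 0 by apply/esym/eqP; rewrite -subr_eq0 opprK addrC -LE L0.
apply: contrapT => /eqP L0.
have e0 : 0 < `|L| / 2 by rewrite divr_gt0 ?normr_gt0.
have lim_r (r : nat -> R) : (forall n, n%:R <= r n) -> s * B (c + s * r n) @[n --> \oo] --> L.
  move=> rn.
  rewrite (_ : (fun n => _) = (fun n => s * B c + (s * rint leb c (c + s * r n) k1 + s * rint upsilon c (c + s * r n) k2))).
    by rewrite LE; apply: cvgD; [exact: cvg_cst|apply: cvgD; exact: rint_exhaust].
  apply/funext => n; rewrite -mulrDr -HB; first by ring.
  by rewrite addrAC subrr add0r mulrA ss mul1r (le_trans _ (rn n)).
have [N HN] : exists N : nat, forall r, N%:R <= r -> `|L| / 2 <= `|B (c + s * r)|.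
  apply: contrapT => /forallNP H.
  have {}H N : exists r, N%:R <= r /\ `|B (c + s * r)| < `|L| / 2.
    have /existsNP[r /not_implyP[Nr /negP]] := H N; rewrite -ltNge => ?; by exists r.
  have [r Hr] := choice H.
  have /cvgrPdist_lt/(_ _ e0)[N _ /(_ N (leqnn N))] := lim_r r (fun n => (Hr n).1).
  have [_] := Hr N; rewrite /= => B1 B2.
  have B3 : `|s * B (c + s * r N)| < `|L| / 2.
    have s1 : `|s| = 1 by rewrite /outward; case: plus; rewrite ?normrN normr1.
    by rewrite normrM s1 mul1r.
  have := ler_normD (L - s * B (c + s * r N)) (s * B (c + s * r N)).
  by rewrite subrK; lra.
pose D : set R := if plus then `[c + N%:R, +oo[%classic else `]-oo, c - N%:R[%classic.
have mD : measurable (D : set (measurableTypeR R)) by rewrite /D; case: plus; exact: measurable_itv.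
have DJ : D `<=` J.
  have n0 : 0 <= N%:R :> R by [].
  by move=> x; rewrite /D => Dx; apply/JE; move: Dx; case: plus; rewrite /= in_itv/= ?andbT => ?; lra.
have DB x : D x -> `|L| / 2 <= `|B x|.
  move=> Dx; have -> : x = c + s * (s * (x - c)) by rewrite mulrA ss mul1r addrC subrK.
  apply: HN; move: Dx; rewrite /D /outward; case: plus; rewrite /= in_itv/= ?andbT => ?; lra.
have Doo : leb D = +oo%E.
  have E1 := @lebesgue_measure_itv R `[c + N%:R, +oo[; have E2 := @lebesgue_measure_itv R `]-oo, c - N%:R[.
  by rewrite /D; case: plus; [rewrite [LHS]E1|rewrite [LHS]E2]; rewrite /= ?ltry ?ltNyr.
have /integrableP[mB] := iB; apply/negP; rewrite -leNgt.
have <- : (\int[leb]_(x in D) (`|L| / 2)%:E = +oo)%E.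
  transitivity ((`|L| / 2)%:E * +oo)%E; last by rewrite mulry gtr0_sg// mul1e.
  by rewrite integral_cst//; congr (_ * _)%E; exact: Doo.
apply: (@le_trans _ _ (\int[leb]_(x in D) `|(B x)%:E|)%E).
  apply: ge0_le_integral => //.
  by apply: measurableT_comp => //; apply: measurable_funS mB => //; exact: mJ.
apply: ge0_subset_integral => //; first exact: mJ.
by apply: measurableT_comp.
Qed.

(** Integration by parts of the form of f and h, where the derivative of p is
    f/4 - omega g - upsilon g2. *)
Lemma half_green f g g' g2 p h h' : Prim f p -> Prim g g' -> locint upsilon g2 -> integrated_eq f g g2 p ->
  Prim h h' -> forall x y,
  rint leb x y (fun t => 4^-1 * (f t * h t) + p t * h' t) =
  p y * h y - p x * h x + rosint x y (fun t => g t * h t) + rint upsilon x y (fun t => h t * g2 t).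
Proof.
move=> Pf Pg g2i H Ph.
have fi := Prim_locint Pf.
have lM := source_lbm omega c Pg g2i.
have pE := integrated_eq_formula c Pg g2i fi H.
have Pr : Prim (fun x => p c + 4^-1 * rint leb c x f) (fun x => 0 + 4^-1 * f x).
  by apply: PrimD; [exact: Prim_cst|apply: PrimZ; exact: Prim_rint].
have lr := Prim_lbm Pr.
have i3 : locint leb (fun t => source g g' g2 t * h' t) by apply: locintMl => //; case: Ph.
have key x y : x <= y ->
  rint leb x y (fun t => 4^-1 * (f t * h t) + p t * h' t) =
  p y * h y - p x * h x + rosint x y (fun t => g t * h t) + rint upsilon x y (fun t => h t * g2 t).
  move=> xy; have PM := PrimM Pr Ph.
  have E1 := PM.2 x y.
  have E2 := source_pairing omega upsilon_lf c Pg g2i Ph xy.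
  rewrite (_ : (fun t => 4^-1 * (f t * h t) + p t * h' t) =
     (fun t => ((0 + 4^-1 * f t) * h t + (p c + 4^-1 * rint leb c t f) * h' t) - source g g' g2 t * h' t)); last first.
    by apply/funext => t; rewrite (pE t); ring.
  rewrite rintB//; last exact: PM.1.
  rewrite -E1 /real_osint xy -[RHS]addrA E2 (pE y) (pE x).
  rewrite (_ : (fun t => h' t * source g g' g2 t) = (fun t => source g g' g2 t * h' t)); first by ring.
  by apply/funext => t; rewrite mulrC.
move=> x y; case: (leP x y) => [|yx]; first exact: key.
rewrite rintC (key _ _ (ltW yx)) /real_osint (ltW yx) leNgt yx/= (rintC upsilon x y); ring.
Qed.

Lemma Rintegral_J_eq mu f g : {ae mu, forall x, J x -> f x = g x} ->
  \int[mu]_(x in J) f x = \int[mu]_(x in J) g x.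
Proof. exact: Rintegral_ae_nm. Qed.

(** The data of a pair in the relation: the pair is ((f, g), (g, g2)), p is the
    distinguished representative of f' and g' is a representative of the derivative
    of g. *)
Definition rsolution f p g g' g2 :=
  [/\ Prim f p, Prim g g', (forall a b, L2on leb `[a, b[ g'), (forall a b, L2on upsilon `[a, b[ g2) & integrated_eq f g g2 p].

(** The pair given by these data belongs to the Hilbert space of the half-line. *)
Definition square_integrable f p g g' g2 :=
  [/\ L2on leb J f, L2on leb J p, L2on leb J g, L2on leb J g' & L2on upsilon J g /\ L2on upsilon J g2].

(** The scalar product, with the derivatives as separate arguments. *)
Definition energy_form f f' f2 g g' g2 := 4^-1 * (\int[leb]_(x in J) (f x * g x)) +
   (\int[leb]_(x in J) (f' x * g' x)) + (\int[upsilon]_(x in J) (f2 x * g2 x)).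

(** The identity half_green is applied to both pairs.  In the difference the
    integrals of g h against omega cancel, which leaves the differential of the
    boundary function p h - q g. *)
Lemma green f p g g' g2 k q h h' h2 : rsolution f p g g' g2 -> square_integrable f p g g' g2 ->
  rsolution k q h h' h2 -> square_integrable k q h h' h2 ->
  energy_form f p g h h' h2 - energy_form g g' g2 k q h = - (s * (p c * h c - q c * g c)).
Proof.
move=> [Pf Pg Lg' Lg2 Sf] [If Ip Ig Ig' [Ig_u Ig2]] [Pk Ph Lh' Lh2 Sk] [Ik Iq Ih Ih' [Ih_u Ih2]].
have g2i := L2on_locint upsilon_lf Lg2; have h2i := L2on_locint upsilon_lf Lh2.
have mJ' := mJ c plus.
have lf := Prim_lbm Pf; have lg := Prim_lbm Pg; have lk := Prim_lbm Pk; have lh := Prim_lbm Ph.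
have I1 := L2onM mJ' If Ih; have I2 := L2onM mJ' Ip Ih'; have I3 := L2onM mJ' Ig Ik; have I4 := L2onM mJ' Ig' Iq.
have I5 := L2onM mJ' Ig_u Ih2; have I6 := L2onM mJ' Ig2 Ih_u.
have I7 := L2onM mJ' Ip Ih; have I8 := L2onM mJ' Iq Ig.
pose k1 t := (4^-1 * (f t * h t) + p t * h' t) - (4^-1 * (k t * g t) + q t * g' t).
pose k2 t := g t * h2 t - g2 t * h t.
have I3' := L2onM mJ' Ik Ig; have I4' := L2onM mJ' Iq Ig'.
have ik1a := intD mJ' (intZ mJ' 4^-1 I1) I2.
have ik1b := intD mJ' (intZ mJ' 4^-1 I3') I4'.
have ik1 : leb.-integrable J (EFin \o k1) by exact: (intB mJ' ik1a ik1b).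
have ik2 : upsilon.-integrable J (EFin \o k2) by exact: (intB mJ' I5 I6).
have iB : leb.-integrable J (EFin \o (fun x => p x * h x - q x * g x)) by exact: (intB mJ' I7 I8).
have fi := Prim_locint Pf; have ki := Prim_locint Pk.
have lp := formula_momentum_lbm Pg g2i fi (integrated_eq_formula c Pg g2i fi Sf).
have lq := formula_momentum_lbm Ph h2i ki (integrated_eq_formula c Ph h2i ki Sk).
rewrite -[p c * h c - _]/((fun x => p x * h x - q x * g x) c) (boundary_value ik1 ik2 iB); last first.
  move=> x _; rewrite /k1 /k2.
  have l4 (u v : R -> R) : lbm u -> lbm v -> locint leb (fun t => 4^-1 * (u t * v t)).
    by move=> lu lv; apply: locintZ; apply: lbm_locint; [exact: lebesgue_locally_finite|exact: lbmM].
  have j1 : locint leb (fun t => 4^-1 * (f t * h t) + p t * h' t).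
    by apply: locintD; [exact: l4|apply: locintMl => //; case: Ph].
  have j2 : locint leb (fun t => 4^-1 * (k t * g t) + q t * g' t).
    by apply: locintD; [exact: l4|apply: locintMl => //; case: Pg].
  have j3 : locint upsilon (fun t => g2 t * h t) by under eq_fun do rewrite mulrC; exact: locintMl.
  have j4 : locint upsilon (fun t => g t * h2 t) by exact: locintMl.
  rewrite (rintB _ _ j1 j2) (half_green Pf Pg g2i Sf Ph) (half_green Pk Ph h2i Sk Pg).
  rewrite (rintB _ _ j4 j3).
  rewrite (_ : (fun t => g2 t * h t) = (fun t => h t * g2 t)); last by apply/funext => t; rewrite mulrC.
  rewrite (_ : (fun t => h t * g t) = (fun t => g t * h t)); last by apply/funext => t; rewrite mulrC.
  by ring.
rewrite /energy_form /k1 /k2 (RintegralB mJ' ik1a ik1b) (RintegralB mJ' I5 I6).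
rewrite (RintegralD mJ' (intZ mJ' 4^-1 I1) I2) (RintegralD mJ' (intZ mJ' 4^-1 I3') I4').
rewrite (RintegralZl _ mJ' I1) (RintegralZl _ mJ' I3').
rewrite (_ : (fun x => g x * k x) = (fun x => k x * g x)); last by apply/funext => t; rewrite mulrC.
rewrite (_ : (fun x => g' x * q x) = (fun x => q x * g' x)); last by apply/funext => t; rewrite mulrC.
by ring.
Qed.

Lemma rint_outward_ge0 mu x y k : (forall t, 0 <= k t) -> 0 <= s * (y - x) -> 0 <= s * rint mu x y k.
Proof.
move=> k0; rewrite /outward; case: plus; rewrite ?mul1r ?mulN1r => xy.
  by rewrite rint_le ?Rintegral_ge0//; lra.
by rewrite rintC opprK rint_le ?Rintegral_ge0//; lra.
Qed.

Lemma L2on_far0 mu h r : locally_finite mu -> lbm h -> (forall x, r <= s * (x - c) -> h x = 0) -> L2on mu J h.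
Proof.
move=> lmu lh h0.
have mP := mJpart c plus r.
apply: (@L2on_eq _ _ _ (h \_ (half_line_part c plus r))); first exact: mJ.
  move=> x Jx; rewrite patchE; case: ifPn => // /negP xP; rewrite h0//.
  by rewrite leNgt; apply/negP => H; apply: xP; rewrite inE; exact: Jpart_dist.
apply: L2on_patch => //; [exact: mJ|exact: JpartS|].
exact: L2on_half_line_part.
Qed.

(** The square of the exponential has an explicit primitive, which is bounded on the
    half-line. *)
Lemma decay_L2 f r C : 0 <= r -> lbm f ->
  (forall x, r <= s * (x - c) -> f x = C * expR (- s / 2 * (x - (c + s * r)))) -> L2on leb J f.
Proof.
move=> r0 lf fE; set b := c + s * r in fE.
have lf2 := lbmM lf lf.
have fi := lbm_locint (@lebesgue_locally_finite R) lf2.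
split; first exact: measurable_funTS lf.1.
have f20 x : 0 <= f x * f x by rewrite -expr2 sqr_ge0.
have H : leb.-integrable J (EFin \o (fun x => f x * f x)).
  apply: (@ge0_integrable_J _ _ _ _ _ (s * rint leb c b (fun x => f x * f x) + C ^+ 2)) => //.
    exact: lebesgue_locally_finite.
  move=> n; have [nr|rn] := leP n%:R r.
    rewrite -(rint_cat fi c (c + s * n%:R) b) mulrDr -addrA lerDl addr_ge0 ?sqr_ge0//.
    apply: rint_outward_ge0 => //.
    rewrite (_ : s * (b - (c + s * n%:R)) = s * s * (r - n%:R)); last by rewrite /b; ring.
    by rewrite ss mul1r subr_ge0.
  set x := c + s * n%:R.
  rewrite -(rint_cat fi c b x) [leLHS]mulrDr lerD2l.
  have Pe := Prim_expR (- s) b.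
  rewrite (@rint_eq _ leb b x _ (fun t => - (C ^+ 2 * s) * (- s * expR (- s * (t - b))))); last first.
    move=> t bt; rewrite fE; last first.
      apply: far_between bt; rewrite -/b (_ : s * (x - b) = s * s * (n%:R - r)); last by rewrite /b /x; ring.
      by rewrite ss mul1r subr_ge0 ltW.
    rewrite (_ : - (C ^+ 2 * s) * (- s * expR (- s * (t - b))) = s * s * (C ^+ 2 * expR (- s * (t - b)))); last by ring.
    rewrite ss mul1r mulrACA -expRD -expr2; congr (_ * expR _); by field.
  rewrite rintZ; last by case: Pe.
  rewrite -Pe.2 subrr mulr0 expR0.
  rewrite (_ : s * _ = s * s * (C ^+ 2 * (1 - expR (- s * (x - b))))); last by ring.
  rewrite ss mul1r ler_piMr ?sqr_ge0// lerBlDr lerDl expR_ge0//.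
by move: H; congr (integrable _ _ _); apply/funext => x /=; rewrite expr2.
Qed.

(** Multiply by the integrating factor exp(- k x). *)
Lemma mode_unique (k : R) D D' x : Prim D D' ->
  {ae leb, forall t, Num.min c x <= t < Num.max c x -> D' t = k * D t} -> D c = 0 -> D x = 0.
Proof.
move=> PD H Dc.
have PY := PrimM (Prim_expR (- k) c) PD.
have := PY.2 c x; rewrite (@rint_ae_nm _ _ _ _ _ (fun=> 0)); last first.
  by move: H; apply: aeS => t E /E ->; ring.
rewrite (@rint0 _ leb c x (fun=> 0))// Dc mulr0 subr0 => /eqP; rewrite mulf_eq0 gt_eqF ?expR_gt0//.
by move/eqP.
Qed.

Lemma sq_integral0 mu D f : measurable (D : set (measurableTypeR R)) -> L2on mu D f ->
  \int[mu]_(x in D) (f x * f x) = 0 -> {ae mu, forall x, D x -> f x = 0}.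
Proof.
move=> mD Lf; have [mf _] := Lf; have i2 := L2onM mD Lf Lf => H.
have : (\int[mu]_(x in D) `|(f x * f x)%:E| = 0)%E.
  under eq_integral do rewrite gee0_abs ?lee_fin -?expr2 ?sqr_ge0//.
  by rewrite EFin_Rintegral// H.
move=> /ae_eq_integral_abs E.
have : ae_eq mu D (fun x => (f x * f x)%:E) (cst 0%E).
  by apply: E => //; apply/measurable_EFinP; exact: measurable_funM.
apply: aeS => x H1 Dx; have [] := H1 Dx.
by move=> /eqP; rewrite mulf_eq0 orbb => /eqP.
Qed.
End green.

(** * Elements of the adjoint of the minimal relation solve the equation *)

Section adjoint_regularity.
Context {R : realType}.
Variables (omega : lf_signed_measure R) (upsilon : {measure set (measurableTypeR R) -> \bar R}).
Hypothesis upsilon_lf : locally_finite upsilon.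
Variables (c : R) (plus : bool).
Implicit Types (mu : {measure set (measurableTypeR R) -> \bar R}) (f g h k p q u v w : R -> R) (a b x y z r : R).
Local Notation leb := (@lebesgue_measure R).
Local Notation J := (half_line plus c).
Local Notation s := (@outward R plus).
Local Notation Jpart := (half_line_part c plus).
Local Notation source := (source_primitive omega upsilon c).
Local Notation integrated_eq := (integrated_eq omega upsilon).
Local Notation rosint := (real_osint omega).
Local Notation rsolution := (rsolution omega upsilon).
Local Notation square_integrable := (square_integrable upsilon c plus).
Local Notation energy := (energy_form upsilon c plus).

Let ss : s * s = 1. Proof. by rewrite -expr2 outward_sq. Qed.

Lemma rosint0 x y : rosint x y (fun=> 0) = 0.
Proof.
have z0 : locint upsilon (fun=> 0) by apply: lbm_locint => //; exact: lbm_cst.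
have := rosint_source omega c (Prim_cst 0) z0 x y.
rewrite (@rint0 _ upsilon x y (fun=> 0))// addr0 => ->.
have E t : source (fun=> 0) (fun=> 0) (fun=> 0) t = 0.
  by rewrite /source_primitive mul0r !rint0 ?subr0 ?addr0// => ? _; rewrite mul0r.
by rewrite !E subrr.
Qed.

(** The inequality must be strict: the left part contains its far endpoint. *)
Lemma out_Jpart r x : r < s * (x - c) -> ~ Jpart r x.
Proof.
move=> H /JpartE; move: H; rewrite /outward; case: plus; rewrite ?mul1r ?mulN1r => H /andP[H1 H2]; lra.
Qed.

Lemma out_Jpart_between r x t :
  Num.min (c + s * r) x <= t < Num.max (c + s * r) x -> r <= s * (x - c) -> ~ Jpart r t.
Proof.
rewrite /outward; case: plus; rewrite ?mul1r ?mulN1r => H rx /JpartE/andP[H1 H2]; move: H.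
  by rewrite min_l ?max_r; try lra; move=> /andP[? ?]; lra.
by rewrite min_r ?max_l; try lra; move=> /andP[? ?]; lra.
Qed.

Lemma far_endpoint r : s * (c + s * r - c) = r.
Proof. by rewrite addrAC subrr add0r mulrA ss mul1r. Qed.

Lemma far_segment r x t : r <= s * (x - c) ->
  Num.min (c + s * r) x <= t < Num.max (c + s * r) x -> r <= s * (t - c).
Proof.
move=> rx; apply: far_between.
rewrite (_ : s * (x - (c + s * r)) = s * (x - c) - s * (c + s * r - c)); last by ring.
by rewrite far_endpoint subr_ge0.
Qed.

Lemma rint_far mu f r x : locint mu f -> (forall t, r <= s * (t - c) -> f t = 0) -> r <= s * (x - c) ->
  rint mu c x f = rint mu c (c + s * r) f.
Proof.
move=> fi f0 rx; rewrite -(rint_cat fi c (c + s * r) x) [X in _ + X]rint0 ?addr0//.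
by move=> t /(far_segment rx)/f0.
Qed.

Lemma source_far h h' h2 r x : Prim h h' -> locint upsilon h2 ->
  (forall x, r <= s * (x - c) -> [/\ h x = 0, h' x = 0 & h2 x = 0]) ->
  r <= s * (x - c) -> source h h' h2 x = source h h' h2 (c + s * r).
Proof.
move=> Ph h2i h0 rx.
have rb : r <= s * (c + s * r - c) by rewrite far_endpoint.
have [hx _ _] := h0 _ rx; have [hb _ _] := h0 _ rb.
rewrite /source_primitive hx hb !mul0r (rint_far (r := r) _ _ rx); last 2 first.
- by apply: locint_W; case: Ph.
- by move=> t /h0[_ -> _]; rewrite mul0r.
by rewrite (rint_far (r := r) h2i _ rx)// => t /h0[].
Qed.

(** Beyond distance r the source primitive is constant.  The growing mode D1 is
    chosen to have this constant value at distance r and so keeps it; the decaying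
    mode D2 then absorbs the condition at c.  Both the solution and its derivative
    are exponentially small at infinity. *)
Lemma test_exists h h' h2 r (beta : R) : 0 <= r -> Prim h h' -> locint upsilon h2 ->
  (forall x, r <= s * (x - c) -> [/\ h x = 0, h' x = 0 & h2 x = 0]) ->
  exists k p, [/\ Prim k p, integrated_eq k h h2 p, p c = beta, L2on leb J k & L2on leb J p].
Proof.
move=> r0 Ph h2i h0.
have lM := source_lbm omega c Ph h2i.
(* The initial value of D2 makes p c = (D1 c + D2 c) / 2 equal to beta. *)
have [D1 P1 D1b] := mode_exists (c + s * r) (s / 2) (source h h' h2 (c + s * r)) lM.
have [D2 P2 D2c] := mode_exists c (- s / 2) (2 * beta - D1 c) lM.
have [Pk pE] := modes_solution c (@outward_sq R plus) P1 P2.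
set k := (fun x => s * (D1 x - D2 x)) in Pk pE.
set p := (fun x => (D1 x + D2 x) / 2 - source h h' h2 x) in Pk.
have ki := Prim_locint Pk.
have C0 : (D1 c + D2 c) / 2 = beta by rewrite D2c; field.
have pE' x : p x = beta + rint leb c x k / 4 - source h h' h2 x by rewrite -C0 -pE.
have Mfar x : r <= s * (x - c) -> source h h' h2 x = source h h' h2 (c + s * r).
  exact: source_far.
have far1 x : r <= s * (x - c) -> D1 x = source h h' h2 (c + s * r).
  move=> rx; apply/eqP; rewrite -subr_eq0.
  rewrite (mode_far (b := c + s * r) (m := source h h' h2 (c + s * r)) lM P1); first by rewrite D1b subrr mulr0.
  by move=> t /(far_segment rx)/Mfar.
have far2 x : r <= s * (x - c) -> D2 x - source h h' h2 (c + s * r) =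
    expR (- s / 2 * (x - (c + s * r))) * (D2 (c + s * r) - source h h' h2 (c + s * r)).
  move=> rx; rewrite (mode_far (b := c + s * r) (m := source h h' h2 (c + s * r)) lM P2)//.
  by move=> t /(far_segment rx)/Mfar.
exists k, p; split => //.
- exact: (formula_integrated_eq (k := beta) Ph h2i ki pE').
- by rewrite pE' rintxx mul0r addr0 source_c subr0.
- apply: (@decay_L2 R c plus k r (- s * (D2 (c + s * r) - source h h' h2 (c + s * r)))) => //.
    exact: Prim_lbm Pk.
  by move=> x rx; rewrite /k (far1 _ rx) -[RHS]mulrA [_ * expR _ in RHS]mulrC -(far2 _ rx); ring.
- apply: (@decay_L2 R c plus p r (2^-1 * (D2 (c + s * r) - source h h' h2 (c + s * r)))) => //.
    exact: formula_momentum_lbm Ph h2i ki pE'.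
  move=> x rx; rewrite /p (far1 _ rx) (Mfar _ rx) -[RHS]mulrA [_ * expR _ in RHS]mulrC -(far2 _ rx); by field.
Qed.

Lemma source_pairing_oriented g g' g2 h h' x y : Prim g g' -> locint upsilon g2 -> Prim h h' ->
  rosint x y (fun t => g t * h t) + rint upsilon x y (fun t => h t * g2 t) =
  h y * source g g' g2 y - h x * source g g' g2 x - rint leb x y (fun t => h' t * source g g' g2 t).
Proof.
move=> Pg g2i Ph; case: (leP x y) => [xy|yx].
  by rewrite -(source_pairing omega upsilon_lf c Pg g2i Ph xy) /real_osint xy.
have := source_pairing omega upsilon_lf c Pg g2i Ph (ltW yx).
rewrite /real_osint (leNgt x) yx/= (rintC _ y x) (rintC leb y x) => E.
rewrite -opprD E; ring.
Qed.

Lemma L2on_patchT mu (D : set (measurableTypeR R)) f (E : set (measurableTypeR R)) : measurable D -> measurable E ->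
  L2on mu D f -> L2on mu E (f \_ D).
Proof.
by move=> mD mE Lf; apply: (L2on_sub measurableT) => //; exact: L2on_patch.
Qed.

(** On the part up to distance r, f is square integrable, hence integrable. *)
Lemma integrable_far0 mu f r : locally_finite mu -> lbm f -> (forall x, r <= s * (x - c) -> f x = 0) ->
  mu.-integrable J (EFin \o f).
Proof.
move=> lmu lf f0.
have L1 := L2on_far0 lmu lf f0.
have L2 : L2on mu J ((fun=> (1 : R)) \_ (Jpart r)).
  apply: L2on_patchT; [exact: mJpart|exact: mJ|].
  by apply: L2on_half_line_part => //; exact: lbm_cst.
have mJ' := mJ c plus.
apply: (le_integrable mJ' _ _ (L2onM mJ' L1 L2)).
  by apply/measurable_EFinP; case: L1.
move=> x Jx; rewrite /= lee_fin patchE; case: ifPn => [_|/negP xP]; first by rewrite mulr1.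
rewrite f0 ?normr0// leNgt; apply/negP => H; apply: xP; rewrite inE; exact: Jpart_dist.
Qed.

Lemma Rintegral_J_part mu f r : 0 <= r -> (forall x, J x -> ~ Jpart r x -> f x = 0) ->
  \int[mu]_(x in J) f x = s * rint mu c (c + s * r) f.
Proof.
move=> r0 f0; rewrite -rint_Jpart//.
transitivity (\int[mu]_(x in J) (f \_ (Jpart r)) x).
  apply: eq_Rintegral => x; rewrite inE => Jx; rewrite patchE; case: ifPn => // /negP xP.
  by rewrite f0// => xP'; apply: xP; rewrite inE.
by rewrite -Rintegral_mkcondr setIidr//; exact: JpartS.
Qed.

Section regularity.
Variables (u u' u2 v v' v2 : R -> R).
Hypotheses (Pu : Prim u u') (Pv : Prim v v').
Hypotheses (Iu : L2on leb J u) (Iu' : L2on leb J u') (Iu2 : L2on upsilon J u2).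
Hypotheses (Iv : L2on leb J v) (Iv' : L2on leb J v') (Iv2 : L2on upsilon J v2).
Hypothesis Lv' : forall a b, L2on leb `[a, b[ v'.
Hypothesis test : forall k p h h' h2, rsolution k p h h' h2 -> square_integrable k p h h' h2 ->
  h c = 0 -> p c = 0 -> energy u u' u2 h h' h2 = energy v v' v2 k p h.

Let lu : lbm u. Proof. exact: Prim_lbm Pu. Qed.
Let lv : lbm v. Proof. exact: Prim_lbm Pv. Qed.
Let mJ' : measurable (J : set (measurableTypeR R)). Proof. exact: mJ. Qed.

(** The equation for the test solution is tested with v.  The boundary function is
    p v plus the integral of h v against omega, shifted so as to vanish at infinity;
    this is why the latter integral is the boundary term. *)
Lemma test_pairing h h' h2 r : 0 <= r -> Prim h h' ->
  (forall a b, L2on leb `[a, b[ h') -> (forall a b, L2on upsilon `[a, b[ h2) ->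
  L2on leb J h' -> L2on upsilon J h2 ->
  (forall x, r <= s * (x - c) -> [/\ h x = 0, h' x = 0 & h2 x = 0]) -> h c = 0 ->
  upsilon.-integrable J (EFin \o (fun t => v t * h2 t)) /\
  energy u u' u2 h h' h2 = s * rosint c (c + s * r) (fun t => h t * v t) +
    (\int[upsilon]_(t in J) (v t * h2 t)) + (\int[upsilon]_(t in J) (v2 t * h t)).
Proof.
move=> r0 Ph Lh' Lh2 Ih' Ih2 h0 hc.
have h2i := L2on_locint upsilon_lf Lh2.
have lh := Prim_lbm Ph.
have [k [p [Pk Hk pc Ik Ip]]] := test_exists 0 r0 Ph h2i h0.
have ki := Prim_locint Pk.
have lp := formula_momentum_lbm Ph h2i ki (integrated_eq_formula c Ph h2i ki Hk).
have hfar x : r <= s * (x - c) -> h x = 0 by move=> /h0[].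
have Ih : L2on leb J h by apply: L2on_far0 lh hfar; exact: lebesgue_locally_finite.
have Ih_u : L2on upsilon J h by apply: L2on_far0 lh hfar.
have ivh2 : upsilon.-integrable J (EFin \o (fun t => v t * h2 t)).
  have Lvp : L2on upsilon J (v \_ (Jpart r)).
    apply: L2on_patchT => //; first exact: mJpart.
    exact: L2on_half_line_part.
  apply: (le_integrable mJ' _ _ (L2onM mJ' Lvp Ih2)).
    apply/measurable_EFinP; apply: measurable_funM; [exact: measurable_funTS lv.1|by case: Ih2].
  move=> x Jx; rewrite /= lee_fin patchE; case: ifPn => // /negP xP.
  have [_ _ ->] : [/\ h x = 0, h' x = 0 & h2 x = 0].
    by apply: h0; rewrite leNgt; apply/negP => H; apply: xP; rewrite inE; exact: Jpart_dist.
  by rewrite !mulr0.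
split=> //.
rewrite (test (k := k) (p := p)) //.
have Phv := PrimM Ph Pv.
(* Q is the source primitive of h v, which gives its regularity. *)
pose Q x := rosint c x (fun t => h t * v t).
have z0 : locint upsilon (fun=> 0) by apply: lbm_locint => //; exact: lbm_cst.
have QE x : Q x = source (fun t => h t * v t) (fun x => h' x * v x + h x * v' x) (fun=> 0) x.
  have := rosint_source omega c Phv z0 c x.
  by rewrite (@rint0 _ upsilon c x (fun=> 0))// source_c addr0 subr0.
have Qc : Q c = 0 by rewrite QE source_c.
have Qfar x : r <= s * (x - c) -> Q x = Q (c + s * r).
  move=> rx; rewrite !QE; apply: source_far => // y /h0[-> -> _].
  by rewrite !mul0r addr0.
have lQ : lbm Q by rewrite (_ : Q = source (fun t => h t * v t) (fun x => h' x * v x + h x * v' x) (fun=> 0)); [exact: (source_lbm omega c Phv z0)|exact/funext].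
pose B x := p x * v x + (Q x - Q (c + s * r)).
have iB : leb.-integrable J (EFin \o B).
  apply: (intD mJ' (L2onM mJ' Ip Iv)); apply: (@integrable_far0 _ _ r).
  - exact: lebesgue_locally_finite.
  - by apply: lbmB => //; exact: lbm_cst.
  - by move=> x /Qfar ->; rewrite subrr.
have I1 := L2onM mJ' Ik Iv; have I2 := L2onM mJ' Ip Iv'.
have ik1 := intD mJ' (intZ mJ' 4^-1 I1) I2.
have jvh2 : locint upsilon (fun t => v t * h2 t) by exact: locintMl.
have ik2 : upsilon.-integrable J (EFin \o (fun t => -1 * (v t * h2 t))) by exact: intZ.
have Bc : - (s * B c) = s * Q (c + s * r) by rewrite /B pc Qc; ring.
have := boundary_value ik1 ik2 iB; rewrite Bc => EQ.
rewrite -[real_osint _ _ _ _]/(Q (c + s * r)) EQ //; last first.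
  move=> x _; rewrite (_ : B x - B c = p x * v x - p c * v c + Q x); last by rewrite /B Qc; ring.
  rewrite -[X in rint leb c x X]/(fun t => 4^-1 * (k t * v t) + p t * v' t).
  rewrite (half_green upsilon_lf c Pk Ph h2i Hk Pv) rintZ// -/(Q x).
  by ring.
rewrite (RintegralD mJ' (intZ mJ' 4^-1 I1) I2) (RintegralZl _ mJ' I1) (RintegralZl _ mJ' ivh2) /energy_form.
rewrite (_ : (fun x => v x * k x) = (fun x => k x * v x)); last by apply/funext => t; rewrite mulrC.
rewrite (_ : (fun x => v' x * p x) = (fun x => p x * v' x)); last by apply/funext => t; rewrite mulrC.
by ring.
Qed.

Let U x := rint leb c x u.
Let v2t : R -> R := v2 \_ J.
Let M := source v v' v2t.

Let Lv2t a b : L2on upsilon `[a, b[ v2t.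
Proof. exact: L2on_patchT. Qed.
Let v2ti : locint upsilon v2t. Proof. exact: L2on_locint. Qed.
Let PU : Prim U u. Proof. by apply: Prim_rint; exact: Prim_locint Pu. Qed.
Let lU : lbm U. Proof. exact: Prim_lbm PU. Qed.
Let lM : lbm M. Proof. exact: source_lbm. Qed.

(** Take h = 0 and h2 = u2 - v, cut off at distance r. *)
Lemma second_component : {ae upsilon, forall x, J x -> u2 x = v x}.
Proof.
suff H (n : nat) : {ae upsilon, forall x, Jpart n.+1%:R x -> u2 x = v x}.
  have := ae_foralln H; apply: aeS => x Hx Jx; apply: (Hx (Num.trunc (s * (x - c)))).
  by apply: Jpart_dist => //; exact: truncnS_gt.
pose r : R := n.+1%:R; rewrite -/r.
have r0 : 0 <= r by [].
have mP := mJpart c plus r.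
pose d x := u2 x - v x.
have Ld : L2on upsilon (Jpart r) d.
  apply: L2onB => //; first by apply: (L2on_sub mJ') Iu2 => //; exact: JpartS.
  exact: L2on_half_line_part.
pose h2 : R -> R := d \_ (Jpart r).
have r1 : 0 <= r + 1 by rewrite addr_ge0.
have h2far x : r + 1 <= s * (x - c) -> h2 x = 0.
  move=> rx; have /out_Jpart xP : r < s * (x - c) by rewrite (lt_le_trans _ rx)// ltrDl.
  by rewrite /h2 patchE; case: ifPn => //; rewrite inE.
have LJ : L2on upsilon J h2 by exact: L2on_patchT.
have [ivh2] := test_pairing r1 (Prim_cst 0) (fun a b => L2on0 leb _) (fun a b => L2on_patchT mP (measurable_itv _) Ld)
  (L2on0 leb J) LJ (fun x rx => And3 erefl erefl (h2far x rx)) erefl.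
rewrite /energy_form !Rintegral_mulr0 mulr0 !add0r addr0.
rewrite (_ : (fun t => 0 * v t) = (fun=> 0)); last by apply/funext => t; rewrite mul0r.
rewrite rosint0 mulr0 add0r => E.
have : \int[upsilon]_(x in J) (u2 x * h2 x - v x * h2 x) = 0.
  by rewrite (RintegralB mJ' (L2onM mJ' Iu2 LJ) ivh2) E subrr.
rewrite (_ : (fun x => u2 x * h2 x - v x * h2 x) = (fun x => d x * d x) \_ (Jpart r)); last first.
  apply/funext => x; rewrite /h2 patchE patchE -mulrBl -/(d x); case: ifP => // _; exact: mulr0.
rewrite -Rintegral_mkcondr setIidr; last exact: JpartS.
move=> /(sq_integral0 mP Ld); apply: aeS => x H /H /eqP.
by rewrite subr_eq0 => /eqP.
Qed.

Let q x := u' x - 4^-1 * U x + M x.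

Let qi : locint leb q.
Proof.
apply: locintD; last by apply: lbm_locint => //; exact: lebesgue_locally_finite.
apply: locintB; first by case: Pu.
by apply: lbm_locint; [exact: lebesgue_locally_finite|exact: lbmZ].
Qed.

(** Take h2 = 0 and for h the primitive of q - m cut off at distance r, where m is
    the mean value of q.  Then h vanishes beyond distance r and at c, and the test
    says that the integral of q h' is zero; as m h' has integral zero as well, q - m
    is orthogonal to itself. *)
Lemma momentum_constant_part (n : nat) : exists m, {ae leb, forall x, Jpart n.+1%:R x -> q x = m}.
Proof.
pose r : R := n.+1%:R; rewrite -/r.
have r0 : 0 <= r by [].
have mP := mJpart c plus r.
set b := c + s * r.
(* The cut off function may be nonzero at distance exactly r, so the test data
   are seen as supported up to distance r + 1. *)
pose r1 := r + 1; have r10 : 0 <= r1 by rewrite addr_ge0.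
have mP1 := mJpart c plus r1; set b1 := c + s * r1.
have rr1 : r <= r1 by rewrite lerDl.
have PP1 : Jpart r `<=` Jpart r1.
  by move=> x /JpartE H; apply/JpartE; move: H rr1; case: plus => /andP[? ?] ?; lra.
have [m mE] : exists m : R, m * (b - c) = rint leb c b q.
  exists (rint leb c b q / (b - c)); rewrite divfK// /b addrAC subrr add0r /outward.
  by case: plus; rewrite ?mul1r ?mulN1r ?oppr_eq0 pnatr_eq0.
exists m.
pose d x : R := q x - m.
have Lq : L2on leb (Jpart r) q.
  have lbmL f : lbm f -> L2on leb (Jpart r) f.
    by move=> lf; apply: L2on_half_line_part => //; exact: lebesgue_locally_finite.
  apply: L2onD => //; last exact: lbmL.
  apply: L2onB => //; first by apply: (L2on_sub mJ') Iu' => //; exact: JpartS.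
  exact/lbmL/lbmZ.
have Ld : L2on leb (Jpart r) d.
  apply: L2onB => //; apply: L2on_half_line_part; [exact: lebesgue_locally_finite|exact: lbm_cst].
pose h' : R -> R := d \_ (Jpart r).
have Lh' a e : L2on leb `[a, e[ h' by exact: L2on_patchT.
have h'i : locint leb h' by apply: L2on_locint => //; exact: lebesgue_locally_finite.
pose h x := rint leb c x h'.
have Ph : Prim h h' by exact: Prim_rint.
have h'far x : r1 <= s * (x - c) -> h' x = 0.
  move=> rx; have /out_Jpart xP : r < s * (x - c) by rewrite (lt_le_trans _ rx)// ltrDl.
  by rewrite /h' patchE; case: ifPn => //; rewrite inE.
have h'd t : Num.min c b <= t < Num.max c b -> h' t = d t.
  by move=> /(between_Jpart c plus t r0).1 tP; rewrite /h' patchE mem_set.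
have ci : locint leb (fun=> m).
  by apply: lbm_locint; [exact: lebesgue_locally_finite|exact: lbm_cst].
have hb : h b1 = 0.
  rewrite /h -(rint_cat h'i c b b1) [X in _ + X]rint0 ?addr0; last first.
    move=> t /out_Jpart_between tP; rewrite /h' patchE memNset//; apply: tP.
    by rewrite far_endpoint.
  rewrite (@rint_eq _ leb c b h' d h'd) /d rintB// -mE.
  by rewrite rint_cst subrr.
have hc : h c = 0 by rewrite /h rintxx.
have hfar x : r1 <= s * (x - c) -> h x = 0 by move=> rx; rewrite /h (rint_far h'i h'far rx).
have [_] := test_pairing r10 Ph Lh' (fun a b => L2on0 upsilon _) (L2on_patchT mP mJ' Ld) (L2on0 upsilon J)
  (fun x rx => And3 (hfar x rx) (h'far x rx) erefl) hc.
rewrite /energy_form !Rintegral_mulr0 addr0 addr0.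
have hP x : J x -> ~ Jpart r1 x -> h x = 0.
  move=> Jx xP; apply: hfar; rewrite leNgt; apply/negP => H; apply: xP; exact: Jpart_dist.
have h'P x : J x -> ~ Jpart r1 x -> h' x = 0.
  by move=> Jx xP; apply: h'far; rewrite leNgt; apply/negP => H; apply: xP; exact: Jpart_dist.
rewrite (@Rintegral_J_part leb _ r1 r10); last by move=> x Jx /(hP _ Jx) ->; rewrite mulr0.
rewrite (@Rintegral_J_part leb _ r1 r10); last by move=> x Jx /(h'P _ Jx) ->; rewrite mulr0.
rewrite (@Rintegral_J_part upsilon _ r1 r10); last by move=> x Jx /(hP _ Jx) ->; rewrite mulr0.
rewrite -/b1.
rewrite (_ : (fun t => h t * v t) = (fun t => v t * h t)); last by apply/funext => t; rewrite mulrC.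
have -> : rint upsilon c b1 (fun x => v2 x * h x) = rint upsilon c b1 (fun x => h x * v2t x).
  apply: rint_eq => t /(between_Jpart c plus t r10).1 tP; rewrite /v2t patchE mem_set 1?mulrC//.
  exact: JpartS tP.
have E1 := source_pairing_oriented c b1 Pv v2ti Ph.
rewrite -/M hb hc !mul0r subrr sub0r in E1.
have E2 := rint_ibp c lebesgue_locally_finite (Prim_locint Pu) Ph c b1.
rewrite hb hc !mul0r subrr sub0r -/U in E2.
rewrite (_ : (fun x => u x * h x) = (fun x => h x * u x)); last by apply/funext => t; rewrite mulrC.
rewrite -mulrDr E1 E2 => E.
have sn0 : s != 0 by rewrite /outward; case: plus; rewrite ?oppr_eq0 oner_eq0.
have lh := Prim_lbm Ph.
have i1 : locint leb (fun t => h' t * U t) by under eq_fun do rewrite mulrC; exact: locintMl.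
have i2 : locint leb (fun t => h' t * M t) by under eq_fun do rewrite mulrC; exact: locintMl.
have E3 : rint leb c b1 (fun x => u' x * h' x) - 4^-1 * rint leb c b1 (fun t => h' t * U t) +
   rint leb c b1 (fun t => h' t * M t) = 0.
  apply: (mulfI sn0); rewrite mulr0; move: E.
  move: (rint leb c b1 (fun x => u' x * h' x)) (rint leb c b1 (fun t => h' t * U t))
    (rint leb c b1 (fun t => h' t * M t)) => A B C E.
  rewrite (_ : s * (A - 4^-1 * B + C) = (4^-1 * (s * - B) + s * A) - s * - C); last by ring.
  by rewrite E subrr.
have lL f : lbm f -> L2on leb (Jpart r1) f.
  by move=> lf; apply: L2on_half_line_part => //; exact: lebesgue_locally_finite.
have Lh'P : L2on leb (Jpart r1) h' by exact: L2on_patchT.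
have Lu'P : L2on leb (Jpart r1) u' by apply: (L2on_sub mJ') Iu' => //; exact: JpartS.
have j1 := L2onM mP1 Lu'P Lh'P.
have j2 := intZ mP1 4^-1 (L2onM mP1 Lh'P (lL _ lU)).
have j3 := L2onM mP1 Lh'P (lL _ lM).
have j4 := intZ mP1 m (L2onM mP1 Lh'P (lL _ (lbm_cst 1))).
have j12 := intB mP1 j1 j2; have j123 := intD mP1 j12 j3.
have : \int[leb]_(x in Jpart r) (d x * d x) = 0.
  transitivity (\int[leb]_(x in Jpart r1) ((fun x => d x * d x) \_ (Jpart r)) x).
    by rewrite -Rintegral_mkcondr setIidr.
  transitivity (\int[leb]_(x in Jpart r1) ((u' x * h' x - 4^-1 * (h' x * U x) + h' x * M x) - m * (h' x * 1))).
    apply: eq_Rintegral => x xP; rewrite /h' !patch0 /d /q; case: ifP => _; ring.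
  rewrite (RintegralB mP1 j123 j4) (RintegralD mP1 j12 j3) (RintegralB mP1 j1 j2).
  rewrite (RintegralZl _ mP1 (L2onM mP1 Lh'P (lL _ lU))) (RintegralZl _ mP1 (L2onM mP1 Lh'P (lL _ (lbm_cst 1)))).
  rewrite !rint_Jpart// -/b1.
  rewrite (_ : (fun x => h' x * 1) = h'); last by apply/funext => t; rewrite mulr1.
  rewrite -[rint leb c b1 h']/(h b1) hb.
  transitivity (s * (rint leb c b1 (fun x => u' x * h' x) - 4^-1 * rint leb c b1 (fun t => h' t * U t) +
   rint leb c b1 (fun t => h' t * M t))); first by ring.
  by rewrite E3 mulr0.
by move=> /(sq_integral0 mP Ld); apply: aeS => x H /H /eqP; rewrite subr_eq0 => /eqP.
Qed.

Lemma momentum_constant : exists C, {ae leb, forall x, J x -> q x = C}.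
Proof.
have [m mE] := choice momentum_constant_part.
have m0 n : m n = m 0.
  have H : rint leb c (c + s * 1) (fun=> m n) = rint leb c (c + s * 1) (fun=> m 0).
    apply: rint_ae_nm; have := mE n; have := mE 0; apply: aeS2 => x H0 Hn /(between_Jpart c plus x ler01).1 xP.
    rewrite -H0// -Hn//; move: xP => /JpartE xP; apply/JpartE.
    have n1 : 1 <= n.+1%:R :> R by rewrite ler1n.
    by move: xP n1; case: plus => /andP[? ?] ?; lra.
  move: H; rewrite !rint_cst (_ : c + s * 1 - c = s); last by ring.
  move=> /mulIf; apply; rewrite /outward; case: plus; rewrite ?oppr_eq0 oner_eq0//.
exists (m 0); have := ae_foralln mE; apply: aeS => x Hx Jx.
rewrite -(m0 (Num.trunc (s * (x - c)))); apply: Hx.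
by apply: Jpart_dist => //; exact: truncnS_gt.
Qed.

(** A solution w with the right data exists on the whole line.  On the half-line it
    agrees with u, since the two modes of the difference w - u satisfy homogeneous
    equations and vanish at c. *)
Lemma adjoint_solution : {ae upsilon, forall x, J x -> u2 x = v x} /\
  exists w pw, rsolution w pw v v' v2t /\ forall x, J x -> w x = u x.
Proof.
split; first exact: second_component.
have [C HC] := momentum_constant.
(* These initial values give w c = u c and a momentum of w equal to C at c. *)
have [D1 P1 D1c] := mode_exists c (1 / 2) (C + u c / 2) lM.
have [D2 P2 D2c] := mode_exists c (- 1 / 2) (C - u c / 2) lM.
have [] := modes_solution c (expr1n R 2) P1 P2.
set w := (fun x => 1 * (D1 x - D2 x)); set pw := (fun x => (D1 x + D2 x) / 2 - M x) => Pw pwE.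
have wi := Prim_locint Pw.
have wc : w c = u c by rewrite /w D1c D2c; field.
have cE : (D1 c + D2 c) / 2 = C by rewrite D1c D2c; field.
exists w, pw; split.
  by split=> //; exact: (formula_integrated_eq (k := (D1 c + D2 c) / 2) Pv v2ti wi pwE).
have Pd := PrimB Pw Pu.
have Pe := PrimZ 4^-1 (PrimB (Prim_rint c wi) PU).
have aeE : {ae leb, forall t, J t -> pw t - u' t = 4^-1 * (rint leb c t w - U t)}.
  by move: HC; apply: aeS => t H /H; rewrite /pw pwE cE /q => <-; field.
move=> x Jx.
have inJ t : Num.min c x <= t < Num.max c x -> J t by exact: J_between.
have E1 : 4^-1 * (rint leb c x w - U x) + 2^-1 * (w x - u x) = 0.
  apply: (mode_unique (c := c) (k := 1 / 2) (PrimD Pe (PrimZ 2^-1 Pd))).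
    by move: aeE; apply: aeS => t H /inJ/H ->; field.
  by rewrite rintxx /U rintxx wc; ring.
have E2 : 4^-1 * (rint leb c x w - U x) - 2^-1 * (w x - u x) = 0.
  apply: (mode_unique (c := c) (k := - 1 / 2) (PrimB Pe (PrimZ 2^-1 Pd))).
    by move: aeE; apply: aeS => t H /inJ/H ->; field.
  by rewrite rintxx /U rintxx wc; ring.
by apply/eqP; rewrite -subr_eq0; apply/eqP; lra.
Qed.
End regularity.
End adjoint_regularity.

(** * The relations over the reals *)

Section realH.
Context {R : realType}.
Implicit Types (mu : {measure set (measurableTypeR R) -> \bar R}) (D : set (measurableTypeR R)).
Implicit Types (f g h k p q u v w : R -> R) (a b x y z r : R).
Local Notation leb := (@lebesgue_measure R).

Lemma L2on_ae mu D f g : measurable D -> measurable_fun D g -> {ae mu, forall x, D x -> f x = g x} ->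
  L2on mu D f -> L2on mu D g.
Proof.
move=> mD mg fg [mf /integrableP[_ fi]]; split=> //; apply/integrableP; split.
  by apply/measurable_EFinP; exact: measurable_funX.
apply: le_lt_trans fi; rewrite le_eqVlt; apply/orP; left; apply/eqP.
apply: ae_eq_integral => //.
- by apply: measurableT_comp => //; apply/measurable_EFinP; exact: measurable_funX.
- by apply: measurableT_comp => //; apply/measurable_EFinP; exact: measurable_funX.
- by move: fg; apply: aeS => x H /H /= ->.
Qed.

Lemma lbm_L2on_closed mu a b f : locally_finite mu -> lbm f -> L2on mu `[a, b] f.
Proof.
move=> lmu lf; apply: (@L2on_sub _ _ `[a, b + 1[) => //; last exact: L2on_lbm.
by move=> x; rewrite /= !in_itv/= => /andP[-> xb]; rewrite (le_lt_trans xb)// ltrDl.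
Qed.

Lemma ae_ne (x0 : R) : {ae leb, forall x, x != x0}.
Proof.
exists [set x0]; split; [exact: measurable_set1|exact: lebesgue_measure_set1|].
by move=> x /= /negP; rewrite negbK => /eqP.
Qed.

Lemma AC_Prim f h x y : x <= y -> abs_continuous x y f -> locint leb h ->
  {ae leb, forall t, x < t < y -> is_derive t 1 f (h t)} -> f y - f x = rint leb x y h.
Proof. by move=> xy acf hi df; rewrite rint_le//; exact: FTC2_abs_continuous. Qed.

Definition real_AC (J : set R) f := forall a b, `[a, b] `<=` J -> abs_continuous a b f.

Definition real_H1 (J : set R) f :=
  [/\ real_AC J f, L2on leb J f &
    exists2 h, {ae leb, forall x, J x -> is_derive x 1 f (h x)} & L2on leb J h].

Definition real_H1loc f := real_AC setT f /\
  exists2 h, {ae leb, forall x, setT x -> is_derive x 1 f (h x)} & forall a b, L2on leb `[a, b] h.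

Lemma H1loc_Prim f : real_H1loc f -> exists2 f', Prim f f' & forall a b, L2on leb `[a, b[ f'.
Proof.
move=> [acf [h df Lh]]; exists h; last first.
  by move=> a b; apply: L2on_sub (Lh a b) => // x; rewrite /= !in_itv/= => /andP[-> /ltW].
have hi : locint leb h.
  apply: L2on_locint; first exact: lebesgue_locally_finite.
  by move=> a b; apply: L2on_sub (Lh a b) => // x; rewrite /= !in_itv/= => /andP[-> /ltW].
have H x y : x <= y -> f y - f x = rint leb x y h.
  move=> xy; apply: AC_Prim => //; first exact: acf.
  by move: df; apply: aeS => t H _; exact: H.
split=> // x y; case: (leP x y) => [|/ltW yx]; first exact: H.
by rewrite rintC -(H _ _ yx) opprB.
Qed.

Lemma Prim_H1loc f f' : Prim f f' -> (forall a b, L2on leb `[a, b] f') -> real_H1loc f.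
Proof.
move=> Pf Lf'; split; first by move=> a b _; exact: Prim_abs_continuous Pf.
by exists f' => //; have := Prim_ae_derive Pf; apply: aeS => x ? _.
Qed.

Lemma Prim_H1 (J : set (measurableTypeR R)) f f' : Prim f f' -> L2on leb J f -> L2on leb J f' -> real_H1 J f.
Proof.
move=> Pf Lf Lf'; split=> //; first by move=> a b _; exact: Prim_abs_continuous Pf.
by exists f' => //; have := Prim_ae_derive Pf; apply: aeS => x ? _.
Qed.

Section halfline_H1.
Variables (c : R) (plus : bool).
Local Notation J := (half_line plus c).
Local Notation s := (@outward R plus).

Let mJ' : measurable (J : set (measurableTypeR R)). Proof. exact: mJ. Qed.

Lemma J_interval a b x : J a -> J b -> a <= x <= b -> J x.
Proof. by move=> /JE Ja /JE Jb /andP[ax xb]; apply/JE; move: Ja Jb; case: plus => Ja Jb; lra. Qed.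

(** Outside of c, a point of the half-line has a neighbourhood in the half-line. *)
Lemma derive1_J f g : (forall x, J x -> f x = g x) -> {ae leb, forall x, J x -> derive1 f x = derive1 g x}.
Proof.
move=> fg; have := ae_ne c; apply: aeS => x xc Jx.
rewrite !derive1E; apply: near_eq_derive.
have : \forall y \near x, J y.
  have : \forall y \near x, (y - c) * (x - c) > 0.
    have cx : continuous (fun y : R => (y - c) * (x - c)).
      by move=> y; apply: cvgM; [apply: cvgB; [exact: cvg_id|exact: cvg_cst]|exact: cvg_cst].
    apply: (cvgr_gt _ (cx x)).
    by rewrite -expr2 exprn_even_gt0//= subr_eq0.
  apply: filterS => y; have /JE := Jx; move=> H1 H2; apply/JE; move: H1 H2 xc; rewrite neq_lt.
  by case: plus => H1 H2 /orP[H3|H3]; nra.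
by apply: filterS => y /fg.
Qed.

(** Extend the derivative by zero and integrate it from a point of the half-line;
    the point at distance one serves both half-lines. *)
Lemma H1_global f : real_H1 J f ->
  exists F F', [/\ Prim F F', (forall x, J x -> F x = f x), (forall a b, L2on leb `[a, b[ F') & L2on leb J F'].
Proof.
move=> [acf Lf [h df Lh]].
pose F' := (h \_ J : R -> R); pose x0 := c + s.
have Jx0 : J x0 by apply/JE; rewrite /x0 /outward; case: plus; lra.
have LF a b : L2on leb `[a, b[ F' by exact: L2on_patchT.
have LJ : L2on leb J F' by exact: L2on_patchT.
have F'i : locint leb F' by apply: L2on_locint => //; exact: lebesgue_locally_finite.
have H x y : x <= y -> J x -> J y -> f y - f x = rint leb x y F'.
  move=> xy Jx Jy; apply: AC_Prim => //.
    by apply: acf => t; rewrite /= in_itv/=; exact: J_interval.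
  move: df; apply: aeS => t Ht /andP[xt ty].
  have Jt : J t by apply: (J_interval Jx Jy); rewrite !ltW.
  by rewrite /F' patchE mem_set//; exact: Ht.
exists (fun x => f x0 + rint leb x0 x F'), F'; split=> //.
  have := PrimD (Prim_cst (f x0)) (Prim_rint x0 F'i); congr Prim.
  by apply/funext => x; rewrite add0r.
move=> x Jx; case: (leP x0 x) => [xx|/ltW xx]; first by rewrite -(H _ _ xx)// addrC subrK.
by rewrite rintC -(H _ _ xx)// opprB addrC subrK.
Qed.

Lemma Prim_J_derive F F' f : Prim F F' -> (forall x, J x -> F x = f x) ->
  {ae leb, forall x, J x -> derive1 f x = F' x}.
Proof.
move=> PF /derive1_J; apply: aeS2 (Prim_derive1 PF) => x E1 H Jx.
by rewrite -(H Jx).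
Qed.

Variables (omega : lf_signed_measure R) (upsilon : {measure set (measurableTypeR R) -> \bar R}).
Hypothesis upsilon_lf : locally_finite upsilon.
Local Notation rsolution := (rsolution omega upsilon).
Local Notation square_integrable := (square_integrable upsilon c plus).
Local Notation energy := (energy_form upsilon c plus).

Definition rvec : Type := ((R -> R) * (R -> R))%type.
Implicit Types (e d : rvec) (E K L : rvec * rvec).

Definition real_H e := real_H1 J e.1 /\ L2on upsilon J e.2.

Definition real_inner e d := 4^-1 * (\int[leb]_(x in J) (e.1 x * d.1 x)) +
  (\int[leb]_(x in J) (derive1 e.1 x * derive1 d.1 x)) + (\int[upsilon]_(x in J) (e.2 x * d.2 x)).

(** The witnesses are a pair in the relation on the whole line that restricts to E. *)
Definition represents (k p h h' h2 : R -> R) E := [/\ rsolution k p h h' h2,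
  (forall x, J x -> E.1.1 x = k x), (forall x, J x -> E.2.1 x = h x),
  {ae upsilon, forall x, J x -> E.1.2 x = h x} & {ae upsilon, forall x, J x -> E.2.2 x = h2 x}].

Definition real_max E := [/\ real_H E.1, real_H E.2 & exists k p h h' h2, represents k p h h' h2 E].

Definition real_min E := [/\ real_H E.1, real_H E.2 &
  exists k p h h' h2, [/\ represents k p h h' h2 E, h c = 0 & p c = 0]].

Definition real_adjoint (S : rvec * rvec -> Prop) E := [/\ real_H E.1, real_H E.2 &
  forall K, S K -> real_inner E.1 K.2 = real_inner E.2 K.1].

Lemma real_inner_energy e d F F' f2 G G' g2 : Prim F F' -> Prim G G' ->
  (forall x, J x -> e.1 x = F x) -> (forall x, J x -> d.1 x = G x) ->
  {ae upsilon, forall x, J x -> e.2 x = f2 x} -> {ae upsilon, forall x, J x -> d.2 x = g2 x} ->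
  real_inner e d = energy F F' f2 G G' g2.
Proof.
move=> PF PG eF dG e2 d2; rewrite /real_inner /energy_form; congr (_ * _ + _ + _).
- by apply: eq_Rintegral => x; rewrite inE => Jx; rewrite eF ?dG.
- apply: Rintegral_J_eq.
  have H1 := Prim_J_derive PF (fun x Jx => esym (eF x Jx)).
  have H2 := Prim_J_derive PG (fun x Jx => esym (dG x Jx)).
  by move: H1 H2; apply: aeS2 => x A B Jx; rewrite A ?B.
- by apply: Rintegral_J_eq; move: e2 d2; apply: aeS2 => x A B Jx; rewrite A ?B.
Qed.

Lemma real_H1_Prim_L2 f F F' : real_H1 J f -> Prim F F' -> (forall x, J x -> f x = F x) ->
  L2on leb J F /\ L2on leb J F'.
Proof.
move=> Hf PF fF; have [_ Lf _] := Hf; split; first exact: L2on_eq Lf.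
have [K [K' [PK KF _ LK']]] := H1_global Hf.
apply: L2on_ae LK' => //; first by apply: measurable_funTS; exact: (locint_measurable PF.1).
have := Prim_J_derive PK (fun x Jx => etrans (KF x Jx) (fF x Jx)).
by apply: aeS2 (Prim_derive1 PF) => x A B Jx; rewrite -(B Jx).
Qed.

Lemma represents_square_integrable k p h h' h2 E : real_H E.1 -> real_H E.2 ->
  represents k p h h' h2 E -> square_integrable k p h h' h2.
Proof.
move=> [Hf Lf2] [Hg Lg2] [[Pk Ph Lh' Lh2 _] fk gh f2h g2h].
have [Lk Lp] := real_H1_Prim_L2 Hf Pk fk; have [Lh Lh'J] := real_H1_Prim_L2 Hg Ph gh.
split=> //; split.
  by apply: L2on_ae f2h Lf2 => //; apply: measurable_funTS; exact: (Prim_lbm Ph).1.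
apply: L2on_ae g2h Lg2 => //; apply: measurable_funTS; apply: locint_measurable (L2on_locint _ Lh2).
exact: upsilon_lf.
Qed.

(** Green's identity, where the choice of the representatives is irrelevant for the
    left-hand side. *)
Lemma real_inner_green k p h h' h2 l q m m' m2 E K : real_H E.1 -> real_H E.2 -> real_H K.1 -> real_H K.2 ->
  represents k p h h' h2 E -> represents l q m m' m2 K ->
  real_inner E.1 K.2 - real_inner E.2 K.1 = - (s * (p c * m c - q c * h c)).
Proof.
move=> E1 E2 K1 K2 rE rK.
have SE := represents_square_integrable E1 E2 rE; have SK := represents_square_integrable K1 K2 rK.
have [solE Ek Eh E2h Eh2] := rE; have [solK Kl Km K2m Km2] := rK.
have [Pk Ph _ _ _] := solE; have [Pl Pm _ _ _] := solK.
by rewrite -(green upsilon_lf solE SE solK SK); congr (_ - _); exact: real_inner_energy.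
Qed.

Lemma real_min_max E : real_min E -> real_max E.
Proof. by move=> [H1 H2 [k [p [h [h' [h2 [r _ _]]]]]]]; split=> //; exists k, p, h, h', h2. Qed.

Lemma real_min_adjoint_max E : real_min E -> real_adjoint real_max E.
Proof.
move=> [E1 E2 [k [p [h [h' [h2 [rE hc pc]]]]]]]; split=> // K [K1 K2 [l [q [m [m' [m2 rK]]]]]].
apply/eqP; rewrite -subr_eq0 (real_inner_green E1 E2 K1 K2 rE rK) hc pc; apply/eqP; ring.
Qed.

Lemma real_max_adjoint_min E : real_max E -> real_adjoint real_min E.
Proof.
move=> [E1 E2 [k [p [h [h' [h2 rE]]]]]]; split=> // K [K1 K2 [l [q [m [m' [m2 [rK mc qc]]]]]]].
apply/eqP; rewrite -subr_eq0 (real_inner_green E1 E2 K1 K2 rE rK) mc qc; apply/eqP; ring.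
Qed.

Lemma solution_H k p h h' h2 : rsolution k p h h' h2 -> square_integrable k p h h' h2 ->
  real_H (k, h) /\ real_H (h, h2).
Proof.
move=> [Pk Ph _ _ _] [Lk Lp Lh Lh' [Lhu Lh2]].
by split; split => //=; [exact: Prim_H1 Pk _ _|exact: Prim_H1 Ph _ _].
Qed.

Lemma solution_represents k p h h' h2 : rsolution k p h h' h2 ->
  represents k p h h' h2 ((k, h), (h, h2)).
Proof. by move=> sol; split=> //; apply: aeW. Qed.

(** Every test solution of adjoint_solution gives an element of the minimal
    relation. *)
Lemma real_adjoint_min_max E : real_adjoint real_min E -> real_max E.
Proof.
move=> [E1 E2 HE]; split=> //.
have [u [u' [Pu uE Lu' Ju']]] := H1_global E1.1.
have [v [v' [Pv vE Lv' Jv']]] := H1_global E2.1.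
have Lu := real_H1_Prim_L2 E1.1 Pu (fun x Jx => esym (uE x Jx)).
have Lv := real_H1_Prim_L2 E2.1 Pv (fun x Jx => esym (vE x Jx)).
have test k p h h' h2 : rsolution k p h h' h2 -> square_integrable k p h h' h2 ->
    h c = 0 -> p c = 0 -> energy u u' E.1.2 h h' h2 = energy v v' E.2.2 k p h.
  move=> sol sq hc pc; have [H1 H2] := solution_H sol sq; have [Pk Ph _ _ _] := sol.
  have <- : real_inner E.1 (h, h2) = energy u u' E.1.2 h h' h2.
    by apply: real_inner_energy => //; [move=> x /uE|apply: aeW|apply: aeW].
  have <- : real_inner E.2 (k, h) = energy v v' E.2.2 k p h.
    by apply: real_inner_energy => //; [move=> x /vE|apply: aeW|apply: aeW].
  apply: (HE ((k, h), (h, h2))); split=> //; exists k, p, h, h', h2; split=> //.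
  exact: solution_represents.
have [E12 [w [pw [sol wu]]]] := adjoint_solution upsilon_lf Pu Pv Lu.2 E1.2 Lv.1 Lv.2 E2.2 Lv' test.
exists w, pw, v, v', (E.2.2 \_ J); split=> //.
- by move=> x Jx; rewrite wu ?uE.
- by move=> x Jx; rewrite vE.
- by apply: aeW => x Jx; rewrite patchE mem_set.
Qed.

(** Elements of the maximal relation with prescribed values at c. *)
Lemma boundary_test h h' r beta : 0 <= r -> Prim h h' -> (forall a b, L2on leb `[a, b[ h') -> L2on leb J h' ->
  (forall x, r <= s * (x - c) -> h x = 0 /\ h' x = 0) ->
  exists k p, [/\ rsolution k p h h' (fun=> 0), square_integrable k p h h' (fun=> 0) & p c = beta].
Proof.
move=> r0 Ph Lh' Jh' h0; have lh := Prim_lbm Ph.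
have z0 : locint upsilon (fun=> 0) by apply: lbm_locint => //; exact: lbm_cst.
have h0' x : r <= s * (x - c) -> [/\ h x = 0, h' x = 0 & (0 : R) = 0] by move=> /h0[-> ->].
have [k [p [Pk sol pc Lk Lp]]] := test_exists omega beta r0 Ph z0 h0'.
exists k, p; split=> //; first by split=> // a b; exact: L2on0.
split=> //; first by apply: (L2on_far0 _ lh (fun x rx => (h0 x rx).1)); exact: lebesgue_locally_finite.
by split; [exact: (L2on_far0 _ lh (fun x rx => (h0 x rx).1))|exact: L2on0].
Qed.

Lemma cutoff_exists : exists h h', [/\ Prim h h', (forall a b, L2on leb `[a, b[ h'), L2on leb J h',
  (forall x, 2 <= s * (x - c) -> h x = 0 /\ h' x = 0) & h c = 1].
Proof.
have ss : s * s = 1 by rewrite -expr2 outward_sq.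
(* h decreases linearly from 1 at c to 0 at distance one. *)
pose h' := ((fun=> - s) \_ (half_line_part c plus 1) : R -> R).
have mP := mJpart c plus 1.
have Lc : L2on leb (half_line_part c plus 1) (fun=> - s).
  by apply: L2on_half_line_part; [exact: lebesgue_locally_finite|exact: lbm_cst].
have Lh' a b : L2on leb `[a, b[ h' by exact: L2on_patchT.
have h'i : locint leb h' by apply: L2on_locint => //; exact: lebesgue_locally_finite.
have far x : 2 <= s * (x - c) -> h' x = 0.
  move=> x2; rewrite /h' patchE memNset//; apply: out_Jpart.
  by rewrite (lt_le_trans _ x2)// ltr1n.
exists (fun x => 1 + rint leb c x h'), h'; split=> //.
- have := PrimD (Prim_cst 1) (Prim_rint c h'i); congr Prim.
  by apply/funext => x; rewrite add0r.
- exact: L2on_patchT.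
- move=> x x2; split; last exact: far.
  rewrite -(rint_cat h'i c (c + s * 1) x) [X in _ + (_ + X)]rint0; last first.
    move=> t /out_Jpart_between tP; rewrite /h' patchE memNset//; apply: tP.
    by rewrite (le_trans _ x2)// ler1n.
  rewrite (@rint_eq _ leb c (c + s * 1) h' (fun=> - s)); last first.
    by move=> t /(between_Jpart c plus t ler01).1 tP; rewrite /h' patchE mem_set.
  rewrite rint_cst addr0 (_ : - s * _ = - (s * s)); last by ring.
  by rewrite ss subrr.
- by rewrite rintxx addr0.
Qed.

(** By Green's identity the boundary form p m - q h of E with every element of the
    maximal relation is zero at c.  The values (m, q) = (0, 1) and (1, 0) are
    attained. *)
Lemma real_adjoint_max_min E : real_adjoint real_max E -> real_min E.
Proof.
move=> HE; have [E1 E2 EK] := HE.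
have [_ _ [k [p [h [h' [h2 rE]]]]]] : real_max E.
  by apply: real_adjoint_min_max; split=> // K /real_min_max/EK.
have key l q m m' m2 : rsolution l q m m' m2 -> square_integrable l q m m' m2 -> p c * m c = q c * h c.
  move=> sol sq; have [K1 K2] := solution_H sol sq; have rK := solution_represents sol.
  have /eqP := @real_inner_green _ _ _ _ _ _ _ _ _ _ E ((l, m), (m, m2)) E1 E2 K1 K2 rE rK.
  rewrite (EK ((l, m), (m, m2))); last by split=> //; exists l, q, m, m', m2.
  rewrite subrr eq_sym oppr_eq0 mulf_eq0 => /orP[|/eqP/subr0_eq//].
  by rewrite /outward; case: plus; rewrite ?oppr_eq0 oner_eq0.
have [h0 [h0' [Pm Lm Jm m0 mc]]] := cutoff_exists.
have hc : h c = 0.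
  have [l [q [sol sq qc]]] := boundary_test 1 (lexx 0) (Prim_cst 0) (fun a b => L2on0 leb _) (L2on0 leb J)
    (fun x _ => conj erefl erefl).
  by have := key _ _ _ _ _ sol sq; rewrite qc mulr0 mul1r.
have pc : p c = 0.
  have [l [q [sol sq qc]]] := boundary_test 0 (ler0n R 2) Pm Lm Jm m0.
  by have := key _ _ _ _ _ sol sq; rewrite mc mulr1 hc mulr0.
by split=> //; exists k, p, h, h', h2.
Qed.

(** The integral of t (f -+ g/t)^2 is nonnegative.  This form of the Cauchy-Schwarz
    inequality is linear in the integrals and so adds up over the three terms of
    the scalar product. *)
Lemma L2_young mu D f g (t : R) : measurable D -> L2on mu D f -> L2on mu D g -> 0 < t ->
  `|2 * (\int[mu]_(x in D) (f x * g x))| <= t * (\int[mu]_(x in D) (f x * f x)) + t^-1 * (\int[mu]_(x in D) (g x * g x)).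
Proof.
move=> mD Lf Lg t0.
have fg := L2onM mD Lf Lg; have ff := L2onM mD Lf Lf; have gg := L2onM mD Lg Lg.
have ti : t * t^-1 = 1 by rewrite mulfV// gt_eqF.
have r := intD mD (intZ mD t ff) (intZ mD t^-1 gg).
have H (e : R) : e * e = 1 -> e * (2 * (\int[mu]_(x in D) (f x * g x))) <=
    t * (\int[mu]_(x in D) (f x * f x)) + t^-1 * (\int[mu]_(x in D) (g x * g x)).
  move=> ee; rewrite mulrA -(RintegralZl _ mD fg) -(RintegralZl _ mD ff) -(RintegralZl _ mD gg).
  rewrite -(RintegralD mD (intZ mD t ff) (intZ mD t^-1 gg)).
  apply: le_Rintegral => //; first exact: intZ.
  move=> x Dx; rewrite -subr_ge0.
  rewrite (_ : _ - _ = t * (f x - e * t^-1 * g x) ^+ 2); first by rewrite mulr_ge0 ?sqr_ge0 ?ltW.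
  transitivity (t * (f x * f x) + (t * t^-1) * (e * e) * t^-1 * (g x * g x) - (t * t^-1) * e * 2 * (f x * g x)); last by ring.
  by rewrite ti ee; ring.
have H1 := H 1 (mulr1 1); have H2 := H (-1) (etrans (mulrNN 1 1) (mulr1 1)).
by rewrite ler_norml lerNl -mulN1r H2/= -[X in X <= _]mul1r.
Qed.

Definition real_sub e d : rvec := (fun x => e.1 x - d.1 x, fun x => e.2 x - d.2 x).

Lemma real_H_sub e d : real_H e -> real_H d -> real_H (real_sub e d).
Proof.
move=> [[ae Le [he de Lhe]] Le2] [[ad Ld [hd dd Lhd]] Ld2]; split; last exact: L2onB.
split; [|exact: L2onB|exists (fun x => he x - hd x)]; last exact: L2onB.
  move=> a b Jab z z0; have z2 : 0 < z / 2 by rewrite divr_gt0.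
  have [d1 d10 H1] := ae a b Jab _ z2; have [d2 d20 H2] := ad a b Jab _ z2.
  exists (Num.min d1 d2); first by rewrite lt_min d10.
  move=> n x y xy tI; rewrite lt_min => /andP[S1 S2].
  have := ltrD (H1 n x y xy tI S1) (H2 n x y xy tI S2); rewrite -splitr; apply: le_lt_trans.
  rewrite -big_split/=; apply: ler_sum => i _; rewrite -(normrN (d.1 _ - _)).
  by apply: le_trans (ler_normD _ _); rewrite le_eqVlt (_ : _ - _ = e.1 (y i) - e.1 (x i) + - (d.1 (y i) - d.1 (x i))) ?eqxx//; ring.
move: de dd; apply: aeS2 => x H1 H2 Jx.
have := H1 Jx; have := H2 Jx; move=> A B; exact: is_deriveB.
Qed.

Lemma real_H_global e : real_H e -> exists F F', [/\ Prim F F', (forall x, J x -> e.1 x = F x),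
  L2on leb J F, L2on leb J F' & L2on upsilon J e.2].
Proof.
move=> [He Le]; have [F [F' [PF FE _ JF]]] := H1_global He.
exists F, F'; split=> //; first by move=> x /FE.
exact: (real_H1_Prim_L2 He PF (fun x Jx => esym (FE x Jx))).1.
Qed.

Lemma real_inner_sub e d (n : rvec) : real_H e -> real_H d -> real_H n ->
  real_inner (real_sub e d) n = real_inner e n - real_inner d n.
Proof.
move=> /real_H_global[F [F' [PF eF LF LF' Le]]] /real_H_global[G [G' [PG dG LG LG' Ld]]].
move=> /real_H_global[K [K' [PK fK LK LK' Lf]]].
have r2 (g : R -> R) : {ae upsilon, forall x, J x -> g x = g x} by exact: aeW.
rewrite (real_inner_energy PF PK eF fK (r2 _) (r2 _)) (real_inner_energy PG PK dG fK (r2 _) (r2 _)).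
have sE x : J x -> (real_sub e d).1 x = F x - G x by move=> Jx; rewrite /= eF ?dG.
rewrite (real_inner_energy (PrimB PF PG) PK sE fK (r2 _) (r2 _)) /energy_form /=.
have B mu (a b k : R -> R) : L2on mu J a -> L2on mu J b -> L2on mu J k ->
    \int[mu]_(x in J) ((a x - b x) * k x) = (\int[mu]_(x in J) (a x * k x)) - \int[mu]_(x in J) (b x * k x).
  move=> La Lb Lk; rewrite -(RintegralB mJ' (L2onM mJ' La Lk) (L2onM mJ' Lb Lk)).
  by apply: eq_Rintegral => x _; rewrite mulrBl.
rewrite !B//; ring.
Qed.

Lemma real_inner_ge0 e : 0 <= real_inner e e.
Proof.
rewrite /real_inner !addr_ge0 ?mulr_ge0//; apply: Rintegral_ge0 => x _; rewrite -expr2 sqr_ge0//.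
Qed.

Lemma weighted_young_sum (t i a1 b1 c1 a2 b2 c2 a3 b3 c3 : R) : `|2 * c1| <= t * a1 + i * b1 ->
  `|2 * c2| <= t * a2 + i * b2 -> `|2 * c3| <= t * a3 + i * b3 ->
  `|2 * (4^-1 * c1 + c2 + c3)| <= t * (4^-1 * a1 + a2 + a3) + i * (4^-1 * b1 + b2 + b3).
Proof.
have -> : t * (4^-1 * a1 + a2 + a3) = 4^-1 * (t * a1) + t * a2 + t * a3 by ring.
have -> : i * (4^-1 * b1 + b2 + b3) = 4^-1 * (i * b1) + i * b2 + i * b3 by ring.
by rewrite !ler_norml => /andP[? ?] /andP[? ?] /andP[? ?]; apply/andP; split; lra.
Qed.

Lemma real_inner_young e d (t : R) : real_H e -> real_H d -> 0 < t ->
  `|2 * real_inner e d| <= t * real_inner e e + t^-1 * real_inner d d.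
Proof.
move=> /real_H_global[F [F' [PF eF LF LF' Le]]] /real_H_global[G [G' [PG dG LG LG' Ld]]] t0.
have r2 (g : R -> R) : {ae upsilon, forall x, J x -> g x = g x} by exact: aeW.
rewrite (real_inner_energy PF PG eF dG (r2 _) (r2 _)) (real_inner_energy PF PF eF eF (r2 _) (r2 _)).
rewrite (real_inner_energy PG PG dG dG (r2 _) (r2 _)) /energy_form.
exact: weighted_young_sum (L2_young mJ' LF LG t0) (L2_young mJ' LF' LG' t0) (L2_young mJ' Le Ld t0).
Qed.

(** The defect X of the adjoint identity is unchanged when K is subtracted from E,
    and is then small by the Cauchy-Schwarz inequality. *)
Lemma real_adjoint_closed S E : (forall K, S K -> real_H K.1 /\ real_H K.2) -> real_H E.1 -> real_H E.2 ->
  (forall z : R, 0 < z -> exists2 K, real_adjoint S K &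
    real_inner (real_sub E.1 K.1) (real_sub E.1 K.1) + real_inner (real_sub E.2 K.2) (real_sub E.2 K.2) < z) ->
  real_adjoint S E.
Proof.
move=> SH E1 E2 HE; split=> // L SL; have [L1 L2] := SH _ SL.
apply/eqP; rewrite -subr_eq0; apply: contrapT => /negP X0.
have [X XE] : exists X : R, X = real_inner E.1 L.2 - real_inner E.2 L.1 by eexists.
have [N NE] : exists N : R, N = real_inner L.1 L.1 + real_inner L.2 L.2 by eexists.
have N0 : 0 <= N by rewrite NE addr_ge0 ?real_inner_ge0.
rewrite -XE in X0; have aX : 0 < `|X| by rewrite normr_gt0.
(* With squared distance below 1/t^2 the two terms of the inequality are at most
   1/t and N/t, which add up to |X| although they bound 2 |X|. *)
have [t tE] : exists t : R, t = (N + 1) / `|X| by eexists.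
have t0 : 0 < t by rewrite tE divr_gt0// ltr_wpDl.
have t20 : 0 < t^-1 ^+ 2 by rewrite exprn_gt0// invr_gt0.
have [K [K1 K2 HK]] := HE _ t20.
have := real_inner_young (real_H_sub E1 K1) L2 t0; have := real_inner_young (real_H_sub E2 K2) L1 t0.
have -> : real_inner (real_sub E.1 K.1) L.2 = X + real_inner (real_sub E.2 K.2) L.1.
  rewrite (real_inner_sub E1 K1 L2) (real_inner_sub E2 K2 L1) XE (HK _ SL); ring.
move: (real_inner (real_sub E.2 K.2) L.1) (real_inner (real_sub E.1 K.1) (real_sub E.1 K.1))
  (real_inner (real_sub E.2 K.2) (real_sub E.2 K.2)) NE => Y A B NE H2 H1 AB.
have : t * (A + B) < t^-1.
  by rewrite (_ : t^-1 = t * t^-1 ^+ 2) ?ltr_pM2l// expr2 mulrA mulfV ?mul1r// gt_eqF.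
have : t^-1 * N + t^-1 = `|X|.
  rewrite -[X in _ + X]mulr1 -mulrDr tE invf_div divfK// gt_eqF// ltr_wpDl//.
have : `|2 * X| <= `|2 * (X + Y)| + `|2 * Y|.
  by rewrite -[`|2 * Y|]normrN; apply: le_trans (ler_normD _ _); rewrite le_eqVlt (_ : 2 * X = 2 * (X + Y) + - (2 * Y)) ?eqxx//; ring.
have : t^-1 * N = t^-1 * real_inner L.1 L.1 + t^-1 * real_inner L.2 L.2 by rewrite NE mulrDr.
rewrite (normrM 2 X) (ger0_norm (ler0n R 2)) (mulrDr t); move: H1 H2 aX.
move: (t * A) (t * B) (t^-1 * N) (t^-1 * real_inner L.1 L.1) (t^-1 * real_inner L.2 L.2) (`|2 * (X + Y)|) (`|2 * Y|) (`|X|) (t^-1).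
move=> a1 a2 a3 a4 a5 a6 a7 a8 a9; clear; lra.
Qed.
End halfline_H1.
End realH.

(** * Complex scalars *)

Section complex_case.
Local Open Scope complex_scope.
Context {R : realType}.
Implicit Types (mu : {measure set (measurableTypeR R) -> \bar R}) (D : set (measurableTypeR R)).
Implicit Types (a b x y : R) (i : bool) (z w : R[i]).
Local Notation leb := (@lebesgue_measure R).
Local Notation Re := complex.Re.
Local Notation Im := complex.Im.

(** A boolean index for real and imaginary parts lets one proof serve for both. *)
Definition part i z : R := if i then Im z else Re z.

Lemma partD i z w : part i (z + w) = part i z + part i w.
Proof. by case: i z w => [] [? ?] []. Qed.

Lemma partN i z : part i (- z) = - part i z.
Proof. by case: i z => [] []. Qed.

Lemma partMr i z (k : R) : part i (z * k%:C) = part i z * k.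
Proof. by case: i z => [] [x y] /=; rewrite mulr0 ?add0r ?subr0. Qed.

Lemma part_quarter i z : part i (4^-1 * z) = 4^-1 * part i z.
Proof.
have -> : (4^-1 : R[i]) = (4^-1)%:C by rewrite fmorphV rmorph_nat.
by rewrite mulrC partMr mulrC.
Qed.

Lemma part_inj z w : (forall i, part i z = part i w) -> z = w.
Proof. by move=> H; apply/eqP; rewrite eq_complex (H false : Re z = Re w) (H true : Im z = Im w) !eqxx. Qed.

Lemma part_cint i mu D (f : R -> R[i]) : part i (cint mu D f) = \int[mu]_(x in D) part i (f x).
Proof. by case: i. Qed.

Lemma part_oint i mu x y (f : R -> R[i]) : part i (oint mu x y f) = rint mu x y (fun t => part i (f t)).
Proof. by rewrite /oint /rint; case: ifP => _; rewrite ?partN part_cint. Qed.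

Lemma part_csint i omega x y (f : R -> R[i]) : part i (csint omega x y f) = sint omega x y (fun t => part i (f t)).
Proof. by case: i. Qed.

Lemma part_osint i omega x y (f : R -> R[i]) : part i (osint omega x y f) = real_osint omega x y (fun t => part i (f t)).
Proof. by rewrite /osint /real_osint; case: ifP => _; rewrite ?partN part_csint. Qed.

Lemma part_cderive1 i (f : R -> R[i]) x : part i (cderive1 f x) = derive1 (fun t => part i (f t)) x.
Proof. by case: i. Qed.

Definition cpair (f : bool -> R -> R) x : R[i] := f false x +i* f true x.

Lemma part_cpair i f x : part i (cpair f x) = f i x.
Proof. by case: i. Qed.

Lemma part_cpairE i f : (fun x => part i (cpair f x)) = f i.
Proof. by apply/funext => x; exact: part_cpair. Qed.

Lemma L2_parts mu D (f : R -> R[i]) : measurable D -> L2 mu D f <-> forall i, L2on mu D (fun x => part i (f x)).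
Proof.
move=> mD; split=> [[m0 m1 H] i|H].
  split; first by case: i.
  apply/integrableP; split; first by apply/measurable_EFinP/measurable_funX; case: i.
  apply: le_lt_trans H; apply: ge0_le_integral => //.
  - by apply: measurableT_comp => //; apply/measurable_EFinP/measurable_funX; case: i.
  - by apply/measurable_EFinP; apply: measurable_funD; exact: measurable_funX.
  - move=> x _; rewrite /= lee_fin ger0_norm ?sqr_ge0//.
    by case: i => /=; rewrite ?lerDl ?lerDr sqr_ge0.
have [m0 i0] := H false; have [m1 i1] := H true.
split=> //; have /integrableP[_] := integrableD mD i0 i1.
have m2 : measurable_fun D (fun x => Re (f x) ^+ 2 + Im (f x) ^+ 2).
  by apply: measurable_realfun.measurable_funD; exact: measurable_funX.
apply: le_lt_trans; apply: ge0_le_integral => //.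
- by move=> x _; rewrite lee_fin addr_ge0 ?sqr_ge0.
- exact/measurable_EFinP.
- apply: measurableT_comp => //; exact/measurable_EFinP.
- by move=> x _; rewrite lee_fin ler_norm.
Qed.

Lemma is_cderive_parts (f : R -> R[i]) x z : is_cderive f x z <-> forall i, is_derive x 1 (fun t => part i (f t)) (part i z).
Proof. by split=> [[? ?] []|H] //; split; [exact: (H false)|exact: (H true)]. Qed.

Lemma ae_forall_bool mu (P : bool -> R -> Prop) : (forall i, {ae mu, forall x, P i x}) -> {ae mu, forall x i, P i x}.
Proof. by move=> H; have := H false; have := H true; apply: aeS2 => x H1 H2 []. Qed.

Lemma H1J_parts (J : set (measurableTypeR R)) (f : R -> R[i]) : measurable J ->
  H1J J f <-> forall i, real_H1 J (fun x => part i (f x)).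
Proof.
move=> mJ; split=> [[ac Lf [h df Lh]] i|H].
  split; [|by have := (L2_parts _ _ mJ).1 Lf i|].
    by move=> a b /ac[H0 H1]; case: i.
  exists (fun x => part i (h x)); last by have := (L2_parts _ _ mJ).1 Lh i.
  by move: df; apply: aeS => x H /H /is_cderive_parts.
have Hh i : exists h : R -> R,
    {ae leb, forall x, J x -> is_derive x 1 (fun x => part i (f x)) (h x)} /\ L2on leb J h.
  by have [_ _ [h dh Lh]] := H i; exists h.
have [h {}Hh] := choice Hh.
split.
- by move=> a b Jab; split; [have [ac _ _] := H false|have [ac _ _] := H true]; exact: ac.
- by apply/L2_parts => // i; have [] := H i.
exists (cpair h); last by apply/L2_parts => // i; rewrite part_cpairE; have [] := Hh i.
have := ae_forall_bool (fun i => (Hh i).1); apply: aeS => x Hx Jx.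
by apply/is_cderive_parts => i; rewrite part_cpair; exact: Hx.
Qed.

Lemma H1loc_parts (f : R -> R[i]) : H1loc f <-> forall i, real_H1loc (fun x => part i (f x)).
Proof.
split=> [[ac [h df Lh]] i|H].
  split; first by move=> a b /ac[H0 H1]; case: i.
  exists (fun x => part i (h x)); last by move=> a b; have := (L2_parts _ _ (measurable_itv _)).1 (Lh a b) i.
  by move: df; apply: aeS => x H /H /is_cderive_parts.
have Hh i : exists h : R -> R,
    {ae leb, forall x, setT x -> is_derive x 1 (fun x => part i (f x)) (h x)} /\ forall a b, L2on leb `[a, b] h.
  by have [_ [h dh Lh]] := H i; exists h.
have [h {}Hh] := choice Hh.
split.
  by move=> a b Jab; split; [have [ac _] := H false|have [ac _] := H true]; exact: ac.
exists (cpair h); last by move=> a b; apply/L2_parts => // i; rewrite part_cpairE; have [] := Hh i.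
have := ae_forall_bool (fun i => (Hh i).1); apply: aeS => x Hx Jx.
by apply/is_cderive_parts => i; rewrite part_cpair; exact: Hx.
Qed.

Lemma part_cintM i mu D (f : R -> R[i]) (g : R -> R) :
  part i (cint mu D (fun x => f x * (g x)%:C)) = \int[mu]_(x in D) (part i (f x) * g x).
Proof. by rewrite part_cint; apply: eq_Rintegral => x _; rewrite partMr. Qed.

Lemma part_csintM i omega a b (f : R -> R[i]) (g : R -> R) :
  part i (csint omega a b (fun x => f x * (g x)%:C)) = sint omega a b (fun x => part i (f x) * g x).
Proof. by rewrite part_csint; congr (sint _ _ _ _); apply/funext => x; rewrite partMr. Qed.

Lemma L2on_closed mu (f : R -> R) : (forall a b, L2on mu `[a, b[ f) -> forall a b, L2on mu `[a, b] f.
Proof.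
move=> Lf a b; apply: L2on_sub (Lf a (b + 1)) => // x.
by rewrite /= !in_itv/= => /andP[-> xb]; rewrite (le_lt_trans xb)// ltrDl.
Qed.

Lemma L2on_halfopen mu (f : R -> R) : (forall a b, L2on mu `[a, b] f) -> forall a b, L2on mu `[a, b[ f.
Proof. by move=> Lf a b; apply: L2on_sub (Lf a b) => // x; rewrite /= !in_itv/= => /andP[-> /ltW]. Qed.

Section relations.
Variables (omega : lf_signed_measure R) (upsilon : {measure set (measurableTypeR R) -> \bar R}).
Hypothesis upsilon_lf : locally_finite upsilon.
Variables (c : R) (plus : bool).
Local Notation J := (half_line plus c).
Local Notation vec := (@vec R).
Implicit Types (f g : vec) (F G K : vec * vec).
Local Notation rsolution := (rsolution omega upsilon).
Local Notation real_H := (real_H c plus upsilon).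
Local Notation inner := (real_inner c plus upsilon).

Let mJ' : measurable (J : set (measurableTypeR R)). Proof. exact: mJ. Qed.

Definition vpart i f : @rvec R := (fun x => part i (f.1 x), fun x => part i (f.2 x)).
Definition ppart i F := (vpart i F.1, vpart i F.2).

Lemma HJ_parts f : HJ upsilon J f <-> forall i, real_H (vpart i f).
Proof.
split=> [[/(H1J_parts _ mJ') H1 /(L2_parts _ _ mJ') H2] i|H]; first by split; [exact: H1|exact: H2].
by split; [apply/H1J_parts => // i; case: (H i)|apply/L2_parts => // i; case: (H i)].
Qed.

Lemma distr_eq_parts f g : distr_eq omega upsilon f g <->
  forall i, distributional_eq omega upsilon (fun x => part i (f.1 x)) (fun x => part i (g.1 x)) (fun x => part i (g.2 x)).
Proof.
split=> [H i a b phi tphi|H a b phi tphi]; last apply: part_inj => i.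
  have /(congr1 (part i)) := H a b phi tphi.
  by rewrite !partD partN part_quarter !part_cintM part_csintM.
by rewrite !partD partN part_quarter !part_cintM part_csintM; exact: H.
Qed.

Lemma Tloc_Prim G : Tloc omega upsilon G -> forall i, exists u' h' : R -> R,
  [/\ Prim (fun x => part i (G.1.1 x)) u', Prim (fun x => part i (G.2.1 x)) h',
   (forall a b, L2on leb `[a, b[ h') & (forall a b, L2on upsilon `[a, b[ (fun x => part i (G.2.2 x)))].
Proof.
move=> [[/H1loc_parts f1 _] [/H1loc_parts g1 g2] _ _] i.
have [f' Pf Lf'] := H1loc_Prim (f1 i); have [g' Pg Lg'] := H1loc_Prim (g1 i).
exists f', g'; split=> //; apply: L2on_halfopen => a b.
by have := (L2_parts _ _ (measurable_itv _)).1 (g2 a b) i.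
Qed.

Lemma Tloc_solution G : Tloc omega upsilon G -> forall i, exists p h',
  rsolution (fun x => part i (G.1.1 x)) p (fun x => part i (G.2.1 x)) h' (fun x => part i (G.2.2 x)).
Proof.
move=> GT i; have [f' [g' [Pf Pg Lg' Lg2]]] := Tloc_Prim GT i.
have [_ _ /distr_eq_parts/(_ i) D _] := GT.
have [p Pp sol] := distributional_integrated upsilon_lf c Pf Pg (L2on_locint upsilon_lf Lg2) D.
by exists p, g'.
Qed.

Lemma Tloc_left_derivative G p : Tloc omega upsilon G -> left_derivative omega upsilon G p -> forall i, exists h',
  rsolution (fun x => part i (G.1.1 x)) (fun x => part i (p x)) (fun x => part i (G.2.1 x)) h' (fun x => part i (G.2.2 x)).
Proof.
move=> GT [pf pE] i; have [f' [g' [Pf Pg Lg' Lg2]]] := Tloc_Prim GT i.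
have sol : integrated_eq omega upsilon (fun x => part i (G.1.1 x)) (fun x => part i (G.2.1 x)) (fun x => part i (G.2.2 x)) (fun x => part i (p x)).
  move=> x y; have /(congr1 (part i)) := pE x y.
  by rewrite !partD partN part_quarter !part_oint part_osint.
exists g'; split=> //; apply: (integrated_eq_Prim c Pf Pg (L2on_locint upsilon_lf Lg2) sol).
by move: pf; apply: aeS => x ->; exact: part_cderive1.
Qed.

Section pairing.
Variables (k p h h' h2 : bool -> R -> R).
Hypothesis sol : forall i, rsolution (k i) (p i) (h i) (h' i) (h2 i).
Let G : vec * vec := ((cpair k, cpair h), (cpair h, cpair h2)).

Lemma Tloc_cpair : Tloc omega upsilon G.
Proof.
have Hh : H1loc (cpair h).
  apply/H1loc_parts => i; rewrite part_cpairE; have [_ Ph Lh' _ _] := sol i.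
  by apply: Prim_H1loc Ph _; exact: L2on_closed.
split; [split|split|apply/distr_eq_parts => i|exact: aeW] => //=.
- apply/H1loc_parts => i; rewrite part_cpairE; have [Pk Ph Lh' Lh2 H] := sol i.
  apply: (Prim_H1loc Pk) => a b; apply: lbm_L2on_closed; first exact: lebesgue_locally_finite.
  have h2i := L2on_locint upsilon_lf Lh2; have ki := Prim_locint Pk.
  exact: formula_momentum_lbm Ph h2i ki (integrated_eq_formula c Ph h2i ki H).
- move=> a b; apply/L2_parts => // i; rewrite part_cpairE; have [_ Ph _ _ _] := sol i.
  by apply: lbm_L2on_closed => //; exact: Prim_lbm Ph.
- by move=> a b; apply/L2_parts => // i; rewrite part_cpairE; have [_ _ _ Lh2 _] := sol i; exact: L2on_closed.
- have [Pk Ph Lh' Lh2 H] := sol i; rewrite /G /= !part_cpairE => a b phi tphi.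

  exact (integrated_distributional upsilon_lf c Pk Ph (L2on_locint upsilon_lf Lh2) H tphi).
Qed.

Lemma left_derivative_cpair : left_derivative omega upsilon G (cpair p).
Proof.
split.
  have : {ae leb, forall x i, p i x = derive1 (k i) x}.
    apply: ae_forall_bool => i; have [Pk _ _ _ _] := sol i.
    by have := Prim_derive1 Pk; apply: aeS => x ->.
  by apply: aeS => x H; apply: part_inj => i; rewrite part_cpair part_cderive1 part_cpairE.
move=> x y; apply: part_inj => i; have [_ _ _ _ H] := sol i.
by rewrite !partD partN part_quarter !part_oint part_osint !part_cpairE !part_cpair; exact: H.
Qed.
End pairing.

(** The two real parts have independent representatives, which are recombined into
    one complex representative. *)
Lemma Tmax_parts F : Tmax omega upsilon J F <-> forall i, real_max c plus omega upsilon (ppart i F).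
Proof.
split=> [[/HJ_parts F1 /HJ_parts F2 [G GT [[FG11 FG12] [FG21 FG22]]]] i|H].
  split; [exact: F1|exact: F2|].
  have [p [h' sol]] := Tloc_solution GT i; have [_ _ _ G12] := GT.
  exists (fun x => part i (G.1.1 x)), p, (fun x => part i (G.2.1 x)), h', (fun x => part i (G.2.2 x)).
  split=> //=.
  - by move=> x /FG11 ->.
  - by move=> x /FG21 ->.
  - by move: FG12 G12; apply: aeS2 => x A B /A ->; rewrite B.
  - by move: FG22; apply: aeS => x A /A ->.
have [k {}Hk] := choice (fun i => let: And3 _ _ e := H i in e).
have [p {}Hp] := choice Hk; have [h {}Hh] := choice Hp; have [h' {}Hh'] := choice Hh; have [h2 {}Hr] := choice Hh'.
split; [by apply/HJ_parts => i; have [] := H i|by apply/HJ_parts => i; have [] := H i|].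
exists ((cpair k, cpair h), (cpair h, cpair h2)).
  by apply: (@Tloc_cpair k p h h' h2) => i; have [] := Hr i.
split; split=> /=.
- by move=> x Jx; apply: part_inj => i; rewrite part_cpair; have [_ A _ _ _] := Hr i; exact: A.
- have : {ae upsilon, forall x i, J x -> part i (F.1.2 x) = h i x} by apply: ae_forall_bool => i; have [] := Hr i.
  by apply: aeS => x A Jx; apply: part_inj => i; rewrite part_cpair A.
- by move=> x Jx; apply: part_inj => i; rewrite part_cpair; have [_ _ A _ _] := Hr i; exact: A.
- have : {ae upsilon, forall x i, J x -> part i (F.2.2 x) = h2 i x} by apply: ae_forall_bool => i; have [] := Hr i.
  by apply: aeS => x A Jx; apply: part_inj => i; rewrite part_cpair A.
Qed.

Lemma Tmin_parts F : Tmin omega upsilon J c F <-> forall i, real_min c plus omega upsilon (ppart i F).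
Proof.
split=> [[[/HJ_parts F1 /HJ_parts F2 _] [G [p [GT [[FG11 FG12] [FG21 FG22]] GD hc pc]]]] i|H].
  split; [exact: F1|exact: F2|].
  have [h' sol] := Tloc_left_derivative GT GD i; have [_ _ _ G12] := GT.
  exists (fun x => part i (G.1.1 x)), (fun x => part i (p x)), (fun x => part i (G.2.1 x)), h', (fun x => part i (G.2.2 x)).
  split; [split=> //=|by rewrite hc; case: (i)|by rewrite pc; case: (i)].
  - by move=> x /FG11 ->.
  - by move=> x /FG21 ->.
  - by move: FG12 G12; apply: aeS2 => x A B /A ->; rewrite B.
  - by move: FG22; apply: aeS => x A /A ->.
split; first by apply/Tmax_parts => i; exact: real_min_max.
have [k {}Hk] := choice (fun i => let: And3 _ _ e := H i in e).
have [p {}Hp] := choice Hk; have [h {}Hh] := choice Hp; have [h' {}Hh'] := choice Hh; have [h2 {}Hr] := choice Hh'.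
have sol i : rsolution (k i) (p i) (h i) (h' i) (h2 i) by have [[]] := Hr i.
exists ((cpair k, cpair h), (cpair h, cpair h2)), (cpair p); split.
- exact: Tloc_cpair sol.
- split; split=> /=.
  + by move=> x Jx; apply: part_inj => i; rewrite part_cpair; have [[_ A _ _ _] _ _] := Hr i; exact: A.
  + have : {ae upsilon, forall x i, J x -> part i (F.1.2 x) = h i x} by apply: ae_forall_bool => i; have [[]] := Hr i.
    by apply: aeS => x A Jx; apply: part_inj => i; rewrite part_cpair A.
  + by move=> x Jx; apply: part_inj => i; rewrite part_cpair; have [[_ _ A _ _] _ _] := Hr i; exact: A.
  + have : {ae upsilon, forall x i, J x -> part i (F.2.2 x) = h2 i x} by apply: ae_forall_bool => i; have [[]] := Hr i.
    by apply: aeS => x A Jx; apply: part_inj => i; rewrite part_cpair A.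
- exact: left_derivative_cpair sol.
- by apply: part_inj => i; rewrite /= part_cpair; have [_ -> _] := Hr i; case: i.
- by apply: part_inj => i; rewrite /= part_cpair; have [_ _ ->] := Hr i; case: i.
Qed.

(** The form in which the square integrability of derivatives is available. *)
Definition almost_L2 mu (g : R -> R) := exists2 g0, L2on mu J g0 & {ae mu, forall x, J x -> g x = g0 x}.

Lemma almost_L2_dot mu (e : R) (g h k l : R -> R) : almost_L2 mu g -> almost_L2 mu h -> almost_L2 mu k -> almost_L2 mu l ->
  \int[mu]_(x in J) (g x * h x + e * (k x * l x)) =
  \int[mu]_(x in J) (g x * h x) + e * \int[mu]_(x in J) (k x * l x).
Proof.
move=> [g0 Lg gg] [h0 Lh hh] [k0 Lk kk] [l0 Ll ll].
have A := aeS2 (fun x => @conj (J x -> g x = g0 x) (J x -> h x = h0 x)) gg hh.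
have B := aeS2 (fun x => @conj (J x -> k x = k0 x) (J x -> l x = l0 x)) kk ll.
rewrite (@Rintegral_ae_nm _ mu J (fun x => g x * h x) (fun x => g0 x * h0 x)); last first.
  by move: A; apply: aeS => x [E1 E2] Jx; rewrite E1 ?E2.
rewrite (@Rintegral_ae_nm _ mu J (fun x => k x * l x) (fun x => k0 x * l0 x)); last first.
  by move: B; apply: aeS => x [E1 E2] Jx; rewrite E1 ?E2.
rewrite (@Rintegral_ae_nm _ mu J _ (fun x => g0 x * h0 x + e * (k0 x * l0 x))); last first.
  by move: A B; apply: aeS2 => x [E1 E2] [E3 E4] Jx; rewrite E1 ?E2 ?E3 ?E4.
have I1 := L2onM mJ' Lg Lh; have I2 := L2onM mJ' Lk Ll.
by rewrite (RintegralD mJ' I1 (intZ mJ' e I2)) (RintegralZl _ mJ' I2).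
Qed.

Lemma real_H_almost (e : rvec) : real_H e ->
  [/\ almost_L2 leb e.1, almost_L2 leb (derive1 e.1) & almost_L2 upsilon e.2].
Proof.
move=> /real_H_global[F [F' [PF eF LF LF' Le]]]; split.
- by exists F => //; apply: aeW.
- by exists F' => //; apply: (Prim_J_derive PF) => x /eF.
- by exists e.2 => //; apply: aeW.
Qed.

(** The scalar product is sesquilinear.  Integrability of the products is needed to
    split the integrals of its real and imaginary parts. *)
Lemma dotH_parts f g : HJ upsilon J f -> HJ upsilon J g ->
  part false (dotH upsilon J f g) = inner (vpart false f) (vpart false g) + inner (vpart true f) (vpart true g) /\
  part true (dotH upsilon J f g) = inner (vpart true f) (vpart false g) - inner (vpart false f) (vpart true g).
Proof.
move=> /HJ_parts Hf /HJ_parts Hg.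
have [f01 f0d f02] := real_H_almost (Hf false); have [f11 f1d f12] := real_H_almost (Hf true).
have [g01 g0d g02] := real_H_almost (Hg false); have [g11 g1d g12] := real_H_almost (Hg true).
have R0 z w : part false (z * w^*) = part false z * part false w + 1 * (part true z * part true w).
  by case: z w => [a b] [x y] /=; ring.
have R1 z w : part true (z * w^*) = part true z * part false w + -1 * (part false z * part true w).
  by case: z w => [a b] [x y] /=; ring.
have D0 mu (a b : R -> R[i]) : (forall i, almost_L2 mu (fun x => part i (a x))) -> (forall i, almost_L2 mu (fun x => part i (b x))) ->
    \int[mu]_(x in J) part false (a x * (b x)^*) =
    \int[mu]_(x in J) (part false (a x) * part false (b x)) + 1 * \int[mu]_(x in J) (part true (a x) * part true (b x)).
  by move=> La Lb; rewrite -almost_L2_dot//; apply: eq_Rintegral => x _; exact: R0.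
have D1 mu (a b : R -> R[i]) : (forall i, almost_L2 mu (fun x => part i (a x))) -> (forall i, almost_L2 mu (fun x => part i (b x))) ->
    \int[mu]_(x in J) part true (a x * (b x)^*) =
    \int[mu]_(x in J) (part true (a x) * part false (b x)) + -1 * \int[mu]_(x in J) (part false (a x) * part true (b x)).
  by move=> La Lb; rewrite -almost_L2_dot//; apply: eq_Rintegral => x _; exact: R1.
have f1 i : almost_L2 leb (fun x => part i (f.1 x)) by case: i.
have g1 i : almost_L2 leb (fun x => part i (g.1 x)) by case: i.
have fd i : almost_L2 leb (fun x => part i (cderive1 f.1 x)) by case: i.
have gd i : almost_L2 leb (fun x => part i (cderive1 g.1 x)) by case: i.
have f2 i : almost_L2 upsilon (fun x => part i (f.2 x)) by case: i.
have g2 i : almost_L2 upsilon (fun x => part i (g.2 x)) by case: i.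
have combine (e a0 a1 b0 b1 c0 c1 : R) : 4^-1 * (a0 + e * a1) + (b0 + e * b1) + (c0 + e * c1) =
    (4^-1 * a0 + b0 + c0) + e * (4^-1 * a1 + b1 + c1) by ring.
split; rewrite /dotH !partD part_quarter !part_cint.
  rewrite (D0 _ _ _ f1 g1) (D0 _ _ _ fd gd) (D0 _ _ _ f2 g2).
  by rewrite -[inner (vpart true f) _]mul1r; exact: combine.
rewrite (D1 _ _ _ f1 g1) (D1 _ _ _ fd gd) (D1 _ _ _ f2 g2).
by rewrite -[- inner _ _]mulN1r; exact: combine.
Qed.

Definition vpair (e : bool -> @rvec R) : vec := (cpair (fun i => (e i).1), cpair (fun i => (e i).2)).

Lemma vpart_vpair i e : vpart i (vpair e) = e i.
Proof. by rewrite /vpart /vpair /= !part_cpairE -surjective_pairing. Qed.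

Definition rzero : @rvec R := (fun=> 0, fun=> 0).

Lemma real_H_zero : real_H rzero.
Proof.
split; last exact: L2on0.
by apply: Prim_H1 (Prim_cst 0) _ _; exact: L2on0.
Qed.

Lemma zero_solution : rsolution (fun=> 0) (fun=> 0) (fun=> 0) (fun=> 0) (fun=> 0).
Proof.
split; [exact: Prim_cst|exact: Prim_cst|move=> ? ?; exact: L2on0|move=> ? ?; exact: L2on0|].
by move=> x y; rewrite (rosint0 omega upsilon_lf c) !rint0//; ring.
Qed.

Lemma real_min_zero : real_min c plus omega upsilon (rzero, rzero).
Proof.
split; [exact: real_H_zero|exact: real_H_zero|].
exists (fun=> 0), (fun=> 0), (fun=> 0), (fun=> 0), (fun=> 0); split=> //.
exact: (solution_represents c plus zero_solution).
Qed.

Lemma real_inner_zero e : inner e rzero = 0.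
Proof.
have d0 : derive1 (fun=> 0 : R) = (fun=> 0) by apply/funext => x; rewrite derive1_cst.
rewrite /real_inner /= d0.
by rewrite !Rintegral_mulr0 mulr0 !addr0.
Qed.

Section adjoint_parts.
Variables (S : set (vec * vec)) (SR : @rvec R * @rvec R -> Prop).
Hypotheses (S_parts : forall F, S F <-> forall i, SR (ppart i F)).
Hypotheses (SR0 : SR (rzero, rzero)) (SRH : forall E, SR E -> real_H E.1 /\ real_H E.2).

Lemma S_HJ F : S F -> HJ upsilon J F.1 /\ HJ upsilon J F.2.
Proof. by move=> /S_parts SF; split; apply/HJ_parts => i; have [] := SRH (SF i). Qed.

(** Testing with an element whose imaginary part is zero gives the adjoint condition
    for both parts; the converse is sesquilinearity. *)
Lemma adjoint_parts F : adjoint upsilon J S F <-> forall i, real_adjoint c plus upsilon SR (ppart i F).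
Proof.
split=> [[F1 F2 FK] i|H].
  split; [exact: (HJ_parts _).1 F1 i|exact: (HJ_parts _).1 F2 i|move=> K SK].
  pose e1 i := if i then rzero else K.1; pose e2 i := if i then rzero else K.2.
  have SK' : S (vpair e1, vpair e2).
    by apply/S_parts; case; rewrite /ppart /= !vpart_vpair//= -surjective_pairing.
  have [K1 K2] : HJ upsilon J (vpair e1) /\ HJ upsilon J (vpair e2) := S_HJ SK'.
  have E : dotH upsilon J F.1 (vpair e2) = dotH upsilon J F.2 (vpair e1) := FK _ SK'.
  have [A0 A1] := dotH_parts F1 K2; have [B0 B1] := dotH_parts F2 K1.
  move: A0 A1 B0 B1; rewrite E !vpart_vpair /e1 /e2 !real_inner_zero !addr0 !subr0 => A0 A1 B0 B1.
  by case: i; [rewrite -A1|rewrite -A0].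
have F1 : HJ upsilon J F.1 by apply/HJ_parts => i; have [] := H i.
have F2 : HJ upsilon J F.2 by apply/HJ_parts => i; have [] := H i.
split=> // K SK; have [K1 K2] := S_HJ SK; have /S_parts SK' := SK.
have [A0 A1] := dotH_parts F1 K2; have [B0 B1] := dotH_parts F2 K1.
have E i j : inner (vpart i F.1) (vpart j K.2) = inner (vpart i F.2) (vpart j K.1).
  by have [_ _ HK] := H i; exact: (HK _ (SK' j)).
by apply: part_inj => -[]; rewrite ?A0 ?A1 ?B0 ?B1 !E.
Qed.

Lemma adjoint_closed : closed_rel upsilon J (adjoint upsilon J S).
Proof.
move=> F F1 F2 HF; apply/adjoint_parts => i.
apply: (real_adjoint_closed SRH) => [||z z0]; [exact: (HJ_parts _).1 F1 i|exact: (HJ_parts _).1 F2 i|].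
have [K KS HK] := HF z z0; have /adjoint_parts KR := KS; have [K1 K2 _] := KS.
exists (ppart i K) => //; apply: le_lt_trans HK.
have subE j (f g : vec) : vpart j (vsub f g) = real_sub (vpart j f) (vpart j g).
  by congr pair; apply/funext => x; rewrite /= partD partN.
have key (f g : vec) : HJ upsilon J f -> HJ upsilon J g ->
    inner (real_sub (vpart i f) (vpart i g)) (real_sub (vpart i f) (vpart i g)) <= sqnormH upsilon J (vsub f g).
  move=> /HJ_parts Hf /HJ_parts Hg.
  have Hfg : HJ upsilon J (vsub f g) by apply/HJ_parts => j; rewrite subE; exact: real_H_sub.
  have := (dotH_parts Hfg Hfg).1; rewrite -[sqnormH _ _ _]/(part false _) => ->.
  by rewrite !subE; case: (i); rewrite ?lerDl ?lerDr real_inner_ge0.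
by apply: lerD; apply: key.
Qed.
End adjoint_parts.
End relations.
End complex_case.

Theorem theorem4p3 (R : realType) (omega : lf_signed_measure R)
    (upsilon : {measure set (measurableTypeR R) -> \bar R}) (upsilon_lf : locally_finite upsilon)
    (c : R) (plus : bool) :
  let J := half_line plus c in
  [/\ symmetric_rel upsilon J (Tmin omega upsilon J c),
      adjoint upsilon J (Tmin omega upsilon J c) = Tmax omega upsilon J,
      adjoint upsilon J (Tmax omega upsilon J) = Tmin omega upsilon J c,
      closed_rel upsilon J (Tmin omega upsilon J c) &
      closed_rel upsilon J (Tmax omega upsilon J)].
Proof.
move=> J.
have minH E : real_min c plus omega upsilon E -> real_H c plus upsilon E.1 /\ real_H c plus upsilon E.2 by case.
have maxH E : real_max c plus omega upsilon E -> real_H c plus upsilon E.1 /\ real_H c plus upsilon E.2 by case.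
have min0 := real_min_zero omega upsilon_lf c plus; have max0 := real_min_max min0.
have adj_min : adjoint upsilon J (Tmin omega upsilon J c) = Tmax omega upsilon J.
  apply/seteqP; split=> F.
    move=> /(adjoint_parts (Tmin_parts omega upsilon_lf c plus) min0 minH) H; apply/(Tmax_parts omega upsilon_lf c plus) => i; exact: (real_adjoint_min_max upsilon_lf).
  move=> /(Tmax_parts omega upsilon_lf c plus) H; apply/(adjoint_parts (Tmin_parts omega upsilon_lf c plus) min0 minH) => i; exact: (real_max_adjoint_min upsilon_lf).
have adj_max : adjoint upsilon J (Tmax omega upsilon J) = Tmin omega upsilon J c.
  apply/seteqP; split=> F.
    move=> /(adjoint_parts (Tmax_parts omega upsilon_lf c plus) max0 maxH) H; apply/(Tmin_parts omega upsilon_lf c plus) => i; exact: (real_adjoint_max_min upsilon_lf).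
  move=> /(Tmin_parts omega upsilon_lf c plus) H; apply/(adjoint_parts (Tmax_parts omega upsilon_lf c plus) max0 maxH) => i; exact: (real_min_adjoint_max upsilon_lf).
split=> //.
- by rewrite /symmetric_rel adj_min => F [].
- by rewrite -adj_max; exact: adjoint_closed (Tmax_parts omega upsilon_lf c plus) max0 maxH.
- by rewrite -adj_min; exact: adjoint_closed (Tmin_parts omega upsilon_lf c plus) min0 minH.
Qed.
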